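(* For every integer $n\ge 1$, the Ramanujan tau function satisfies \begin{align*} \tau(n) & = \frac{1}{73\times 3728}\Big[\frac{36387}{35} L_{12;8}(n) + 108\, L_{12;6}(n) + \frac{1}{3} \mathcal{L}_4(n) - \frac{32668}{12} L_{6;2}(n)\\ & \quad - 329680 \sum_{\substack{a,b \in \mathbb{N}\\ a+b=n}} \sigma_3(a) L_{8;4}(b) + 1372056 \sum_{\substack{a,b \in \mathbb{N}\\ a+b=n}} \sigma_5(a) L_{6;2}(b)\Big], \end{align*} where \begin{align*} L_{12;8}(n) &= \sum_{F_{8}(x_1,\ldots,x_{16})=n} \left(135 x_1^4 - 54 n x_1^2 + 2 n^2\right),\\ L_{12;6}(n) &= \sum_{F_{6}(x_1,\ldots,x_{12})=n} \left(162 x_1^6 - 162 n x_1^4 + 36 n^2 x_1^2- n^3\right),\\ L_{8;4}(n) &= \sum_{F_{4}(x_1,\ldots,x_{8})=n} \left(45 x_1^4 - 30 n x_1^2 + 2 n^2\right),\\ L_{6;2}(n) &= \sum_{F_{2}(x_1,\ldots,x_{4})=n} \left(9 x_1^4 - 9 n x_1^2 + n^2\right),\\ \mathcal{L}_4(n) &= \sum_{F_{4}(x_1,\ldots,x_{8})=n} \Big(164025\, x_1^8 - 306180\, n x_1^6 + 45(3780 n^2 -4121) x_1^4\\ &\qquad\qquad\qquad - 30(945 n^2 - 4121) n x_1^2 + 675 n^4 - 8242 n^2\Big), \end{align*} each sum being over all integer vectors $(x_1,\ldots,x_{2k})\in\mathbb{Z}^{2k}$ with $F_k(x_1,\ldots,x_{2k})=n$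 for the indicated $k$.
   Context: For a positive integer $k$, let $F_k(x_1,\ldots,x_{2k}) = \sum_{j=1}^k \left(x_{2j-1}^2 + x_{2j-1}x_{2j} + x_{2j}^2\right)$. $\mathbb{N}=\{1,2,3,\ldots\}$; $\sigma_r(n)=\sum_{d\mid n}d^r$. The Ramanujan tau function $\tau(n)$ is defined by $\sum_{n\ge1}\tau(n)q^n = q\prod_{n\ge1}(1-q^n)^{24}$. *)

(* Defs.v *)
From mathcomp Require Import all_boot all_order all_algebra.
From mathcomp Require Import boolp classical_sets cardinality fsbigop.
From mathcomp Require Import zify ring lra.

Import Order.TTheory GRing.Theory Num.Theory.

Local Open Scope classical_set_scope.
Local Open Scope ring_scope.

(* Coordinates are numbered from 0: x`_i stands for x_(i+1). *)
Definition F (k : nat) (x : (2 * k).-tuple int) : int :=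
  \sum_(j < k) (x`_(2 * j) ^+ 2 + x`_(2 * j) * x`_(2 * j).+1
                + x`_(2 * j).+1 ^+ 2).

Definition reps (k n : nat) : set ((2 * k).-tuple int) :=
  [set x | F k x = n%:Z].

Definition L12_8 (n : nat) : int :=
  \sum_(x \in reps 8 n)
    (135 * x`_0 ^+ 4 - 54 * n%:Z * x`_0 ^+ 2 + 2 * n%:Z ^+ 2).

Definition L12_6 (n : nat) : int :=
  \sum_(x \in reps 6 n)
    (162 * x`_0 ^+ 6 - 162 * n%:Z * x`_0 ^+ 4
     + 36 * n%:Z ^+ 2 * x`_0 ^+ 2 - n%:Z ^+ 3).

Definition L8_4 (n : nat) : int :=
  \sum_(x \in reps 4 n)
    (45 * x`_0 ^+ 4 - 30 * n%:Z * x`_0 ^+ 2 + 2 * n%:Z ^+ 2).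

Definition L6_2 (n : nat) : int :=
  \sum_(x \in reps 2 n)
    (9 * x`_0 ^+ 4 - 9 * n%:Z * x`_0 ^+ 2 + n%:Z ^+ 2).

(* Numerals above 5000 carry an explicit %:R, which parses them in nat_scope,
   where they stay symbolic; bare ring_scope ones unfold to unary numbers. *)
Definition calL4 (n : nat) : int :=
  \sum_(x \in reps 4 n)
    (164025%:R * x`_0 ^+ 8 - 306180%:R * n%:Z * x`_0 ^+ 6
     + 45 * (3780 * n%:Z ^+ 2 - 4121) * x`_0 ^+ 4
     - 30 * (945 * n%:Z ^+ 2 - 4121) * n%:Z * x`_0 ^+ 2
     + 675 * n%:Z ^+ 4 - 8242%:R * n%:Z ^+ 2).

Definition sigma (r n : nat) : nat := (\sum_(d <- divisors n) d ^ r)%N.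

(* The factors with m > n of the infinite product do not affect the
   coefficient of q^n; see tau_coef. *)
Definition tau (n : nat) : int :=
  ('X * \prod_(1 <= m < n.+1) (1 - 'X^m) ^+ 24 : {poly int})`_n.

Lemma tau_coef (n N : nat) : (n <= N)%N ->
  ('X * \prod_(1 <= m < N.+1) (1 - 'X^m) ^+ 24 : {poly int})`_n = tau n.
Proof.
move=> /subnKC <-; elim: (N - n)%N => [|d IHd]; first by rewrite addn0.
rewrite addnS big_nat_recr //= mulrA -[RHS]IHd; set p := 'X * _.
have [q ->] : exists q : {poly int},
    (1 - 'X^((n + d).+1)) ^+ 24 = 1 + 'X^(n.+1) * q.
  elim: 24%N => [|e [q IHe]]; first by exists 0; rewrite mulr0 addr0.
  exists (q - 'X^d - 'X^d * 'X^(n.+1) * q).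
  by rewrite exprS IHe -addSn exprD; ring.
by rewrite mulrDr mulr1 coefD mulrCA coefXnM ltnSn addr0.
Qed.

(* A finitely supported sum over an infinite support is 0 by convention; this
   lemma shows that the convention never applies to the sums above. *)
Lemma finite_reps (k n : nat) : finite_set (reps k n).
Proof.
pose g (t : (2 * k).-tuple 'I_(4 * n).+1) : (2 * k).-tuple int :=
  [tuple of [seq (val i)%:Z - (2 * n)%:Z | i <- t]].
apply: (@sub_finite_set _ _ (range g)); last exact: finite_image.
move=> x Fx; change (F k x = n%:Z) in Fx.
have form_ge0 (a b : int) : 0 <= a ^+ 2 + a * b + b ^+ 2 by nia.
have key (a b s : int) : 0 <= s ->
    a ^+ 2 + a * b + b ^+ 2 + s = n%:Z -> `|a| <= (2 * n)%N%:Z.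
  move=> s_ge0 eq_n; have : 3 * a ^+ 2 <= 4 * n%:Z.
    have := sqr_ge0 (a + 2 * b); nia.
  rewrite -real_normK ?num_real //; have := normr_ge0 a.
  move: `|a| => c c_ge0 le_n; rewrite leNgt; apply/negP => lt_c.
  have : (2 * n%:Z + 1) * c <= c ^+ 2 by nia.
  nia.
have bound i : (i < 2 * k)%N -> (`|x`_i| <= (2 * n)%N%:Z).
  move=> lti; have ltj : (i./2 < k)%N by lia.
  have := Fx; rewrite /F (bigD1 (Ordinal ltj)) //=.
  set s := \sum_(_ < _ | _) _.
  have s_ge0 : 0 <= s by apply: sumr_ge0 => j _; apply: form_ge0.
  have [->|->] : i = (2 * i./2)%N \/ i = (2 * i./2).+1 by lia.
    by rewrite (_ : (2 * i./2)./2 = i./2); [apply: key | lia].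
  rewrite (_ : (2 * i./2).+1./2 = i./2); last by lia.
  move: (x`_(2 * _)) (x`_(_.+1)) => a b eq_n.
  by apply: (key b a s s_ge0); rewrite -eq_n; ring.
exists [tuple inord `|(tnth x i + (2 * n)%N%:Z)%R|%N | i < 2 * k] => //.
apply: eq_from_tnth => i; rewrite tnth_map tnth_mktuple.
have := bound i (ltn_ord i); rewrite -tnth_nth.
move: (tnth x i) => y; rewrite ler_norml => /andP[le_y ge_y].
have y_ge0 : 0 <= y + (2 * n)%N%:Z by rewrite -lerBlDr sub0r.
rewrite /= inordK; first by rewrite gez0_abs // addrK.
by rewrite ltnS -lez_nat gez0_abs //; lia.
Qed.

(* Main.v *)
Require Import Defs.
From HB Require Import structures.
From mathcomp Require Import all_boot all_order all_algebra.
From mathcomp Require Import finmap boolp classical_sets functions cardinality fsbigop.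
From mathcomp Require Import zify ring lra.

Set Implicit Arguments.
Unset Strict Implicit.
Unset Printing Implicit Defensive.

Import Order.TTheory GRing.Theory Num.Theory.

Local Open Scope ring_scope.

(* Let Q(x, y) = x^2 + xy + y^2.  The generating series of the power sums of x_1
   are products of powers of the Borwein cubic theta function
   a = sum q^Q(x,y) with the series sum x^j q^Q(x,y).  Averaging over the
   rotations of the hexagonal lattice expresses the latter, for j <= 8, through
   the derivatives of a under D = q d/dq and the theta series h of the invariant
   harmonic polynomial of degree 6; the combinations in the statement are those
   in which the Eisenstein series E2 cancels.

   To compute in the ring generated by a, b, c and their D-derivatives, weight
   sum z^x q^Q(x,y) by a function of x - y modulo 3.  The resulting series b(z)
   and c(z) are quasi-periodic, and their zeros in z are those of an explicit
   product, so that their logarithmic derivatives in z are Lambert series; this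
   is proved by comparing coefficients, without any analysis.  The Taylor
   coefficients at z = 1 express D b, D c and h through divisor sums.  Series
   identities between f(q), f(q^3) and f(q^9) then follow from the uniqueness of
   solutions: a first-order equation determines a series from one coefficient,
   and an equation u(q) f(q) = v(q) f(q^3) with u(0) <> 0 forces f = 0 as soon
   as v(0) f(0) = 0.  This gives a^3 = b^3 + c^3, the derivatives of a, b and E2,
   E4 = 9 a^4 - 8 a b^3, E6 = -27 a^6 + 36 a^3 b^3 - 8 b^6, 9 h = 4 a b^3 c^3, and
   27 sum tau(n) q^n = b^9 c^3 (here c is a series in q^(1/3), and only c^3 is
   used).  The theorem becomes a polynomial identity in a and b. *)

(** * Formal power series *)

(** That f(z) vanishes at z = w is stated without evaluating anything: the product of f(z) with the
    formal delta series sum_m (z/w)^m, over all integers m, is 0. Cutting this series at m = 0 gives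
    the two opposite expansions of a geometric series, which is how zeros become a logarithmic
    derivative.

    Both b(z) and c(z) are needed because the sixth moment of either yields one equation in two
    unknown series, h and E6. Together the two equations determine the coefficients of both,
    alternately.

    The constants of the statement group as 329680 = 240 * 4121 / 3, 32668 / 12 = 8167 / 3 and
    1372056 = 504 * 8167 / 3. Hence the convolution sums, the part of calL4 carrying the factor 4121
    and the multiple of L_{6;2} amount to multiples of E4 times the series of L_{8;4} and of E6
    times the series of L_{6;2}. With y = b^3 and u = a^3 - b^3, every term then lies in the span of
    a^6 y u, a^3 y^2 u and y^3 u, and 27 sum tau(n) q^n is y^3 u. *)

Record fps (R : Type) := Fps { fps_coef :> nat -> R }.

Section PowerSeries.
Variable R : comNzRingType.
Implicit Types f g h : fps R.

Lemma fpsP f g : (forall n, f n = g n) -> f = g.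
Proof. by case: f g => [f] [g] /= /funext ->. Qed.

HB.instance Definition _ := gen_eqMixin (fps R).
HB.instance Definition _ := gen_choiceMixin (fps R).

Definition fps_add f g := Fps (fun n => f n + g n).
Definition fps_opp f := Fps (fun n => - f n).
Definition fps_zero : fps R := Fps (fun=> 0).
Definition fps_one : fps R := Fps (fun n => (n == 0%N)%:R).
Definition fps_mul f g := Fps (fun n => \sum_(i < n.+1) f i * g (n - i)%N).

Lemma fps_addA : associative fps_add.
Proof. by move=> f g h; apply: fpsP => n /=; rewrite addrA. Qed.

Lemma fps_addC : commutative fps_add.
Proof. by move=> f g; apply: fpsP => n /=; rewrite addrC. Qed.

Lemma fps_add0 : left_id fps_zero fps_add.
Proof. by move=> f; apply: fpsP => n /=; rewrite add0r. Qed.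

Lemma fps_addN : left_inverse fps_zero fps_opp fps_add.
Proof. by move=> f; apply: fpsP => n /=; rewrite addNr. Qed.

Definition fps_trunc N f : {poly R} := \poly_(i < N.+1) f i.

(** Reduces the ring axioms to those of [{poly R}]: coefficients up to N of a product only see the
    truncations of the factors. *)
Lemma fps_mul_trunc N n f g : (n <= N)%N ->
  fps_mul f g n = (fps_trunc N f * fps_trunc N g)`_n.
Proof.
move=> leN; rewrite coefM; apply: eq_bigr => i _; rewrite !coef_poly !ltnS.
by rewrite (leq_trans (leq_subr i n) leN) (leq_trans _ leN) // -ltnS.
Qed.

Lemma fps_mulA : associative fps_mul.
Proof.
move=> f g h; apply: fpsP => n; transitivity
  (fps_trunc n f * fps_trunc n g * fps_trunc n h)`_n.
  rewrite -mulrA coefM; apply: eq_bigr => i _.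
  by rewrite (fps_mul_trunc _ _ (leq_subr i n)) coef_poly ltn_ord.
rewrite coefM; apply: eq_bigr => i _.
have lein : (i <= n)%N by rewrite -ltnS.
by rewrite -(fps_mul_trunc f g lein) coef_poly ltnS leq_subr.
Qed.

Lemma fps_mulC : commutative fps_mul.
Proof.
by move=> f g; apply: fpsP => n; rewrite !(@fps_mul_trunc n n) // mulrC.
Qed.

Lemma fps_mul1 : left_id fps_one fps_mul.
Proof.
move=> f; apply: fpsP => n; rewrite /= big_ord_recl mul1r subn0.
by rewrite big1 ?addr0 // => i _; rewrite mul0r.
Qed.

Lemma fps_mulDl : left_distributive fps_mul fps_add.
Proof.
move=> f g h; apply: fpsP => n; rewrite /= -big_split.
by apply: eq_bigr => i _; rewrite mulrDl.
Qed.

Lemma fps_one_neq0 : fps_one != fps_zero.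
Proof. by apply/eqP => /(congr1 (fun f : fps R => f 0%N))/eqP; rewrite oner_eq0. Qed.

HB.instance Definition _ := GRing.isZmodule.Build (fps R)
  fps_addA fps_addC fps_add0 fps_addN.
HB.instance Definition _ := GRing.Zmodule_isComNzRing.Build (fps R)
  fps_mulA fps_mulC fps_mul1 fps_mulDl fps_one_neq0.

Lemma fpsD f g n : (f + g) n = f n + g n. Proof. by []. Qed.
Lemma fpsN f n : (- f) n = - f n. Proof. by []. Qed.
Lemma fps0 n : (0 : fps R) n = 0. Proof. by []. Qed.
Lemma fps1 n : (1 : fps R) n = (n == 0%N)%:R. Proof. by []. Qed.
Lemma fpsM f g n : (f * g) n = \sum_(i < n.+1) f i * g (n - i)%N. Proof. by []. Qed.
Lemma fpsMn f k n : (f *+ k) n = f n *+ k.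
Proof. by elim: k => // k IH; rewrite !mulrS fpsD IH. Qed.

Lemma fps_sum I (r : seq I) (P : pred I) (F : I -> fps R) n :
  (\sum_(i <- r | P i) F i) n = \sum_(i <- r | P i) F i n.
Proof. by elim/big_rec2: _ => // i x y _ <-. Qed.

Lemma fps_natM k f n : (k%:R * f) n = k%:R * f n.
Proof. by rewrite mulr_natl fpsMn mulr_natl. Qed.

End PowerSeries.

(** * The derivation q d/dq, the substitution q -> q^3, and uniqueness of solutions *)

Section Operators.
Implicit Types f g h u v : fps rat.

Definition fps_D f : fps rat := Fps (fun n => n%:R * f n).

Lemma fps_D_is_additive : {morph fps_D : f g / f - g}.
Proof. by move=> f g; apply: fpsP => n /=; rewrite mulrBr. Qed.
HB.instance Definition _ :=
  GRing.isZmodMorphism.Build (fps rat) (fps rat) fps_D fps_D_is_additive.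

Lemma fps_DE f n : fps_D f n = n%:R * f n. Proof. by []. Qed.

Lemma fps_DM f g : fps_D (f * g) = fps_D f * g + f * fps_D g.
Proof.
apply: fpsP => n; rewrite fpsD fps_DE !fpsM mulr_sumr -big_split.
apply: eq_bigr => -[i /= lein] _; rewrite -[in LHS](subnKC (ltnSE lein)) natrD.
by rewrite addKn; ring.
Qed.

Lemma fps_DX f n : fps_D (f ^+ n) = n%:R * (f ^+ n.-1 * fps_D f).
Proof.
elim: n => [|n IH]; first by apply: fpsP => -[|n]; rewrite !mul0r /= ?mul0r ?mulr0.
rewrite exprS fps_DM IH /= -natr1; case: n IH => [|n] _ /=; last by rewrite exprS; ring.
by rewrite expr0; ring.
Qed.

Lemma fps_Dn k : fps_D k%:R = 0.
Proof. by rewrite raddfMn /= -[1](expr0 1) fps_DX mul0r mul0rn. Qed.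

Definition fps_V f : fps rat :=
  Fps (fun n => if (3 %| n)%N then f (n %/ 3)%N else 0).

Lemma fps_VE f n : fps_V f (3 * n)%N = f n.
Proof. by rewrite /= dvdn_mulr // mulKn. Qed.

Lemma fps_VN f n : ~~ (3 %| n)%N -> fps_V f n = 0.
Proof. by move=> /negbTE /= ->. Qed.

Lemma fps_V0 f : fps_V f 0%N = f 0%N. Proof. exact: (fps_VE f 0). Qed.

Lemma fps_V_is_additive : {morph fps_V : f g / f - g}.
Proof. by move=> f g; apply: fpsP => n /=; case: ifP; rewrite ?subrr. Qed.

Lemma fps_V_is_multiplicative : monoid_morphism fps_V.
Proof.
split=> [|f g]; apply: fpsP => n.
  rewrite /= -(eqn_pmul2l (isT : 0 < 3)%N) muln0.
  by case: (boolP (3 %| n)%N) => [/dvdnP[k ->]|]; [rewrite mulnK // mulnC | case: n].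
have [/dvdnP[k ->]|n3] := boolP (3 %| n)%N; last first.
  rewrite fps_VN // fpsM big1 // => -[i /= lein] _.
  have [i3|i3] := boolP (3 %| i)%N; last by rewrite mul0r.
  by rewrite dvdn_subl ?(negbTE n3) ?mulr0.
rewrite mulnC fps_VE !fpsM.
rewrite -(big_mkord xpredT (fun i => fps_V f i * fps_V g (3 * k - i)%N)).
rewrite -(big_mkord xpredT (fun i => f i * g (k - i)%N)).
(* The upper limit is freed from k, so that induction on j appends three terms at a time, two of
   which vanish. *)
suff gen j : \sum_(0 <= i < (3 * j).+1) fps_V f i * fps_V g (3 * k - i)%N =
    \sum_(0 <= i < j.+1) f i * g (k - i)%N.
  by rewrite gen.
elim: j => [|j IH]; first by rewrite muln0 !big_nat1 !subn0 fps_V0 fps_VE.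
rewrite (_ : (3 * j.+1).+1 = (3 * j).+4); last lia.
rewrite big_nat_recr // [in RHS]big_nat_recr // -IH.
rewrite big_nat_recr // big_nat_recr //.
rewrite (@fps_VN f (3 * j).+1) ?(@fps_VN f (3 * j).+2) ?mul0r ?addr0; try lia.
rewrite (_ : (3 * j).+3 = (3 * j.+1)%N); last lia.
by rewrite -mulnBr !fps_VE /= !addr0.
Qed.
HB.instance Definition _ :=
  GRing.isZmodMorphism.Build (fps rat) (fps rat) fps_V fps_V_is_additive.
HB.instance Definition _ :=
  GRing.isMonoidMorphism.Build (fps rat) (fps rat) fps_V fps_V_is_multiplicative.

Lemma fps_VD f g : fps_V (f + g) = fps_V f + fps_V g. Proof. exact: raddfD. Qed.
Lemma fps_VB f g : fps_V (f - g) = fps_V f - fps_V g. Proof. exact: raddfB. Qed.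
Lemma fps_Vopp f : fps_V (- f) = - fps_V f. Proof. exact: raddfN. Qed.
Lemma fps_VM f g : fps_V (f * g) = fps_V f * fps_V g. Proof. exact: rmorphM. Qed.
Lemma fps_VX f n : fps_V (f ^+ n) = fps_V f ^+ n. Proof. exact: rmorphXn. Qed.
Lemma fps_VZ k f : fps_V (k%:R * f) = k%:R * fps_V f.
Proof. by rewrite fps_VM rmorph_nat. Qed.

Lemma fps_DV f : fps_D (fps_V f) = 3%:R * fps_V (fps_D f).
Proof.
rewrite mulr_natl; apply: fpsP => n; rewrite fpsMn fps_DE.
have [/dvdnP[k ->]|n3] := boolP (3 %| n)%N; last by rewrite !fps_VN ?mulr0 ?mul0rn.
by rewrite mulnC !fps_VE fps_DE natrM; ring.
Qed.

Lemma fps_V_inj : injective fps_V.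
Proof. by move=> f g eqV; apply: fpsP => n; rewrite -fps_VE eqV fps_VE. Qed.

Lemma fps_strong_ind f :
  (forall n, (forall m, (m < n)%N -> f m = 0) -> f n = 0) -> f = 0.
Proof.
move=> IH; apply: fpsP => n; rewrite fps0.
elim: n {-2}n (leqnn n) => [|k IHk] n len; apply: IH => m ltm.
  by case: n len ltm.
by apply: IHk; rewrite -ltnS (leq_trans ltm).
Qed.

Lemma fpsM_low f g n : (forall m, (m < n)%N -> g m = 0) ->
  (f * g) n = f 0%N * g n.
Proof.
move=> g0; rewrite fpsM big_ord_recl subn0 big1 ?addr0 // => i _.
by rewrite g0 ?mulr0 //= /bump; case: n i g0 => [[]//|n] i _; lia.
Qed.

Lemma fps_mul_eq0 f g m : f m != 0 -> f * g = 0 -> g = 0.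
Proof.
move=> fm0; have [|{fm0}m fm minm fg] := @ex_minnP (fun m => f m != 0).
  by exists m.
apply: fps_strong_ind => n IH; have := congr1 (fun h : fps rat => h (m + n)%N) fg.
rewrite /= (bigD1 (inord m)) //= inordK ?addKn; last by lia.
rewrite big1 ?addr0; first by move/eqP; rewrite mulf_eq0 (negbTE fm) => /eqP.
move=> i ne; have [lti|gti|eqi] := ltngtP i m.
- by rewrite (contraNeq (minm i)) ?mul0r // -ltnNge.
- by rewrite IH ?mulr0 //; have := ltn_ord i; lia.
by case/eqP: ne; apply: val_inj; rewrite /= inordK; lia.
Qed.

Lemma fps_mulI f g h m : f m != 0 -> f * g = f * h -> g = h.
Proof.
move=> fm /eqP; rewrite -subr_eq0 -mulrBr => /eqP/(fps_mul_eq0 fm)/eqP.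
by rewrite subr_eq0 => /eqP.
Qed.

Lemma fps_natI k f g : k.+1%:R * f = k.+1%:R * g -> f = g.
Proof.
by apply: (@fps_mulI _ _ _ 0); rewrite fpsMn fps1 mulr1n pnatr_eq0.
Qed.

(** Coefficient n of [v * fps_V f] only involves f k with 3 k <= n, so k < n except for k = n = 0,
    which is the case of the hypothesis on [v 0 * f 0]. *)
Lemma fps_V_eq0 u v f : u 0%N != 0 -> v 0%N * f 0%N = 0 -> u * f = v * fps_V f -> f = 0.
Proof.
move=> u0 v0f0 eqf; apply: fps_strong_ind => n IH.
have := fpsM_low u IH; rewrite eqf => uf; apply/eqP.
rewrite -(mulrI_eq0 _ (lregP u0)) -uf fpsM big1 // => -[i /= lein] _.
have [/dvdnP[k eqk]|n3] := boolP (3 %| n - i)%N; last by rewrite mulr0.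
rewrite eqk mulnK //; case: (ltnP k n) => [/IH->|lenk]; first by rewrite mulr0.
have -> : i = 0%N by lia.
by have -> : k = 0%N by lia.
Qed.

(** If the difference d vanishes below n, coefficient n of its equation reads k (n - m) d_n = 0, so
    only coefficient m is free. *)
Lemma fps_Dlog_uniq (k m : nat) f g h : (0 < k)%N -> h 0%N = (k * m)%:R -> f m = g m ->
  k%:R * fps_D f = h * f -> k%:R * fps_D g = h * g -> f = g.
Proof.
move=> k_gt0 h0 eqm Df Dg; apply/eqP; rewrite -subr_eq0; apply/eqP.
set d := f - g; have Dd : k%:R * fps_D d = h * d by rewrite raddfB /= !mulrBr Df Dg.
apply: fps_strong_ind => n /(fpsM_low h); rewrite -Dd h0 mulr_natl fpsMn fps_DE.
have [->|nem] := eqVneq n m; first by rewrite /d fpsD fpsN eqm subrr.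
move=> eqd; have /eqP : (k%:R * (n%:R - m%:R)) * d n = 0.
  by rewrite -mulrA mulrBl mulrBr [k%:R * (_ * _)]mulr_natl eqd natrM; ring.
rewrite !mulf_eq0 subr_eq0 eqr_nat (negbTE nem) pnatr_eq0.
by case: k k_gt0 {h0 Df Dg Dd eqd} => //= k _ /eqP.
Qed.

End Operators.

(** * Finitely supported sums *)

Section FiniteSums.
Implicit Types T U : choiceType.

Definition fsum T (F : T -> rat) : rat := \sum_(t \in [set: T]%classic) F t.

(** Since [fsum] is 0 on infinite supports, additivity and interchange of sums need this hypothesis;
    scaling and reindexing do not. *)
Definition fsupported T (F : T -> rat) :=
  exists r : seq T, forall t, F t != 0 -> t \in r.

Lemma eq_fsum T (F G : T -> rat) : F =1 G -> fsum F = fsum G.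
Proof. by move=> /funext ->. Qed.

Lemma fsum_seq T (r : seq T) (F : T -> rat) : uniq r ->
  (forall t, F t != 0 -> t \in r) -> fsum F = \sum_(t <- r) F t.
Proof.
move=> ur Fr; rewrite /fsum (fsbig_seq _ _ ur); apply/esym/fsbig_widen => //.
by move=> t [_ /negP tr]; apply/eqP; apply: contraNT tr => /Fr.
Qed.

Lemma fsum_undup T (r : seq T) (F : T -> rat) :
  (forall t, F t != 0 -> t \in r) -> fsum F = \sum_(t <- undup r) F t.
Proof.
by move=> Fr; apply: fsum_seq => [|t /Fr]; rewrite ?undup_uniq ?mem_undup.
Qed.

Lemma sub_fsupported T (F G : T -> rat) :
  (forall t, G t != 0 -> F t != 0) -> fsupported F -> fsupported G.
Proof. by move=> GF [r Fr]; exists r => t /GF/Fr. Qed.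

Lemma fsumZ T k (F : T -> rat) : fsum (fun t => k * F t) = k * fsum F.
Proof. by rewrite /fsum mulr_fsumr. Qed.

Lemma fsumN T (F : T -> rat) : fsum (fun t => - F t) = - fsum F.
Proof. by rewrite -mulN1r -fsumZ; apply: eq_fsum => t; rewrite mulN1r. Qed.

Lemma fsumD T (F G : T -> rat) : fsupported F -> fsupported G ->
  fsum (fun t => F t + G t) = fsum F + fsum G.
Proof.
move=> [r Fr] [s Gs]; rewrite !(@fsum_undup _ (r ++ s)) ?big_split // => t.
- by rewrite mem_cat => /Gs ->; rewrite orbT.
- by rewrite mem_cat => /Fr ->.
- rewrite mem_cat => nz; apply/orP.
  have [Ft|/Fr] := eqVneq (F t) 0; last by left.
  by right; apply: Gs; rewrite Ft add0r in nz.
Qed.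

Lemma fsumB T (F G : T -> rat) : fsupported F -> fsupported G ->
  fsum (fun t => F t - G t) = fsum F - fsum G.
Proof.
move=> sF sG; rewrite -fsumN fsumD //.
by apply: sub_fsupported sG => t; rewrite oppr_eq0.
Qed.

Lemma fsum0 T : fsum (fun _ : T => 0) = 0.
Proof. by rewrite (@fsum_seq _ [::]) ?big_nil // => t; rewrite eqxx. Qed.

Lemma fsum_eq0 T (F : T -> rat) : (forall t, F t = 0) -> fsum F = 0.
Proof. by move=> F0; rewrite -[RHS](fsum0 T); apply: eq_fsum. Qed.

Lemma fsum_neq0 T (F : T -> rat) : fsum F != 0 -> exists t, F t != 0.
Proof.
apply: contra_neqP => F0; apply: fsum_eq0 => t.
by apply/eqP/negP => /negP nz; apply: F0; exists t.
Qed.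

Lemma fsum_big T I (s : seq I) (F : I -> T -> rat) :
  (forall i, fsupported (F i)) ->
  fsum (fun t => \sum_(i <- s) F i t) = \sum_(i <- s) fsum (F i).
Proof.
move=> sF; suff [] : fsupported (fun t => \sum_(i <- s) F i t) /\
    fsum (fun t => \sum_(i <- s) F i t) = \sum_(i <- s) fsum (F i) by [].
elim: s => [|i s [[r IHr] IH]].
  split; first by exists [::] => t; rewrite big_nil eqxx.
  by rewrite big_nil -[RHS](fsum0 T); apply: eq_fsum => t; rewrite big_nil.
have eqF : (fun t => \sum_(j <- i :: s) F j t) =1
    (fun t => F i t + \sum_(j <- s) F j t) by move=> t; rewrite big_cons.
split; last by rewrite (eq_fsum eqF) fsumD // ?IH ?big_cons //; exists r.
have [ri Fri] := sF i; exists (ri ++ r) => t; rewrite eqF mem_cat.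
have [->|/Fri -> //] := eqVneq (F i t) 0.
by rewrite add0r => /IHr ->; rewrite orbT.
Qed.

Lemma fsum_bij T U (h : T -> U) (h' : U -> T) (F : U -> rat) :
  cancel h h' -> cancel h' h -> fsum (fun t => F (h t)) = fsum F.
Proof.
move=> hK h'K; apply/esym; apply: (reindex_fsbigT h).
by exists h'.
Qed.

Lemma fsupportedD T (F G : T -> rat) : fsupported F -> fsupported G ->
  fsupported (fun t => F t + G t).
Proof.
move=> [r Fr] [s Gs]; exists (r ++ s) => t; rewrite mem_cat.
by have [->|/Fr -> //] := eqVneq (F t) 0; rewrite add0r => /Gs ->; rewrite orbT.
Qed.

Lemma fsupportedZ T (k F : T -> rat) : fsupported F -> fsupported (fun t => k t * F t).
Proof.
by apply: sub_fsupported => t; rewrite mulf_eq0 negb_or => /andP[].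
Qed.

Lemma fsupported_can T U (h : T -> U) (h' : U -> T) (F : U -> rat) :
  cancel h h' -> fsupported F -> fsupported (fun t => F (h t)).
Proof.
by move=> hK [r Fr]; exists (map h' r) => t /Fr/(map_f h'); rewrite hK.
Qed.

Lemma fsum_pair T U (F : T * U -> rat) : fsupported F ->
  fsum F = fsum (fun t => fsum (fun u => F (t, u))).
Proof.
move=> [r Fr]; pose r1 := undup (map fst r); pose r2 := undup (map snd r).
have F1 t u : F (t, u) != 0 -> t \in r1.
  by move=> /Fr; rewrite mem_undup => /(map_f fst).
have F2 t u : F (t, u) != 0 -> u \in r2.
  by move=> /Fr; rewrite mem_undup => /(map_f snd).
rewrite (@fsum_seq _ [seq (t, u) | t <- r1, u <- r2]).
- rewrite big_allpairs; rewrite (@fsum_seq _ r1) ?undup_uniq //.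
    apply: eq_bigr => t _; rewrite (@fsum_seq _ r2) ?undup_uniq // => u.
    exact: F2.
  move=> t; apply: contraNT => tr1; rewrite -(fsum0 U); apply/eqP.
  by apply: eq_fsum => u; apply/eqP; apply: contraNT tr1; apply: F1.
- by apply: allpairs_uniq; rewrite ?undup_uniq // => -[? ?] [? ?].
- by case=> t u nz; apply/allpairsP; exists (t, u); rewrite (F1 t u) ?(F2 t u).
Qed.

Lemma fsum_swap T U (F : T * U -> rat) : fsupported F ->
  fsum (fun t => fsum (fun u => F (t, u))) =
  fsum (fun u => fsum (fun t => F (t, u))).
Proof.
move=> sF; rewrite -fsum_pair //.
rewrite -(@fsum_bij _ _ (fun p : U * T => (p.2, p.1)) (fun p => (p.2, p.1))) //.
- rewrite fsum_pair //; case: sF => r Fr; exists [seq (p.2, p.1) | p <- r].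
  by case=> u t /Fr tr; apply/mapP; exists (t, u).
- by case.
- by case.
Qed.

Lemma fsum_D1 T (a : T) (F : T -> rat) : fsupported F ->
  fsum (fun t => (t != a)%:R * F t) = fsum F - F a.
Proof.
move=> sF; have <- : fsum (fun t => (t == a)%:R * F t) = F a.
  rewrite (@fsum_seq _ [:: a]) ?big_seq1 ?eqxx ?mul1r // => t.
  by rewrite inE; have [//|_] := eqVneq t a; rewrite mul0r eqxx.
rewrite -fsumB //; last first.
  by exists [:: a] => t; rewrite inE; have [//|_] := eqVneq t a; rewrite mul0r eqxx.
by apply: eq_fsum => t; have [_|_] := eqVneq t a; rewrite ?mul0r ?mul1r ?subr0 ?subrr.
Qed.

Definition int_range (B : nat) : seq int := [seq i%:Z - B%:Z | i <- iota 0 (2 * B).+1].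

Lemma mem_int_range B x : (x \in int_range B) = (`|x| <= B%:Z).
Proof.
apply/mapP/idP => [[i]|leB]; first by rewrite mem_iota => ? ->; lia.
by exists `|(x + B%:Z)%R|%N; rewrite ?mem_iota; lia.
Qed.

Lemma fsupported_int (B : nat) (F : int -> rat) :
  (forall x, F x != 0 -> `|x| <= B%:Z) -> fsupported F.
Proof. by move=> FB; exists (int_range B) => x /FB; rewrite mem_int_range. Qed.

Lemma fsupported_prod T U (r : seq T) (s : seq U) (F : T * U -> rat) :
  (forall t v, F (t, v) != 0 -> t \in r /\ v \in s) -> fsupported F.
Proof.
move=> Frs; exists [seq (t, v) | t <- r, v <- s] => -[t v] /Frs[tr vs].
exact: allpairs_f.
Qed.

Lemma fsupported_int2 (B : nat) (F : int * int -> rat) :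
  (forall x y, F (x, y) != 0 -> `|x| <= B%:Z /\ `|y| <= B%:Z) -> fsupported F.
Proof.
move=> FB; apply: (@fsupported_prod _ _ (int_range B) (int_range B)) => x y.
by rewrite !mem_int_range; apply: FB.
Qed.

Lemma fsum_subl n (F : int -> rat) : fsum (fun x => F (n - x)) = fsum F.
Proof.
by apply: (@fsum_bij _ _ (fun x => n - x) (fun x => n - x)) => x; rewrite subKr.
Qed.

Lemma fsum_addr n (F : int -> rat) : fsum (fun x => F (x + n)) = fsum F.
Proof.
by apply: (@fsum_bij _ _ (fun x => x + n) (fun x => x - n)) => x; rewrite ?addrK ?subrK.
Qed.

End FiniteSums.

(** * Logarithmic derivatives of theta functions *)

(** For a nonzero term [g (n - m) (N - l * m)] with l m >= - 3 |m|, the support condition on g gives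
    this hypothesis with K = |N|. The square outgrows the linear term, which bounds m. *)
Lemma row_bound (m n K : int) : 0 <= K ->
  3 * (n - m) ^+ 2 <= 4 * K + 12 * `|m| -> `|m| <= 2 * `|n| + K + 20.
Proof.
move=> K0 le_sq; rewrite leNgt; apply/negP => ltm; pose t := `|m| - `|n|.
have t_ge : K + 21 <= t by lia.
have : t ^+ 2 <= (n - m) ^+ 2.
  by rewrite -[leRHS]real_normK ?num_real // lerXn2r ?nnegrE; lia.
have : (K + 21) * t <= t ^+ 2 by rewrite expr2 ler_wpM2r; lia.
have : 21 * K <= K * t by rewrite mulrC ler_wpM2l; lia.
lia.
Qed.

Section ThetaLogDerivative.
Variables (u g : int -> int -> rat).
Hypothesis u_oppl : forall m l, u (- m) l = u m l.
Hypothesis u_oppr : forall m l, u m (- l) = u m l.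
Hypothesis u_per : forall m l, u m (l + 3) = u m l.
Hypothesis u_sum : u 0 1 + u 0 2 + u 0 3 = 2.
Hypothesis g_supp : forall n N, g n N != 0 -> 3 * n ^+ 2 <= 4 * N.
Hypothesis g_even : forall n N, g (- n) N = g n N.
Hypothesis g_shift : forall n N, g (n + 2) (N + 3 * n + 3) = g n N.
Hypothesis g_zero : forall l n N, fsum (fun m => u m l * g (n - m) (N - l * m)) = 0.

(** Read [g n N] as the coefficient of z^n q^N in f(z). Then [g_shift] says f(q^3 z) = z^-2 q^-3
    f(z), [g_zero] says that f(z) sum_m u(m, l) (z q^l)^m = 0, and [u_sum] counts two zeros per
    period. The quadrants come from the logarithmic derivatives of the factors 1 - z q^l, expanded
    in z for l >= 0, and 1 - z^-1 q^-l, expanded in z^-1 for l < 0. *)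
Definition cone_sign (m l : int) : rat :=
  ((0 < m) && (0 <= l))%:R - ((m < 0) && (l < 0))%:R.

Let T n N := fsum (fun p : int * int =>
  cone_sign p.1 p.2 * (u p.1 p.2 * g (n - p.1) (N - p.2 * p.1))).

(** The slack - 3 |m| leaves room for the rows |l| <= 3 that cross the boundary of the cone when l
    is translated by 3. *)
Lemma cone_supported n N (c : int -> int -> rat) :
  (forall m l, c m l != 0 -> m != 0 /\ - 3 * `|m| <= l * m) ->
  fsupported (fun p : int * int =>
    c p.1 p.2 * (u p.1 p.2 * g (n - p.1) (N - p.2 * p.1))).
Proof.
move=> c_supp; pose B := (`|N| + 7 * (2 * `|n| + `|N| + 20))%N.
apply: (@fsupported_int2 B) => m l /=.
rewrite !mulf_eq0 !negb_or => /and3P[/c_supp[m0 lm] _ /g_supp gs].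
have mB : `|m| <= 2 * `|n| + `|N| + 20 by apply: (@row_bound m n); lia.
have lB : `|l| <= `|l * m| by rewrite normrM ler_peMr //; lia.
have ? : `|l * m| <= `|N| + 3 * `|m|.
  by rewrite ler_norml; have := sqr_ge0 (n - m); move: ((n - m) ^+ 2) gs lm; lia.
by rewrite /B; split; lia.
Qed.

Lemma row_supported l n N : `|l| <= 3 ->
  fsupported (fun m => u m l * g (n - m) (N - l * m)).
Proof.
move=> l3; apply: (@fsupported_int (2 * `|n| + `|N| + 20)) => m.
rewrite mulf_eq0 negb_or => /andP[_ /g_supp gs].
have lm : `|l * m| <= 3 * `|m| by rewrite normrM ler_wpM2r.
have : `|m| <= 2 * `|n| + `|N| + 20 by apply: (@row_bound m n); lia.
by lia.
Qed.

(** A full row sums to 0 by [g_zero], so a row deprived of m = 0 sums to minus that term. *)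
Lemma rows_sum (r : seq int) n N : uniq r -> (forall l, l \in r -> `|l| <= 3) ->
  fsum (fun p : int * int => ((p.1 != 0) && (p.2 \in r))%:R *
    (u p.1 p.2 * g (n - p.1) (N - p.2 * p.1))) = - \sum_(l <- r) u 0 l * g n N.
Proof.
move=> ur r3; set F := fun p => _.
have sF : fsupported F.
  apply: (@cone_supported n N (fun m l => ((m != 0) && (l \in r))%:R)) => m l.
  rewrite pnatr_eq0 eqb0 negbK => /andP[m0 /r3 l3]; split=> //.
  have : `|l * m| <= 3 * `|m| by rewrite normrM ler_wpM2r.
  by lia.
rewrite fsum_pair // fsum_swap // (@fsum_seq _ r) // => [|l].
  rewrite -sumrN [LHS]big_seq [RHS]big_seq; apply: eq_bigr => l lr.
  have := fsum_D1 0 (row_supported n N (r3 l lr)).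
  rewrite g_zero sub0r subr0 mulr0 subr0 => <-.
  by apply: eq_fsum => m; rewrite /F /= lr andbT.
apply: contraNT => /negbTE lr; rewrite -(fsum0 int); apply/eqP.
by apply: eq_fsum => m; rewrite /F /= lr andbF mul0r.
Qed.

Lemma cone_sign_neq0 m l : cone_sign m l != 0 -> m != 0 /\ 0 <= l * m.
Proof.
rewrite /cone_sign; case: (boolP (_ && _)) => [/andP[m0 l0] _|_].
  by split; [lia | rewrite mulr_ge0 // ltW].
case: (boolP (_ && _)) => [/andP[m0 l0] _|_]; last by rewrite subrr eqxx.
by split; [lia | rewrite mulr_le0 // ltW].
Qed.

Lemma T_supported n N : fsupported (fun p : int * int =>
  cone_sign p.1 p.2 * (u p.1 p.2 * g (n - p.1) (N - p.2 * p.1))).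
Proof.
apply: (@cone_supported n N cone_sign) => m l /cone_sign_neq0[m0 lm].
by split=> //; lia.
Qed.

(** Translating l by 3 changes the cone sign exactly on the rows l = -1, -2, -3 with m <> 0; [u_sum]
    totals what they contribute. *)
Lemma T_shift n N : T (n + 2) (N + 3 * n + 3) = T n N - 2 * g n N.
Proof.
have -> : T (n + 2) (N + 3 * n + 3) = fsum (fun p : int * int =>
    cone_sign p.1 (p.2 + 3) * (u p.1 p.2 * g (n - p.1) (N - p.2 * p.1))).
  rewrite /T -(@fsum_bij _ _ (fun p => (p.1, p.2 + 3)) (fun p => (p.1, p.2 - 3))) //.
  - apply: eq_fsum => -[m l] /=; rewrite u_per; congr (_ * (_ * _)).
    by rewrite -(g_shift (n - m)); congr (g _ _); ring.
  - by case=> m l; rewrite /= addrK.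
  - by case=> m l; rewrite /= subrK.
apply/eqP; rewrite addrC -subr_eq /T -fsumB; last exact: T_supported; last first.
  apply: (@cone_supported n N (fun m l => cone_sign m (l + 3))) => m l.
  by move=> /cone_sign_neq0[m0]; rewrite mulrDl; split=> //; lia.
have := @rows_sum [:: -1; -2; -3] n N isT; rewrite !big_cons big_nil !u_oppr.
rewrite addr0 addrA -!mulrDl u_sum => <-; last by move=> l; rewrite !inE => /or3P[] /eqP->.
apply/eqP/eq_fsum => -[m l] /=; rewrite -mulrBl !inE; congr (_ * _).
rewrite (_ : [|| _, _ | _] = (0 <= l + 3) && (l < 0)); last by lia.
rewrite /cone_sign; have [l0|l0] := ltP l 0; have [l3|l3] := ltP (l + 3) 0;
  first [exfalso; lia | by case: ltrgtP].
Qed.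

(** The cone signs at (m, l) and (-m, -l) add up to the indicator of the row l = 0 with m <> 0. *)
Lemma T_opp n N : T n N + T (- n) N = - (u 0 0 * g n N).
Proof.
have -> : T (- n) N = fsum (fun p : int * int =>
    cone_sign (- p.1) (- p.2) * (u p.1 p.2 * g (n - p.1) (N - p.2 * p.1))).
  rewrite /T -(@fsum_bij _ _ (fun p : int * int => (- p.1, - p.2)) (fun p => (- p.1, - p.2))).
  - apply: eq_fsum => -[m l] /=; rewrite u_oppl u_oppr mulrNN -opprB g_even.
    by congr (_ * (_ * g _ _)); ring.
  - by case=> m l; rewrite /= !opprK.
  - by case=> m l; rewrite /= !opprK.
rewrite /T -fsumD; first last.
- apply: (@cone_supported n N (fun m l => cone_sign (- m) (- l))) => m l.
  by move=> /cone_sign_neq0[]; rewrite oppr_eq0 mulrNN => m0 lm; split=> //; lia.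
- exact: T_supported.
have := @rows_sum [:: 0] n N isT; rewrite big_seq1 => <-; last by move=> l; rewrite inE => /eqP->.
apply: eq_fsum => -[m l] /=; rewrite -mulrDl !inE; congr (_ * _).
rewrite /cone_sign !oppr_gt0 !oppr_lt0 !oppr_ge0.
by case: (ltrgtP m 0); case: (ltrgtP l 0).
Qed.

(** The left side inherits the quasi-periodicity of g, which determines it from n = 0 and n = 1, and
    it is odd in n. Oddness kills both: the shift takes n = -1 to n = 1 with N unchanged. *)
Lemma theta_log_derivative n N :
  2 * n%:~R * g n N + 2 * T n N + u 0 0 * g n N = 0.
Proof.
set G := fun n N => 2 * n%:~R * g n N + 2 * T n N + u 0 0 * g n N.
rewrite -/(G n N).
have G_opp k M : G (- k) M = - G k M.
  apply/eqP; rewrite -addr_eq0 /G g_even mulrNz; apply/eqP.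
  rewrite [LHS](_ : _ = 2 * (T k M + T (- k) M) + 2 * (u 0 0 * g k M)); last by ring.
  by rewrite T_opp; ring.
have G_shift k M : G (k + 2) (M + 3 * k + 3) = G k M.
  by rewrite /G T_shift g_shift intrD; ring.
have G_nat : forall (k : nat) M, G k%:Z M = 0.
  have two_eq0 (x : rat) : x = - x -> x = 0 by move=> ?; lra.
  have G0 M : G 0 M = 0 by apply: two_eq0; rewrite -G_opp oppr0.
  have G1 M : G 1 M = 0.
    by apply: two_eq0; rewrite -G_opp -(G_shift (-1)); congr G; ring.
  move=> k; elim: k {-2}k (leqnn k) => [|K IH] [|[|k]] // lek M.
  have := G_shift k%:Z (M - 3 * k%:Z - 3); rewrite IH; last by lia.
  rewrite (_ : k%:Z + 2 = k.+2%:Z); last by lia.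
  by rewrite (_ : M - 3 * k%:Z - 3 + 3 * k%:Z + 3 = M); last by ring.
by case: (intP n) => [|k|k]; rewrite ?G_opp G_nat ?oppr0.
Qed.

End ThetaLogDerivative.

(** * Derivatives at z = 1 of a product with a Lambert series *)

Section Moments.
Variables (c g : int -> int -> rat).
Hypothesis c_supp : forall m l, c m l != 0 -> 0 < l * m.
Hypothesis g_supp : forall n N, g n N != 0 -> 3 * n ^+ 2 <= 4 * N.

(** [moment j] and [lambert i] are iterated derivatives z d/dz, taken at z = 1, of the series with
    terms g(n, N) z^n q^N and c(m, l) z^m q^(l m). By [c_supp] each power of q receives finitely
    many terms; a row l = 0 would not be summable at z = 1. *)
Definition moment j : fps rat := Fps (fun N : nat => fsum (fun n => n%:~R ^+ j * g n N%:Z)).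

Definition lambert i : fps rat := Fps (fun K : nat =>
  fsum (fun p : int * int => (p.2 * p.1 == K%:Z)%:R * (c p.1 p.2 * p.1%:~R ^+ i))).

Lemma c_bound m l (B : int) : c m l != 0 -> l * m <= B -> `|m| <= B /\ `|l| <= B.
Proof.
move=> /c_supp lm0 leB; have m0 : m != 0 by apply: contraTneq lm0 => ->; rewrite mulr0 ltxx.
have l0 : l != 0 by apply: contraTneq lm0 => ->; rewrite mul0r ltxx.
have : `|l * m| <= B by rewrite gtr0_norm.
rewrite normrM => leM; split; apply: le_trans leM.
  by rewrite ler_peMl //; lia.
by rewrite ler_peMr //; lia.
Qed.

Lemma g_neg n N : N < 0 -> g n N = 0.
Proof.
move=> N0; apply/eqP; apply: contraTT (N0) => /g_supp gs.
by rewrite -leNgt; have := sqr_ge0 n; lia.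
Qed.

Lemma g_bound n N : g n N != 0 -> `|n| <= 2 * `|N|.
Proof.
move=> /g_supp gs; have [->|n0] := eqVneq n 0; first by lia.
have : `|n| * 1 <= `|n| * `|n| by rewrite ler_wpM2l //; lia.
by rewrite -expr2 real_normK ?num_real // mulr1; lia.
Qed.

Lemma moment_supported j N : fsupported (fun n => n%:~R ^+ j * g n N).
Proof.
apply: (@fsupported_int (2 * `|N|)) => n; rewrite mulf_eq0 negb_or.
by move=> /andP[_ /g_bound]; lia.
Qed.

Lemma cone_term_bound n m l (N : nat) : c m l * g (n - m) (N%:Z - l * m) != 0 ->
  [/\ `|n| <= (3 * N)%N%:Z, `|m| <= N%:Z & `|l| <= N%:Z].
Proof.
rewrite mulf_eq0 negb_or => /andP[cn0 gn0].
have lm0 := c_supp cn0; have lmN : l * m <= N%:Z.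
  by rewrite leNgt; apply: contra gn0 => ?; rewrite g_neg //; lia.
have [mN lN] := c_bound cn0 lmN; have nN := g_bound gn0.
by split=> //; lia.
Qed.

Lemma cone_terms_supported n (N : nat) : fsupported (fun p : int * int =>
  c p.1 p.2 * g (n - p.1) (N%:Z - p.2 * p.1)).
Proof. by apply: (@fsupported_int2 N) => m l /cone_term_bound[]. Qed.

Lemma cone_sum_supported (N : nat) : fsupported (fun n => fsum (fun p : int * int =>
  c p.1 p.2 * g (n - p.1) (N%:Z - p.2 * p.1))).
Proof.
apply: (@fsupported_int (3 * N)) => n /fsum_neq0[[m l]] /=.
by move=> /cone_term_bound[].
Qed.

(** The Leibniz rule for (z d/dz)^j: n is split as m + (n - m) and its power expanded by the
    binomial theorem. *)
Lemma moment_sum j N : fsum (fun n => n%:~R ^+ j * fsum (fun p : int * int =>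
    c p.1 p.2 * g (n - p.1) (N%:Z - p.2 * p.1))) =
  (\sum_(i < j.+1) 'C(j, i)%:R * (lambert i * moment (j - i))) N.
Proof.
under eq_fsum => n do rewrite -fsumZ.
have sF : fsupported (fun q : int * (int * int) => q.1%:~R ^+ j *
    (c q.2.1 q.2.2 * g (q.1 - q.2.1) (N%:Z - q.2.2 * q.2.1))).
  pose R := int_range (3 * N).
  apply: (@fsupported_prod _ _ R [seq (m, l) | m <- R, l <- R]) => n [m l].
  rewrite mulf_eq0 negb_or => /andP[_]; rewrite /fst /snd => /cone_term_bound[nN mN lN].
  by split; [|apply: allpairs_f]; rewrite mem_int_range; lia.
rewrite (fsum_swap sF) /=.
(* K is the exponent l m of q taken from the cone; its indicator selects one term of the Cauchy
   product. *)
transitivity (fsum (fun p : int * int => \sum_(K < N.+1) (p.2 * p.1 == K%:Z)%:R *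
    (c p.1 p.2 * \sum_(i < j.+1) 'C(j, i)%:R * (p.1%:~R ^+ i * moment (j - i) (N - K)%N)))).
  apply: eq_fsum => -[m l] /=; have [->|cn0] := eqVneq (c m l) 0.
    rewrite big1 => [|i _]; last by rewrite mul0r mulr0.
    by apply: fsum_eq0 => n; rewrite mul0r mulr0.
  have lm0 := c_supp cn0.
  transitivity (c m l * fsum (fun n => (n + m)%:~R ^+ j * g n (N%:Z - l * m))).
    rewrite -fsumZ -(fsum_addr m); apply: eq_fsum => n.
    by rewrite addrK mulrCA.
  have [lmN|lmN] := leP (l * m) N%:Z; last first.
    rewrite big1 => [|K _]; last by rewrite gt_eqF ?mul0r //; have := ltn_ord K; lia.
    by rewrite fsum_eq0 ?mulr0 // => n; rewrite g_neg ?mulr0 //; lia.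
  have ltK : (`|(l * m)%R| < N.+1)%N by lia.
  rewrite (bigD1 (Ordinal ltK)) //=; set S := \sum_(_ < N.+1 | _) _.
  have {S}-> : S = 0.
    apply: big1 => K neK.
    rewrite (_ : l * m == K = false) ?mul0r //.
    by apply: contraNF neK => /eqP eqK; apply/eqP/val_inj; rewrite /= eqK.
  rewrite addr0.
  rewrite gtz0_abs // eqxx mul1r; congr (_ * _).
  rewrite (_ : N%:Z - l * m = (N - `|(l * m)%R|)%N%:Z); last by lia.
  set L := (N - _)%N.
  under eq_fsum => n do rewrite rmorphD /= exprDn mulr_suml.
  rewrite fsum_big => [|i].
    apply: eq_bigr => i _.
    rewrite [RHS](_ : _ = 'C(j, i)%:R * m%:~R ^+ i * moment (j - i) L); last by rewrite mulrA.
    rewrite -fsumZ; apply: eq_fsum => n; rewrite -mulr_natl; ring.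
  apply: sub_fsupported (moment_supported (j - i) L%:Z) => n.
  apply: contraNneq => /eqP; rewrite mulf_eq0 -mulr_natl.
  by move=> /orP[]/eqP->; rewrite ?(mulr0, mul0r, mul0rn).
rewrite fsum_big => [|K]; last first.
  apply: (@fsupported_int2 N) => m l.
  rewrite !mulf_eq0 !negb_or pnatr_eq0 eqb0 negbK => /and3P[/eqP lm cn0 _].
  by apply: (c_bound cn0); have := ltn_ord K; move: lm; rewrite /fst /snd => ->; lia.
rewrite fps_sum; under [RHS]eq_bigr => i _ do rewrite fps_natM fpsM mulr_sumr.
rewrite [RHS]exchange_big; apply: eq_bigr => K _ /=.
transitivity (\sum_(i < j.+1) fsum (fun p : int * int =>
    'C(j, i)%:R * moment (j - i) (N - K)%N *
    ((p.2 * p.1 == K%:Z)%:R * (c p.1 p.2 * p.1%:~R ^+ i)))); last first.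
  by apply: eq_bigr => i _; rewrite fsumZ /= -mulrA; congr (_ * _); rewrite mulrC.
rewrite -fsum_big => [|i]; last first.
  apply: (@fsupported_int2 N) => m l.
  rewrite !mulf_eq0 !negb_or => /and3P[_]; rewrite pnatr_eq0 eqb0 negbK => /eqP lm /andP[cn0 _].
  by apply: (c_bound cn0); have := ltn_ord K; move: lm; rewrite /fst /snd => ->; lia.
apply: eq_fsum => -[m l] /=; rewrite !mulr_sumr; apply: eq_bigr => i _.
by ring.
Qed.

End Moments.

(** * Generating series *)

Section GeneratingSeries.
Implicit Types T U : choiceType.

Definition gser T (e : T -> nat) (c : T -> rat) : fps rat :=
  Fps (fun n => fsum (fun t => (e t == n)%:R * c t)).

Definition finite_fibers T (e : T -> nat) :=
  forall n, exists r : seq T, forall t, e t = n -> t \in r.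

Lemma gser_supported T (e : T -> nat) c n : finite_fibers e ->
  fsupported (fun t => (e t == n)%:R * c t).
Proof.
move=> /(_ n)[r er]; exists r => t.
by rewrite mulf_eq0 negb_or pnatr_eq0 eqb0 negbK => /andP[/eqP/er].
Qed.

Lemma eq_gser T (e : T -> nat) c d : c =1 d -> gser e c = gser e d.
Proof. by move=> /funext->. Qed.

Lemma gserD T (e : T -> nat) c d : finite_fibers e ->
  gser e (fun t => c t + d t) = gser e c + gser e d.
Proof.
move=> fe; apply: fpsP => n; rewrite fpsD /=.
rewrite -fsumD; [|exact: gser_supported..].
by apply: eq_fsum => t; rewrite mulrDr.
Qed.

Lemma gserZ T (e : T -> nat) k c :
  gser e (fun t => k%:R * c t) = k%:R * gser e c.
Proof.
apply: fpsP => n; rewrite fps_natM /= -fsumZ.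
by apply: eq_fsum => t; rewrite mulrCA.
Qed.

Lemma gserN T (e : T -> nat) c : gser e (fun t => - c t) = - gser e c.
Proof.
by apply: fpsP => n; rewrite fpsN /= -fsumN; apply: eq_fsum => t; rewrite mulrN.
Qed.

Lemma gser_D T (e : T -> nat) c :
  fps_D (gser e c) = gser e (fun t => (e t)%:R * c t).
Proof.
apply: fpsP => n; rewrite fps_DE /= -fsumZ; apply: eq_fsum => t.
by have [->|_] := eqVneq (e t) n; rewrite ?mul0r ?mulr0 // mulrCA.
Qed.

Lemma gser_bij T U (e : U -> nat) c (h : T -> U) (h' : U -> T) :
  cancel h h' -> cancel h' h -> gser e c = gser (e \o h) (c \o h).
Proof. by move=> hK h'K; apply: fpsP => n /=; rewrite -(fsum_bij _ hK h'K). Qed.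

Lemma gser_V T (e : T -> nat) c : fps_V (gser e c) = gser (fun t => (3 * e t)%N) c.
Proof.
apply: fpsP => n; have [/dvdnP[k ->]|n3] := boolP (3 %| n)%N.
  by rewrite mulnC fps_VE /=; apply: eq_fsum => t; rewrite eqn_pmul2l.
rewrite fps_VN //=; apply/esym/fsum_eq0 => t.
have [eqtn|_] := eqVneq (3 * e t)%N n; last by rewrite mul0r.
by rewrite -eqtn dvdn_mulr in n3.
Qed.

Lemma gserM T U (e : T -> nat) (e' : U -> nat) c c' :
  finite_fibers e -> finite_fibers e' ->
  gser e c * gser e' c' =
  gser (fun p : T * U => (e p.1 + e' p.2)%N) (fun p => c p.1 * c' p.2).
Proof.
move=> fe fe'; apply: fpsP => n; rewrite fpsM /=.
transitivity (\sum_(i < n.+1) fsum (fun p : T * U =>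
    ((e p.1 == i)%:R * c p.1) * ((e' p.2 == n - i)%N%:R * c' p.2))).
  apply: eq_bigr => i _; rewrite fsum_pair.
    rewrite mulrC -fsumZ; apply: eq_fsum => t.
    by rewrite mulrC -fsumZ; apply: eq_fsum => u.
  have [r er] := gser_supported c i fe; have [s es] := gser_supported c' (n - i)%N fe'.
  apply: (@fsupported_prod _ _ r s) => t v; rewrite mulf_eq0 negb_or => /andP[nz1 nz2].
  by split; [exact: er nz1 | exact: es nz2].
rewrite -fsum_big => [|i]; last first.
  have [r er] := gser_supported c i fe; have [s es] := gser_supported c' (n - i)%N fe'.
  apply: (@fsupported_prod _ _ r s) => t v; rewrite mulf_eq0 negb_or => /andP[nz1 nz2].
  by split; [exact: er nz1 | exact: es nz2].
apply: eq_fsum => -[t u] /=; have [len|gtn] := leqP (e t) n; last first.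
  rewrite big1 => [|i _]; first by rewrite gtn_eqF ?mul0r // ltn_addr.
  by rewrite gtn_eqF ?mul0r // (leq_trans _ gtn).
rewrite (bigD1 (Ordinal (len : e t < n.+1)%N)) //= big1 => [|i nei].
  by rewrite eqxx addr0 mul1r -[X in _ = (_ == X)%:R * _](subnKC len) eqn_add2l mulrCA.
rewrite (_ : e t == i = false) ?mul0r //; apply: contraNF nei => /eqP eqi.
by apply/eqP/val_inj; rewrite /= eqi.
Qed.

End GeneratingSeries.

(** * Lambert series as divisor sums *)

Section Lambert.
Variable u : int -> int -> rat.
Hypothesis u_oppl : forall m l, u (- m) l = u m l.
Hypothesis u_oppr : forall m l, u m (- l) = u m l.

(** [cone_sign] without the row l = 0, so that z can be set to 1. *)
Definition open_cone_sign (m l : int) : rat :=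
  ((0 < m) && (0 < l))%:R - ((m < 0) && (l < 0))%:R.

Lemma open_cone_sign_neq0 m l : open_cone_sign m l * u m l != 0 -> 0 < l * m.
Proof.
rewrite mulf_eq0 negb_or => /andP[+ _]; rewrite /open_cone_sign.
case: (boolP (_ && _)) => [/andP[m0 l0] _|_]; first by rewrite mulr_gt0.
case: (boolP (_ && _)) => [/andP[m0 l0] _|_]; last by rewrite subrr eqxx.
by rewrite nmulr_rgt0.
Qed.

(** The constant coefficient is set apart because [divisors 0] is [[:: 1]], not the empty
    sequence. *)
Definition divisor_series (v : nat -> nat -> rat) : fps rat :=
  Fps (fun K => if K is 0 then 0 else \sum_(d <- divisors K) v d (K %/ d)%N).

Lemma divisor_seriesE v K : (0 < K)%N ->
  divisor_series v K = \sum_(d <- divisors K) v d (K %/ d)%N.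
Proof. by case: K. Qed.

Let half i K := fsum (fun p : int * int => (p.2 * p.1 == Posz K)%:R *
  (((0 < p.1) && (0 < p.2))%:R * (u p.1 p.2 * p.1%:~R ^+ i))).

Lemma half_divisors i K :
  half i K = divisor_series (fun d k => u d%:Z k%:Z * d%:R ^+ i) K.
Proof.
have [->|K0] := posnP K.
  apply: fsum_eq0 => -[m l] /=; case: (boolP (_ && _)) => [/andP[m0 l0]|_].
    by rewrite gt_eqF ?mul0r // mulr_gt0.
  by rewrite mul0r mulr0.
rewrite divisor_seriesE // /half (@fsum_seq _ [seq (d%:Z, (K %/ d)%N%:Z) | d <- divisors K]).
- rewrite big_map; apply: eq_big_seq => d.
  rewrite -dvdn_divisors // => dK; have d0 := dvdn_gt0 K0 dK.
  by rewrite /fst /snd -PoszM divnK // eqxx !ltz_nat d0 divn_gt0 // dvdn_leq // !mul1r.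
- by rewrite map_inj_uniq ?divisors_uniq // => d e [].
case=> m l; rewrite !mulf_eq0 !negb_or !pnatr_eq0 !eqb0 !negbK /fst /snd => /and3P[].
case: m l => [m|m] [l|l]; try by move=> _ /andP[]; lia.
rewrite -PoszM !eqz_nat !ltz_nat => /eqP <- /andP[m0 l0] _.
by apply/mapP; exists m; rewrite ?mulnK // -dvdn_divisors ?muln_gt0 ?m0 ?l0 // dvdn_mull.
Qed.

(** Changing both signs maps the negative quadrant to the positive one and multiplies m^i by (-1)^i;
    hence even i contribute nothing. *)
Lemma lambertE i K : lambert (fun m l => open_cone_sign m l * u m l) i K =
  (1 - (-1) ^+ i) * divisor_series (fun d k => u d%:Z k%:Z * d%:R ^+ i) K.
Proof.
rewrite -half_divisors mulrBl mul1r -fsumZ.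
have sF : fsupported (fun p : int * int => (p.2 * p.1 == K%:Z)%:R *
    (((0 < p.1) && (0 < p.2))%:R * (u p.1 p.2 * p.1%:~R ^+ i))).
  apply: (@fsupported_int2 K) => m l; rewrite !mulf_eq0 !negb_or !pnatr_eq0 !eqb0 !negbK.
  by move=> /and3P[/eqP + /andP[m0 l0] _]; rewrite /fst /snd in m0 l0 * => <-; nia.
rewrite [X in _ - X](_ : _ = fsum (fun p : int * int => (p.2 * p.1 == K%:Z)%:R *
    (((p.1 < 0) && (p.2 < 0))%:R * (u p.1 p.2 * p.1%:~R ^+ i)))).
  rewrite /half -fsumB //.
    by apply: eq_fsum => -[m l] /=; rewrite /open_cone_sign; ring.
  apply: (@fsupported_int2 K) => m l; rewrite !mulf_eq0 !negb_or !pnatr_eq0 !eqb0 !negbK.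
  by move=> /and3P[/eqP + /andP[m0 l0] _]; rewrite /fst /snd in m0 l0 * => <-; nia.
rewrite -(@fsum_bij _ _ (fun p : int * int => (- p.1, - p.2)) (fun p => (- p.1, - p.2))).
- apply: eq_fsum => -[m l] /=; rewrite mulrNN u_oppl u_oppr !oppr_gt0 mulrNz.
  have sqr1 : (-1) ^+ i * (-1) ^+ i = 1 :> rat by rewrite -exprMn mulrNN mul1r expr1n.
  by rewrite -[- m%:~R]mulN1r exprMn; move: ((-1) ^+ i) sqr1 => s sqr1; ring: sqr1.
- by case=> m l; rewrite /= !opprK.
- by case=> m l; rewrite /= !opprK.
Qed.

End Lambert.

Definition sigma_series r := divisor_series (fun d _ => d%:R ^+ r).

Lemma sigma_seriesE r n : (0 < n)%N -> sigma_series r n = (sigma r n)%:R.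
Proof.
by move=> n0; rewrite divisor_seriesE // natr_sum; apply: eq_bigr => d _; rewrite natrX.
Qed.

Lemma divisor_series_dvdr (v : nat -> rat) :
  divisor_series (fun d k => (3 %| k)%N%:R * v d) =
  fps_V (divisor_series (fun d _ => v d)).
Proof.
apply: fpsP => K; have [->|K0] := posnP K; first by rewrite fps_V0.
have [/dvdnP[k eqK]|K3] := boolP (3 %| K)%N; last first.
  rewrite fps_VN // divisor_seriesE // big1_seq // => d /andP[_].
  rewrite -dvdn_divisors // => dK; case: (boolP (3 %| _)%N) => [k3|]; last by rewrite mul0r.
  by rewrite -(divnK dK) dvdn_mulr in K3.
have k0 : (0 < k)%N by lia.
rewrite eqK mulnC fps_VE !divisor_seriesE ?muln_gt0 //.
rewrite (eq_bigr (fun d => if (3 %| (3 * k) %/ d)%N then v d else 0)); last first.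
  by move=> d _; case: ifP; rewrite ?mul1r ?mul0r.
rewrite -big_mkcond -big_filter; apply: perm_big; apply: uniq_perm.
- by rewrite filter_uniq // divisors_uniq.
- exact: divisors_uniq.
move=> d; rewrite mem_filter -!dvdn_divisors ?muln_gt0 //.
apply/andP/idP => [[/dvdnP[q eqq] d3k]|dk].
  by apply/dvdnP; exists q; have := divnK d3k; rewrite eqq; lia.
by rewrite dvdn_mull // -muln_divA // dvdn_mulr.
Qed.

Lemma divisor_series_dvdl r :
  divisor_series (fun d _ => (3 %| d)%N%:R * d%:R ^+ r) =
  (3 ^ r)%:R * fps_V (sigma_series r).
Proof.
apply: fpsP => K; rewrite fps_natM; have [->|K0] := posnP K; first by rewrite fps_V0 mulr0.
have [/dvdnP[k eqK]|K3] := boolP (3 %| K)%N; last first.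
  rewrite fps_VN // mulr0 divisor_seriesE // big1_seq // => d /andP[_].
  rewrite -dvdn_divisors // => dK; case: (boolP (3 %| d)%N) => [d3|]; last by rewrite mul0r.
  by rewrite (dvdn_trans d3 dK) in K3.
have k0 : (0 < k)%N by lia.
rewrite eqK mulnC fps_VE sigma_seriesE // divisor_seriesE ?muln_gt0 //.
rewrite (eq_bigr (fun d => if (3 %| d)%N then d%:R ^+ r else 0)); last first.
  by move=> d _; case: ifP; rewrite ?mul1r ?mul0r.
rewrite -big_mkcond -big_filter (perm_big [seq (3 * d)%N | d <- divisors k]).
  rewrite big_map /sigma natr_sum mulr_sumr; apply: eq_bigr => d _.
  by rewrite natrM exprMn !natrX.
apply: uniq_perm.
- by rewrite filter_uniq // divisors_uniq.
- by rewrite map_inj_uniq ?divisors_uniq // => d e /eqP; rewrite eqn_pmul2l // => /eqP.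
move=> d; rewrite mem_filter -dvdn_divisors ?muln_gt0 //; apply/andP/mapP => [[/dvdnP[e ->]]|[e]].
  by rewrite mulnC dvdn_pmul2l // => ek; exists e; rewrite -?dvdn_divisors.
by rewrite -dvdn_divisors // => ek ->; rewrite dvdn_mulr // dvdn_pmul2l.
Qed.

Lemma divisor_seriesD v w : divisor_series (fun d k => v d k + w d k) =
  divisor_series v + divisor_series w.
Proof. by apply: fpsP => -[|K]; rewrite fpsD /= ?addr0 // big_split. Qed.

Lemma divisor_seriesZ c v : divisor_series (fun d k => c%:R * v d k) =
  c%:R * divisor_series v.
Proof. by apply: fpsP => -[|K]; rewrite fps_natM /= ?mulr0 // mulr_sumr. Qed.

Lemma divisor_seriesN v : divisor_series (fun d k => - v d k) = - divisor_series v.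
Proof. by apply: fpsP => -[|K]; rewrite fpsN /= ?oppr0 // sumrN. Qed.

(** * Theta series of the hexagonal lattice *)

Definition qform (t : int * int) : nat := `|(t.1 ^+ 2 + t.1 * t.2 + t.2 ^+ 2)%R|%N.

Lemma qformE x y : (qform (x, y))%:Z = x ^+ 2 + x * y + y ^+ 2.
Proof.
rewrite /qform gez0_abs //= -(pmulr_rge0 _ (isT : 0 < 4 :> int)).
have -> : 4 * (x ^+ 2 + x * y + y ^+ 2) = (2 * x + y) ^+ 2 + 3 * y ^+ 2 by ring.
by have := sqr_ge0 (2 * x + y); have := sqr_ge0 y; lia.
Qed.

Lemma qform_bound x y (N : int) : x ^+ 2 + x * y + y ^+ 2 = N ->
  3 * x ^+ 2 <= 4 * N /\ 3 * y ^+ 2 <= 4 * N.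
Proof.
move=> <-; have := sqr_ge0 (2 * x + y); have := sqr_ge0 (x + 2 * y).
have -> : (2 * x + y) ^+ 2 = 4 * x ^+ 2 + 4 * (x * y) + y ^+ 2 by ring.
have -> : (x + 2 * y) ^+ 2 = x ^+ 2 + 4 * (x * y) + 4 * y ^+ 2 by ring.
by split; lia.
Qed.

Lemma sqr_bound (x N : int) : 3 * x ^+ 2 <= 4 * N -> `|x| <= 2 * `|N|.
Proof.
move=> le_sq; have [->|x0] := eqVneq x 0; first by lia.
have : `|x| * 1 <= `|x| * `|x| by rewrite ler_wpM2l //; lia.
by rewrite -expr2 real_normK ?num_real // mulr1; lia.
Qed.

Lemma qform_fibers : finite_fibers qform.
Proof.
move=> n; exists [seq (x, y) | x <- int_range (2 * n), y <- int_range (2 * n)].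
case=> x y eqn; have := qformE x y; rewrite eqn => /esym/qform_bound[/sqr_bound hx /sqr_bound hy].
by apply: allpairs_f; rewrite mem_int_range; lia.
Qed.

Local Notation theta := (gser qform).

Section ThetaSlices.
Variable rho : int -> rat.
Hypothesis rho_per : forall k l, (k = l %[mod 3])%Z -> rho k = rho l.

(** The coefficient of z^n q^N in the sum of rho(x - y) z^x q^Q(x, y). *)
Definition slice n N := fsum (fun y => (n ^+ 2 + n * y + y ^+ 2 == N)%:R * rho (n - y)).

Lemma slice_supp n N : slice n N != 0 -> 3 * n ^+ 2 <= 4 * N.
Proof.
move=> /fsum_neq0[y]; rewrite mulf_eq0 negb_or pnatr_eq0 eqb0 negbK => /andP[/eqP eqN _].
by have [] := qform_bound eqN.
Qed.

(** The map (x, y) -> (-x, x + y) preserves Q and the class of x - y modulo 3. *)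
Lemma slice_even n N : slice (- n) N = slice n N.
Proof.
rewrite /slice -(fsum_addr n); apply: eq_fsum => y.
rewrite (_ : (- n) ^+ 2 + - n * (y + n) + (y + n) ^+ 2 = n ^+ 2 + n * y + y ^+ 2); last by ring.
by congr (_ * _); apply: rho_per; lia.
Qed.

(** The map (x, y) -> (x + 2, y - 1) adds 3 x + 3 to Q and 3 to x - y. *)
Lemma slice_shift n N : slice (n + 2) (N + 3 * n + 3) = slice n N.
Proof.
rewrite /slice -(fsum_addr (- 1)); apply: eq_fsum => y.
rewrite (_ : (n + 2) ^+ 2 + (n + 2) * (y + -1) + (y + -1) ^+ 2 =
  n ^+ 2 + n * y + y ^+ 2 + (3 * n + 3)); last by ring.
congr ((nat_of_bool _)%:R * _); last by apply: rho_per; lia.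
by apply/eqP/eqP; lia.
Qed.

(* [Q(x, y) - l x] is invariant under a rotation of order 3 about its minimum,
   which permutes the cosets on which the weight has to be summed. *)
Lemma slice_zero (u : int -> int -> rat) l n N :
  (forall x y, u (n - x) l * rho (x - y) + u (n - (l - x - y)) l * rho (l - x - y - (x - l))
     + u (n - (y + l)) l * rho (y + l - (- x - y)) = 0) ->
  fsum (fun m => u m l * slice (n - m) (N - l * m)) = 0.
Proof.
move=> u0; rewrite -(fsum_subl n); set M := N - l * n.
pose H (p : int * int) := u (n - p.1) l *
  ((p.1 ^+ 2 + p.1 * p.2 + p.2 ^+ 2 - l * p.1 == M)%:R * rho (p.1 - p.2)).
pose phi (p : int * int) := (l - p.1 - p.2, p.1 - l).
pose phi' (p : int * int) := (p.2 + l, - p.1 - p.2).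
have phiK : cancel phi phi' by case=> x y; congr (_, _); rewrite /=; ring.
have phi'K : cancel phi' phi by case=> x y; congr (_, _); rewrite /=; ring.
have sH : fsupported H.
  (* Completing the square, 12 (Q(x, y) - l x) >= (3 x - 2 l)^2 - 4 l^2; this bounds x, and then Q =
     M + l x bounds y. *)
  pose Bx : int := 12 * `|M| + 4 * `|l| * `|l| + 2 * `|l|.
  pose By : int := 2 * (`|M| + `|l| * Bx).
  apply: (@fsupported_prod _ _ (int_range (absz Bx)) (int_range (absz By))) => x y.
  rewrite /H !mulf_eq0 !negb_or pnatr_eq0 eqb0 negbK /fst /snd => /and3P[_ /eqP eqM _].
  rewrite !mem_int_range.
  have eqN : x ^+ 2 + x * y + y ^+ 2 = M + l * x by rewrite -eqM subrK.
  have [hx /sqr_bound hy] := qform_bound eqN.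
  have le_sq : (3 * x - 2 * l) ^+ 2 <= 12 * M + 4 * l ^+ 2.
    have -> : (3 * x - 2 * l) ^+ 2 = 3 * (3 * x ^+ 2) - 12 * (l * x) + 4 * l ^+ 2 by ring.
    by lia.
  have : `|3 * x - 2 * l| <= (3 * x - 2 * l) ^+ 2.
    have [->|z0] := eqVneq (3 * x - 2 * l) 0; first by rewrite normr0.
    by rewrite -[leRHS]real_normK ?num_real // expr2 ler_peMl // -gtz0_ge1 normr_gt0.
  have : l ^+ 2 = `|l| * `|l| by rewrite -expr2 real_normK ?num_real.
  move=> eql abs_le; have xB : `|x| <= Bx.
    by rewrite /Bx -mulrA -eql; move: (l ^+ 2) (_ ^+ 2) le_sq abs_le => l2 z2; lia.
  have : `|l * x| <= `|l| * Bx by rewrite normrM ler_wpM2l.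
  split; rewrite abszE; apply: le_trans (ler_norm _) => //; apply: le_trans hy _.
  by rewrite ler_pM2l // (le_trans (ler_normD _ _)) // lerD2l.
transitivity (fsum H).
  rewrite fsum_pair //; apply: eq_fsum => x; rewrite subKr /slice -fsumZ.
  apply: eq_fsum => y; rewrite /H /=; congr (_ * ((nat_of_bool _)%:R * _)).
  rewrite (_ : N - l * (n - x) = M + l * x); last by rewrite /M; ring.
  by apply/eqP/eqP => [->|<-]; rewrite ?addrK ?subrK.
suff : 3 * fsum H = 0 by move/eqP; rewrite mulf_eq0 => /orP[//|/eqP].
have -> : 3 * fsum H = fsum H + fsum (fun p => H (phi p)) + fsum (fun p => H (phi' p)).
  by rewrite (fsum_bij H phiK phi'K) (fsum_bij H phi'K phiK); ring.
have s1 := fsupported_can phiK sH; have s2 := fsupported_can phi'K sH.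
have s12 := fsupportedD sH s1.
rewrite -fsumD // -fsumD //; apply: fsum_eq0 => -[x y]; rewrite /H /phi /phi' /=.
set e := (_ == M)%:R; rewrite -[RHS](mulr0 e) -(u0 x y) -/e.
rewrite [X in (X == M)%:R](_ : _ = x ^+ 2 + x * y + y ^+ 2 - l * x); last by ring.
rewrite [X in _ + _ * ((X == M)%:R * _)](_ : _ = x ^+ 2 + x * y + y ^+ 2 - l * x); last by ring.
by rewrite -/e; ring.
Qed.

Lemma moment_slice j : moment slice j = theta (fun t => t.1%:~R ^+ j * rho (t.1 - t.2)).
Proof.
apply: fpsP => N /=; rewrite [RHS]fsum_pair; last exact: (gser_supported _ _ qform_fibers).
apply: eq_fsum => n; rewrite -fsumZ; apply: eq_fsum => y.
by rewrite mulrCA -eqz_nat qformE.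
Qed.

End ThetaSlices.

(** * Weights modulo 3, and the zeros of b(z) and c(z) *)

Definition cop3 (k : int) : rat := (~~ (3 %| k)%Z)%:R.
(** The Ramanujan sum w^k + w^-k for a primitive cube root of unity w. Thus sum_m ram3(m) z^m is the
    sum of the delta series at w and 1/w, although only rational numbers occur. *)
Definition ram3 (k : int) : rat := 3 * (3 %| k)%Z%:R - 1.

Lemma cop3_per k l : (k = l %[mod 3])%Z -> cop3 k = cop3 l.
Proof. by move=> eqkl; congr ((nat_of_bool _)%:R); lia. Qed.

Lemma ram3_per k l : (k = l %[mod 3])%Z -> ram3 k = ram3 l.
Proof. by move=> eqkl; congr (3 * (nat_of_bool _)%:R - 1); lia. Qed.

Lemma cop3N k : cop3 (- k) = cop3 k.
Proof. by congr ((nat_of_bool _)%:R); lia. Qed.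

Lemma ram3N k : ram3 (- k) = ram3 k.
Proof. by congr (3 * (nat_of_bool _)%:R - 1); lia. Qed.

Lemma ram3_sum j k l : ~~ (3 %| k - j)%Z -> (j + k + l = 0 %[mod 3])%Z ->
  ram3 j + ram3 k + ram3 l = 0.
Proof.
move=> jk jkl; rewrite /ram3.
case: (boolP (3 %| j)%Z) => j3; case: (boolP (3 %| k)%Z) => k3;
  case: (boolP (3 %| l)%Z) => l3; first [by exfalso; lia | by []].
Qed.

Section Instances.

Definition theta_ram j := theta (fun t => t.1%:~R ^+ j * ram3 (t.1 - t.2)).
Definition theta_cop j := theta (fun t => t.1%:~R ^+ j * cop3 (t.1 - t.2)).

(** [u_b] puts the zeros for the weight [ram3] at q^-l with 3 not dividing l; [u_c] puts those for
    the weight [cop3] at q^-l times a primitive cube root of unity with 3 | l. *)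
Let u_b (m l : int) := cop3 l.
Let u_c (m l : int) : rat := (3 %| l)%Z%:R * ram3 m.

(** Modulo 3 the rotated values of x - y differ by l and 2 l. They are distinct when 3 does not
    divide l, and [ram3] then sums to 0. *)
Let u_b_zero l n N : fsum (fun m => u_b m l * slice ram3 (n - m) (N - l * m)) = 0.
Proof.
apply: slice_zero => x y; rewrite /u_b -!mulrDr /cop3.
have [l3|l3] := boolP (3 %| l)%Z; first by rewrite mul0r.
by rewrite ram3_sum ?mulr0 //; lia.
Qed.

(** For 3 | l the rotation fixes x - y modulo 3. The three first coordinates are distinct modulo 3,
    and [ram3] sums to 0, unless 3 | x - y, where [cop3] vanishes. *)
Let u_c_zero l n N : fsum (fun m => u_c m l * slice cop3 (n - m) (N - l * m)) = 0.
Proof.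
apply: slice_zero => x y; rewrite /u_c.
have [l3|l3] := boolP (3 %| l)%Z; last by rewrite !mul0r !addr0.
rewrite !mul1r (cop3_per (k := l - x - y - (x - l)) (l := x - y)); last by lia.
rewrite (cop3_per (k := y + l - (- x - y)) (l := x - y)); last by lia.
rewrite -!mulrDl /cop3; have [k3|k3] := boolP (3 %| x - y)%Z; first by rewrite mulr0.
by rewrite ram3_sum ?mul0r //; lia.
Qed.

(** With S the series over the open cone, [X] below gives the coefficients in z of z f'(z) + S(z)
    f(z), and [W] is the j-th derivative z d/dz of this expression at z = 1. *)
Let W (c g : int -> int -> rat) j :=
  moment g j.+1 + \sum_(i < j.+1) 'C(j, i)%:R * (lambert c i * moment g (j - i)).

Let X (c g : int -> int -> rat) (N : nat) n := n%:~R * g n N%:Z +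
  fsum (fun p : int * int => c p.1 p.2 * g (n - p.1) (N%:Z - p.2 * p.1)).

Let X_supported c g N : (forall m l, c m l != 0 -> 0 < l * m) ->
  (forall n M, g n M != 0 -> 3 * n ^+ 2 <= 4 * M) -> fsupported (X c g N).
Proof.
move=> cs gs; apply: fsupportedD; last exact: cone_sum_supported.
by have := moment_supported gs 1 N.
Qed.

Let WE c g j N : (forall m l, c m l != 0 -> 0 < l * m) ->
  (forall n M, g n M != 0 -> 3 * n ^+ 2 <= 4 * M) ->
  W c g j N = fsum (fun n => n%:~R ^+ j * X c g N n).
Proof.
move=> cs gs; rewrite /W fpsD -(moment_sum cs gs) -fsumD.
- by apply: eq_fsum => n; rewrite /X mulrDr exprSr mulrA.
- exact: moment_supported.
- exact/fsupportedZ/cone_sum_supported.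
Qed.

Let c_b m l := open_cone_sign m l * u_b m l.
Let c_c m l := open_cone_sign m l * u_c m l.

Let half_eq0 (x : rat) : 2 * x = 0 -> x = 0.
Proof. by move/eqP; rewrite mulf_eq0 => /orP[//|/eqP]. Qed.

Let X_b N n : X c_b (slice ram3) N n = 0.
Proof.
have u_opp m l : u_b m (- l) = u_b m l by rewrite /u_b cop3N.
have u_per m l : u_b m (l + 3) = u_b m l by apply: cop3_per; lia.
have u_sum : u_b 0 1 + u_b 0 2 + u_b 0 3 = 2 by [].
have := @theta_log_derivative u_b (slice ram3) (fun _ _ => erefl) u_opp u_per u_sum
  (@slice_supp ram3) (slice_even ram3_per) (slice_shift ram3_per) u_b_zero n N.
rewrite (_ : u_b 0 0 = 0) // mul0r addr0 => key.
apply: half_eq0; apply: etrans key; rewrite /X mulrDr mulrA; congr (_ + 2 * _).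
apply: eq_fsum => -[m l]; rewrite /c_b mulrA /=; congr (_ * _).
rewrite /open_cone_sign /cone_sign /u_b /cop3; have [->|l0] := eqVneq l 0; first by rewrite !mulr0.
by congr ((_ - _) * _); congr (nat_of_bool _)%:R; lia.
Qed.

(** The row l = 0 contributes sum_{m > 0} ram3(m) z^m = - z (1 + 2 z) / (1 + z + z^2), whose terms
    cannot be summed at z = 1. Multiplication by z^-1 + 1 + z turns it into the polynomial - 1 - 2
    z. *)
Let X_c N n : let g := slice cop3 in
  X c_c g N (n - 1) + X c_c g N n + X c_c g N (n + 1) =
  g (n - 1) N%:Z - g (n + 1) N%:Z.
Proof.
move=> g.
have u_oppl m l : u_c (- m) l = u_c m l by rewrite /u_c ram3N.
have u_oppr m l : u_c m (- l) = u_c m l.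
  by congr ((nat_of_bool _)%:R * _); lia.
have u_per m l : u_c m (l + 3) = u_c m l.
  by congr ((nat_of_bool _)%:R * _); lia.
have u_sum : u_c 0 1 + u_c 0 2 + u_c 0 3 = 2 by [].
pose R (k : int) := fsum (fun m : int => (0 < m)%R%:R * (ram3 m * g (k - m) N%:Z)).
have R_supp k : fsupported (fun m : int => ram3 m * g (k - m) N%:Z).
  apply: fsupportedZ; apply: (@fsupported_int (`|k| + 2 * N)%N) => m /slice_supp/sqr_bound.
  by lia.
have XR k : X c_c g N k + R k + g k N%:Z = 0.
  have key := @theta_log_derivative u_c g u_oppl u_oppr u_per u_sum
    (@slice_supp cop3) (slice_even cop3_per) (slice_shift cop3_per) u_c_zero k N.
  apply: half_eq0; apply: etrans key; rewrite (_ : u_c 0 0 = 2) //.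
  rewrite !mulrDr mulrA -!addrA; congr (_ + _); rewrite addrA; congr (_ + _).
  rewrite -mulrDr; congr (_ * _).
  have -> : R k = fsum (fun p : int * int => ((0 < p.1) && (p.2 == 0))%:R *
      (ram3 p.1 * g (k - p.1) N%:Z)).
    rewrite fsum_pair; last first.
      have [r Fr] := R_supp k; apply: (@fsupported_prod _ _ r [:: 0]) => m l /=.
      rewrite mulf_eq0 negb_or pnatr_eq0 eqb0 negbK => /andP[/andP[_ /eqP ->]].
      by move=> /Fr ->; rewrite inE.
    apply: eq_fsum => m; rewrite (@fsum_seq _ [:: 0]) //; first by rewrite big_seq1 eqxx andbT.
    move=> l; rewrite mulf_eq0 negb_or pnatr_eq0 eqb0 negbK inE /= => /andP[/andP[_ ->]].
    by [].
  rewrite -fsumD; first last.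
  - have [r Fr] := R_supp k; apply: (@fsupported_prod _ _ r [:: 0]) => m l /=.
    rewrite mulf_eq0 negb_or pnatr_eq0 eqb0 negbK => /andP[/andP[_ /eqP ->]].
    by move=> /Fr ->; rewrite inE.
  - apply: (@cone_terms_supported c_c g); [exact: open_cone_sign_neq0 | exact: slice_supp].
  apply: eq_fsum => -[m l] /=; rewrite /c_c mulrA /open_cone_sign /cone_sign /u_c.
  have [->|l0] := eqVneq l 0.
    rewrite /= ltxx lexx !andbF !andbT mul0r !subr0 (mul0r m) subr0; ring.
  rewrite andbF !mul0r addr0 -[LHS]mulrA; congr (_ * _).
  by congr (_ - _); congr (nat_of_bool _)%:R; lia.
have R3 : R (n - 1) + R n + R (n + 1) = - g n N%:Z - 2 * g (n - 1) N%:Z.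
  pose C (m : int) := (0 < m - 1)%R%:R * ram3 (m - 1) + (0 < m)%R%:R * ram3 m
    + (0 < m + 1)%R%:R * ram3 (m + 1).
  have s0 k : fsupported (fun m : int => (0 < m)%R%:R * (ram3 m * g (k - m) N%:Z)).
    exact/fsupportedZ/R_supp.
  have s1 : fsupported (fun m : int => (0 < m - 1)%R%:R * (ram3 (m - 1) * g (n - m) N%:Z)).
    have := fsupported_can (h := fun m => m - 1) (h' := +%R^~ 1) _ (s0 (n - 1)).
    move=> sh; apply: sub_fsupported (sh _) => m.
      by rewrite opprB addrA subrK.
    by rewrite subrK.
  have s2 : fsupported (fun m : int => (0 < m + 1)%R%:R * (ram3 (m + 1) * g (n - m) N%:Z)).
    have := fsupported_can (h := fun m => m + 1) (h' := fun m => m - 1) _ (s0 (n + 1)).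
    move=> sh; apply: sub_fsupported (sh _) => m.
      by rewrite opprD addrACA subrr addr0.
    by rewrite addrK.
  transitivity (fsum (fun m => C m * g (n - m) N%:Z)).
    rewrite (_ : R (n - 1) = fsum (fun m : int => (0 < m - 1)%R%:R * (ram3 (m - 1) * g (n - m) N%:Z))).
      rewrite (_ : R (n + 1) = fsum (fun m : int => (0 < m + 1)%R%:R * (ram3 (m + 1) * g (n - m) N%:Z))).
        rewrite /R -fsumD // -fsumD //; last exact: fsupportedD.
        by apply: eq_fsum => m; rewrite /C; ring.
      rewrite /R -(fsum_addr 1); apply: eq_fsum => m.
      by rewrite opprD addrACA subrr addr0.
    rewrite /R -(fsum_addr (- 1)); apply: eq_fsum => m.
    by rewrite opprB addrA subrK.
  rewrite (@fsum_seq _ [:: 0; 1]) //.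
    rewrite !big_cons big_nil subr0 (_ : C 0 = -1) // (_ : C 1 = -2) //.
    by ring.
  move=> m; rewrite mulf_eq0 negb_or => /andP[+ _]; apply: contraR; rewrite !inE => m01.
  rewrite /C; have [m1|m1] := ltP 1 m.
    have [-> -> ->] : [/\ 0 < m - 1, 0 < m & 0 < m + 1] by split; lia.
    rewrite !mul1r.
    by apply/eqP/ram3_sum; lia.
  have [-> -> ->] : [/\ (0 < m - 1) = false, (0 < m) = false & (0 < m + 1) = false].
    by split; lia.
  by rewrite !mul0r !addr0.
have := XR (n - 1); have := XR n; have := XR (n + 1); move: R3.
move: (R (n - 1)) (R n) (R (n + 1)) (X _ _ _ _) (X _ _ _ _) (X _ _ _ _).
move: (g (n - 1) _) (g n _) (g (n + 1) _).
by move=> ? ? ? ? ? ? ? ? ?; lra.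
Qed.

Let lambert_b i : lambert c_b i =
  (if odd i then 2%:R else 0) * (sigma_series i - fps_V (sigma_series i)).
Proof.
apply: fpsP => K; rewrite lambertE; last 2 first.
- by [].
- by move=> m l; rewrite /u_b cop3N.
rewrite (_ : divisor_series _ = sigma_series i - fps_V (sigma_series i)).
  by rewrite -signr_odd; case: (odd i); rewrite ?expr1 ?expr0 ?fps_natM ?subrr ?mul0r // opprK.
rewrite -divisor_series_dvdr -divisor_seriesN -divisor_seriesD.
apply: fpsP => -[//|n]; apply: eq_bigr => d _.
by rewrite /u_b /cop3 dvdzE /=; case: (3 %| _)%N => /=; ring.
Qed.

Let lambert_c i : lambert c_c i = (if odd i then 2%:R else 0) *
  fps_V ((3 ^ i.+1)%:R * fps_V (sigma_series i) - sigma_series i).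
Proof.
apply: fpsP => K; rewrite lambertE; last 2 first.
- by move=> m l; rewrite /u_c ram3N.
- by move=> m l; rewrite /u_c; congr ((nat_of_bool _)%:R * _); lia.
rewrite (_ : divisor_series _ = fps_V ((3 ^ i.+1)%:R * fps_V (sigma_series i) - sigma_series i)).
  by rewrite -signr_odd; case: (odd i); rewrite ?expr1 ?expr0 ?fps_natM ?subrr ?mul0r // opprK.
rewrite expnS natrM -mulrA -divisor_series_dvdl -divisor_seriesZ -divisor_seriesN.
rewrite -divisor_seriesD -divisor_series_dvdr.
apply: fpsP => -[//|n]; apply: eq_bigr => d _.
by rewrite /u_c /ram3 !dvdzE /=; ring.
Qed.

Let W_b j : W c_b (slice ram3) j = 0.
Proof.
apply: fpsP => N; rewrite WE; [|exact: open_cone_sign_neq0|exact: slice_supp].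
by apply: fsum_eq0 => n; rewrite X_b mulr0.
Qed.

(** Summation by parts moves the factor z^-1 + 1 + z onto the test function p, to be specialized to
    odd powers of n. *)
Let W_c N (p : int -> rat) : let g := slice cop3 in
  fsum (fun n => (p (n + 1) + p n + p (n - 1)) * X c_c g N n) =
  fsum (fun n => (p (n + 1) - p (n - 1)) * g n N%:Z).
Proof.
move=> g.
have sX : fsupported (X c_c g N).
  by apply: X_supported; [exact: open_cone_sign_neq0|exact: slice_supp].
have sg : fsupported (fun n => g n N%:Z).
  by apply: (@fsupported_int (2 * N)%N) => n /slice_supp/sqr_bound; lia.
have shl (Y : int -> rat) : fsum (fun n => p (n + 1) * Y n) = fsum (fun n => p n * Y (n - 1)).
  by rewrite -[LHS](fsum_addr (- 1)); apply: eq_fsum => n; congr (p _ * Y _); lia.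
have shr (Y : int -> rat) : fsum (fun n => p (n - 1) * Y n) = fsum (fun n => p n * Y (n + 1)).
  by rewrite -[LHS](fsum_addr 1); apply: eq_fsum => n; congr (p _ * Y _); lia.
have sl Y : fsupported Y -> fsupported (fun n : int => Y (n - 1) : rat).
  exact: (fsupported_can (h := fun n : int => n - 1) (subrK (1 : int))).
have sr Y : fsupported Y -> fsupported (fun n : int => Y (n + 1) : rat).
  exact: (fsupported_can (h := fun n : int => n + 1) (addrK (1 : int))).
transitivity (fsum (fun n => p n * (X c_c g N (n - 1) + X c_c g N n + X c_c g N (n + 1)))).
  transitivity (fsum (fun n => p (n + 1) * X c_c g N n) + fsum (fun n => p n * X c_c g N n)
      + fsum (fun n => p (n - 1) * X c_c g N n)).
    rewrite -!fsumD; do ?[exact: fsupportedZ | apply: fsupportedD].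
    by apply: eq_fsum => n; ring.
  rewrite shl shr -!fsumD;
    do ?[exact/fsupportedZ/sl | exact/fsupportedZ/sr | exact: fsupportedZ | apply: fsupportedD].
  by apply: eq_fsum => n; ring.
transitivity (fsum (fun n => p (n + 1) * g n N%:Z) - fsum (fun n => p (n - 1) * g n N%:Z)).
  rewrite (shl (fun n => g n N%:Z)) (shr (fun n => g n N%:Z)) -fsumB.
  - by apply: eq_fsum => n; rewrite X_c mulrBr.
  - exact/fsupportedZ/(sl (fun n => g n N%:Z)).
  - exact/fsupportedZ/(sr (fun n => g n N%:Z)).
rewrite -fsumB; try exact: fsupportedZ.
by apply: eq_fsum => n; ring.
Qed.

Local Notation s := sigma_series.
Local Notation E i := (2%:R * (s i - fps_V (s i))).
Local Notation F i := (2%:R * fps_V ((3 ^ i.+1)%:R * fps_V (s i) - s i)).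

Lemma theta_ram_moments :
  [/\ theta_ram 2 + E 1 * theta_ram 0 = 0,
      theta_ram 4 + 3%:R * (E 1 * theta_ram 2) + E 3 * theta_ram 0 = 0
    & theta_ram 6 + 5%:R * (E 1 * theta_ram 4) + 10%:R * (E 3 * theta_ram 2)
        + E 5 * theta_ram 0 = 0].
Proof.
have := (W_b 1, W_b 3, W_b 5); rewrite /W !big_ord_recr !big_ord0 /=.
rewrite !lambert_b /= !mul0r !mulr0 !addr0 !add0r !moment_slice -!/(theta_ram _).
rewrite !subnn !binn !bin1 (_ : 'C(5, 3) = 10)%N //.
by case=> -[w1 w3 w5]; split; [rewrite -w1 | rewrite -w3 | rewrite -w5]; ring.
Qed.

(** The constants are those of p(n + 1) + p(n) + p(n - 1) and p(n + 1) - p(n - 1) for p = n, n^3,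
    n^5; for n^3 these are 3 n^3 + 6 n and 6 n^2 + 2. *)
Lemma theta_cop_moments :
  let W1 := theta_cop 2 + F 1 * theta_cop 0 in
  let W3 := theta_cop 4 + 3%:R * (F 1 * theta_cop 2) + F 3 * theta_cop 0 in
  let W5 := theta_cop 6 + 5%:R * (F 1 * theta_cop 4) + 10%:R * (F 3 * theta_cop 2)
        + F 5 * theta_cop 0 in
  [/\ 3%:R * W1 = 2%:R * theta_cop 0,
      3%:R * W3 + 6%:R * W1 = 6%:R * theta_cop 2 + 2%:R * theta_cop 0
    & 3%:R * W5 + 20%:R * W3 + 10%:R * W1 =
      10%:R * theta_cop 4 + 20%:R * theta_cop 2 + 2%:R * theta_cop 0].
Proof.
move=> W1 W3 W5; pose g := slice cop3; have bin53 : 'C(5, 3) = 10%N by [].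
have cs := @open_cone_sign_neq0 u_c; have gs := @slice_supp cop3.
have -> : W1 = W c_c g 1.
  rewrite /W !big_ord_recr !big_ord0 /= !lambert_c /= !mul0r !mulr0 !addr0 !add0r.
  by rewrite !moment_slice -!/(theta_cop _) !subnn !binn ?bin1 ?bin53 /W1; ring.
have -> : W3 = W c_c g 3.
  rewrite /W !big_ord_recr !big_ord0 /= !lambert_c /= !mul0r !mulr0 !addr0 !add0r.
  by rewrite !moment_slice -!/(theta_cop _) !subnn !binn ?bin1 ?bin53 /W3; ring.
have -> : W5 = W c_c g 5.
  rewrite /W !big_ord_recr !big_ord0 /= !lambert_c /= !mul0r !mulr0 !addr0 !add0r.
  by rewrite !moment_slice -!/(theta_cop _) !subnn !binn ?bin1 ?bin53 /W5; ring.
have sX N j : fsupported (fun n => n%:~R ^+ j * X c_c g N n).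
  by apply/fsupportedZ/X_supported.
have sg N j : fsupported (fun n => n%:~R ^+ j * g n N%:Z) by exact: moment_supported.
have lin2 (c d : rat) (Y Z : int -> rat) : fsupported Y -> fsupported Z ->
    fsum (fun n => c * Y n + d * Z n) = c * fsum Y + d * fsum Z.
  by move=> sY sZ; rewrite fsumD ?fsumZ //; apply: (fsupportedZ (fun=> _)).
have lin3 (c d e : rat) (Y Z T : int -> rat) : fsupported Y -> fsupported Z -> fsupported T ->
    fsum (fun n => c * Y n + d * Z n + e * T n) = c * fsum Y + d * fsum Z + e * fsum T.
  move=> sY sZ sT; rewrite fsumD ?lin2 ?fsumZ //; last exact: (fsupportedZ (fun=> _)).
  by apply: fsupportedD; apply: (fsupportedZ (fun=> _)).
rewrite /theta_cop -!moment_slice; split; apply: fpsP => N.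
- have := W_c N (fun n => n%:~R ^+ 1); rewrite !fps_natM (WE _ _ cs gs) -!fsumZ => eqW.
  transitivity (fsum (fun n : int =>
      ((n + 1)%:~R ^+ 1 + n%:~R ^+ 1 + (n - 1)%:~R ^+ 1) * X c_c g N n)).
    by apply: eq_fsum => n; rewrite !intrD; ring.
  by rewrite eqW; apply: eq_fsum => n; rewrite !intrD; ring.
- rewrite !fpsD !fps_natM !(WE _ _ cs gs) -(lin2 _ _ _ _ (sX N 3%N) (sX N 1%N)).
  rewrite -(lin2 _ _ _ _ (sg N 2%N) (sg N 0%N)).
  have := W_c N (fun n => n%:~R ^+ 3); rewrite -/g => eqW.
  transitivity (fsum (fun n : int =>
      ((n + 1)%:~R ^+ 3 + n%:~R ^+ 3 + (n - 1)%:~R ^+ 3) * X c_c g N n)).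
    by apply: eq_fsum => n; rewrite !intrD; ring.
  by rewrite eqW; apply: eq_fsum => n; rewrite !intrD; ring.
- rewrite !fpsD !fps_natM !(WE _ _ cs gs).
  rewrite -(lin3 _ _ _ _ _ _ (sX N 5%N) (sX N 3%N) (sX N 1%N)).
  rewrite -(lin3 _ _ _ _ _ _ (sg N 4%N) (sg N 2%N) (sg N 0%N)).
  have := W_c N (fun n => n%:~R ^+ 5); rewrite -/g => eqW.
  transitivity (fsum (fun n : int =>
      ((n + 1)%:~R ^+ 5 + n%:~R ^+ 5 + (n - 1)%:~R ^+ 5) * X c_c g N n)).
    by apply: eq_fsum => n; rewrite !intrD; ring.
  by rewrite eqW; apply: eq_fsum => n; rewrite !intrD; ring.
Qed.

End Instances.

(** This is the sum of z^6 and its complex conjugate for z = x + y exp(i pi / 3), hence harmonic and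
    invariant under the hexagonal symmetries. *)
Definition hex_harm (x y : int) : rat :=
  (2 * (x ^+ 2 + x * y + y ^+ 2) ^+ 3 - 27 * (x * y * (x + y)) ^+ 2)%:~R.

Section HexagonalSymmetry.
Variable rho : int -> rat.
Hypothesis rho_per : forall k l, (k = l %[mod 3])%Z -> rho k = rho l.
Hypothesis rho_even : forall k, rho (- k) = rho k.

Let th (p : int -> int -> rat) := theta (fun t => p t.1 t.2 * rho (t.1 - t.2)).

Let th_ext p q : (forall x y, p x y = q x y) -> th p = th q.
Proof. by move=> eqpq; apply: eq_gser => t; rewrite eqpq. Qed.

Let thD p q : th (fun x y => p x y + q x y) = th p + th q.
Proof.
rewrite /th -(gserD _ _ qform_fibers); apply: eq_gser => t; exact: mulrDl.
Qed.

Let thN p : th (fun x y => - p x y) = - th p.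
Proof. by rewrite /th -gserN; apply: eq_gser => t; exact: mulNr. Qed.

Let thZ k p : th (fun x y => k%:R * p x y) = k%:R * th p.
Proof. by rewrite /th -gserZ; apply: eq_gser => t; rewrite mulrA. Qed.

Let th_D p : th (fun x y => (x ^+ 2 + x * y + y ^+ 2)%:~R * p x y) = fps_D (th p).
Proof.
rewrite /th gser_D; apply: eq_gser => -[x y]; rewrite -mulrA; congr (_ * _).
by rewrite -qformE.
Qed.

Let th_swap (p : int -> rat) : th (fun _ y => p y) = th (fun x _ => p x).
Proof.
rewrite /th [RHS](@gser_bij _ _ _ _ (fun t : int * int => (t.2, t.1)) (fun t => (t.2, t.1))).
- apply: fpsP => n; apply: eq_fsum => -[x y] /=; rewrite -[y - x]opprB rho_even.
  by congr ((nat_of_bool _)%:R * _); rewrite -!eqz_nat !qformE; congr (_ == _); ring.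
- by case.
- by case.
Qed.

Let th_sum (p : int -> rat) : th (fun x y => p (x + y)) = th (fun x _ => p x).
Proof.
rewrite /th [RHS](@gser_bij _ _ _ _ (fun t : int * int => (t.1 + t.2, - t.2))
  (fun t => (t.1 + t.2, - t.2))).
- apply: fpsP => n; apply: eq_fsum => -[x y] /=.
  rewrite (rho_per (k := x + y - - y) (l := x - y)); last by lia.
  by congr ((nat_of_bool _)%:R * _); rewrite -!eqz_nat !qformE; congr (_ == _); ring.
- by case=> x y; rewrite /= addrK opprK.
- by case=> x y; rewrite /= addrK opprK.
Qed.

(** The automorphisms (y, x) and (x + y, -y) of Q preserve the weight and carry x to y and to x +
    y. *)
Let th_avg j : 3%:R * th (fun x _ => x%:~R ^+ j) =
  th (fun x y => (x ^+ j + y ^+ j + (x + y) ^+ j)%:~R).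
Proof.
rewrite (_ : th (fun x y => _%:~R) = th (fun x y => x%:~R ^+ j + y%:~R ^+ j + (x + y)%:~R ^+ j)).
  rewrite (thD (fun x y => x%:~R ^+ j + y%:~R ^+ j) (fun x y => (x + y)%:~R ^+ j)).
  rewrite (thD (fun x _ => x%:~R ^+ j) (fun _ y => y%:~R ^+ j)).
  by rewrite (th_swap (fun y => y%:~R ^+ j)) (th_sum (fun y => y%:~R ^+ j)); ring.
by apply: th_ext => x y; rewrite !(rmorphD, rmorphXn).
Qed.

Let th0 := th (fun _ _ => 1).
Let thh := th hex_harm.

Lemma theta_power2 : 3%:R * th (fun x _ => x%:~R ^+ 2) = 2%:R * fps_D th0.
Proof.
rewrite th_avg -th_D -thZ; apply: th_ext => x y.
by ring.
Qed.

Lemma theta_power4 : 3%:R * th (fun x _ => x%:~R ^+ 4) = 2%:R * fps_D (fps_D th0).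
Proof.
rewrite th_avg -!th_D -thZ; apply: th_ext => x y.
by ring.
Qed.

(** With P = x y (x + y), the power sums of x, y, x + y are 2 Q^3 + 3 P^2 in degree 6 and 2 Q^4 + 8
    Q P^2 in degree 8; P^2 is then eliminated in favour of [hex_harm], and Q acts as D. *)
Lemma theta_power6 :
  27%:R * th (fun x _ => x%:~R ^+ 6) = 20%:R * fps_D (fps_D (fps_D th0)) - thh.
Proof.
pose q x y : rat := (x ^+ 2 + x * y + y ^+ 2)%:~R.
have -> : 20%:R * fps_D (fps_D (fps_D th0)) - thh =
    th (fun x y => 20%:R * (q x y * (q x y * (q x y * 1))) + - hex_harm x y).
  rewrite (thD (fun x y => 20%:R * (q x y * (q x y * (q x y * 1))))) (thN hex_harm) !thZ.
  by rewrite (th_D (fun x y => q x y * (q x y * 1))) (th_D (fun x y => q x y * 1))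
    (th_D (fun _ _ => 1)).
apply: (@fps_natI 2); rewrite mulrCA th_avg -[LHS]thZ -[RHS]thZ.
by apply: th_ext => x y; rewrite /q /hex_harm; ring.
Qed.

Lemma theta_power8 : 81%:R * th (fun x _ => x%:~R ^+ 8) =
  70%:R * fps_D (fps_D (fps_D (fps_D th0))) - 8%:R * fps_D thh.
Proof.
pose q x y : rat := (x ^+ 2 + x * y + y ^+ 2)%:~R.
have -> : 70%:R * fps_D (fps_D (fps_D (fps_D th0))) - 8%:R * fps_D thh =
    th (fun x y => 70%:R * (q x y * (q x y * (q x y * (q x y * 1))))
      + - (8%:R * (q x y * hex_harm x y))).
  rewrite (thD (fun x y => 70%:R * (q x y * (q x y * (q x y * (q x y * 1)))))).
  rewrite (thN (fun x y => 8%:R * (q x y * hex_harm x y))) !thZ.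
  rewrite (th_D hex_harm) (th_D (fun x y => q x y * (q x y * (q x y * 1)))).
  by rewrite (th_D (fun x y => q x y * (q x y * 1))) (th_D (fun x y => q x y * 1))
    (th_D (fun _ _ => 1)).
apply: (@fps_natI 2); rewrite mulrCA th_avg -[LHS]thZ -[RHS]thZ.
by apply: th_ext => x y; rewrite /q /hex_harm; ring.
Qed.

End HexagonalSymmetry.

Definition theta_a := theta (fun _ => 1).
(** Exchanging x and y shows that this is the sum of w^(x - y) q^Q(x, y), w a primitive cube root of
    unity. *)
Definition theta_b := theta (fun t => ram3 (t.1 - t.2) / 2).
(* This is [c(q^3)], whose exponents are integers. *)
Definition theta_c := theta (fun t => cop3 (t.1 - t.2) / 2).
Definition theta_h := theta (fun t => hex_harm t.1 t.2).

Lemma fps_double_half (p : int * int -> rat) :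
  2%:R * theta (fun t => p t / 2) = theta p.
Proof. by rewrite -gserZ; apply: eq_gser => t; rewrite mulrC divfK. Qed.

(* Multiplication by [sqrt (-3)] maps the hexagonal lattice onto its sublattice
   [x = y mod 3]. *)
Lemma theta_sublattice (p : int -> int -> rat) :
  theta (fun t => (3 %| t.1 - t.2)%Z%:R * p t.1 t.2) =
  fps_V (theta (fun t => p (t.1 - t.2) (t.1 + 2 * t.2))).
Proof.
rewrite gser_V; apply: fpsP => n /=.
pose psi (t : int * int) := (t.1 - t.2, t.1 + 2 * t.2).
pose I := [set t : int * int | (3 %| t.1 - t.2)%Z]%classic.
rewrite /fsum -[LHS](fsbig_widen I) //; last first.
  by move=> -[x y] [_ /= /negP/negbTE->]; rewrite mul0r mulr0.
rewrite (reindex_fsbig psi setT I).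
  apply: eq_fsbigr => -[x y] _ /=.
  rewrite (_ : (3 %| x - y - (x + 2 * y))%Z); last by lia.
  rewrite mul1r; congr ((nat_of_bool _)%:R * _).
  by rewrite -!eqz_nat PoszM !qformE; congr (_ == _); ring.
split=> [[x y] _|[x y] [z w] _ _|[x y]]; rewrite /I /psi /=.
- by lia.
- by case=> eq1 eq2; congr (_, _); lia.
move=> xy; have [k ek] : exists k, y - x = 3 * k by exists ((y - x) %/ 3)%Z; lia.
by exists (x + k, k) => //=; congr (_, _); lia.
Qed.

Lemma theta_sublattice_a : theta (fun t => (3 %| t.1 - t.2)%Z%:R) = fps_V theta_a.
Proof.
rewrite -(theta_sublattice (fun _ _ => 1)); apply: eq_gser => t.
by rewrite mulr1.
Qed.

(** The factor - 27 is the sixth power of sqrt (-3), by which the sublattice is scaled. *)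
Lemma theta_sublattice_h :
  theta (fun t => (3 %| t.1 - t.2)%Z%:R * hex_harm t.1 t.2) = - (27%:R * fps_V theta_h).
Proof.
rewrite (theta_sublattice hex_harm) -(rmorph_nat fps_V 27) -rmorphM /= -rmorphN.
congr fps_V; rewrite -gserZ -gserN; apply: eq_gser => t.
by rewrite /hex_harm; ring.
Qed.

Lemma theta_cop0 : theta_cop 0 = 2%:R * theta_c.
Proof. by rewrite fps_double_half; apply: eq_gser => t; rewrite mul1r. Qed.

Lemma theta_ram0 : theta_ram 0 = 2%:R * theta_b.
Proof. by rewrite fps_double_half; apply: eq_gser => t; rewrite mul1r. Qed.

Lemma theta_aE : theta_a = fps_V theta_a + 2%:R * theta_c.
Proof.
rewrite -theta_sublattice_a fps_double_half -(gserD _ _ qform_fibers).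
by apply: eq_gser => t; rewrite /cop3; case: (3 %| _)%Z.
Qed.

Lemma theta_bE : theta_b = fps_V theta_a - theta_c.
Proof.
rewrite -theta_sublattice_a -gserN -(gserD _ _ qform_fibers).
by apply: eq_gser => t; rewrite /ram3 /cop3; case: (3 %| _)%Z; rewrite /=; lra.
Qed.

Lemma theta_cop_h : theta (fun t => hex_harm t.1 t.2 * cop3 (t.1 - t.2)) =
  theta_h + 27%:R * fps_V theta_h.
Proof.
rewrite -[27%:R * _]opprK -theta_sublattice_h -gserN -(gserD _ _ qform_fibers).
by apply: eq_gser => t; rewrite /cop3; case: (3 %| _)%Z; rewrite /=; ring.
Qed.

Lemma theta_ram_h : theta (fun t => hex_harm t.1 t.2 * ram3 (t.1 - t.2)) =
  - (theta_h + 81%:R * fps_V theta_h).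
Proof.
rewrite (_ : 81%:R * _ = 3%:R * (27%:R * fps_V theta_h)); last by ring.
rewrite -[27%:R * _]opprK -theta_sublattice_h -gserN -gserZ -(gserD _ _ qform_fibers) -gserN.
by apply: eq_gser => t; rewrite /ram3; ring.
Qed.

Lemma theta_cop_powers :
  [/\ 3%:R * theta_cop 2 = 2%:R * fps_D (2%:R * theta_c),
      3%:R * theta_cop 4 = 2%:R * fps_D (fps_D (2%:R * theta_c))
    & 27%:R * theta_cop 6 = 20%:R * fps_D (fps_D (fps_D (2%:R * theta_c)))
        - (theta_h + 27%:R * fps_V theta_h)].
Proof.
rewrite -theta_cop0 -theta_cop_h; split.
- exact: (theta_power2 cop3_per cop3N).
- exact: (theta_power4 cop3_per cop3N).
- exact: (theta_power6 cop3_per cop3N).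
Qed.

Lemma theta_ram_powers :
  [/\ 3%:R * theta_ram 2 = 2%:R * fps_D (2%:R * theta_b),
      3%:R * theta_ram 4 = 2%:R * fps_D (fps_D (2%:R * theta_b))
    & 27%:R * theta_ram 6 = 20%:R * fps_D (fps_D (fps_D (2%:R * theta_b)))
        + (theta_h + 81%:R * fps_V theta_h)].
Proof.
rewrite -theta_ram0 -[theta_h + _]opprK -theta_ram_h; split.
- exact: (theta_power2 ram3_per ram3N).
- exact: (theta_power4 ram3_per ram3N).
- exact: (theta_power6 ram3_per ram3N).
Qed.

Definition theta_pow j := theta (fun t => t.1%:~R ^+ j).

Lemma theta_pow_powers :
  [/\ 3%:R * theta_pow 2 = 2%:R * fps_D theta_a,
      3%:R * theta_pow 4 = 2%:R * fps_D (fps_D theta_a),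
      27%:R * theta_pow 6 = 20%:R * fps_D (fps_D (fps_D theta_a)) - theta_h
    & 81%:R * theta_pow 8 =
        70%:R * fps_D (fps_D (fps_D (fps_D theta_a))) - 8%:R * fps_D theta_h].
Proof.
have powE j : theta_pow j = theta (fun t => t.1%:~R ^+ j * 1).
  by apply: eq_gser => t; rewrite mulr1.
have aE : theta_a = theta (fun t => 1 * 1) by apply: eq_gser => t; rewrite mulr1.
have hE : theta_h = theta (fun t => hex_harm t.1 t.2 * 1).
  by apply: eq_gser => t; rewrite mulr1.
have p1 (k l : int) : (k = l %[mod 3])%Z -> (1 : rat) = 1 by [].
rewrite !powE aE hE; split.
- exact: (theta_power2 (rho := fun=> 1) p1).
- exact: (theta_power4 (rho := fun=> 1) p1).
- exact: (theta_power6 (rho := fun=> 1) p1).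
- exact: (theta_power8 (rho := fun=> 1) p1).
Qed.

(** * Sums over representations *)

Lemma F_ge0 k (x : (2 * k).-tuple int) : 0 <= F k x.
Proof.
apply: sumr_ge0 => j _; rewrite -(pmulr_rge0 _ (isT : 0 < 4 :> int)).
have := sqr_ge0 (2 * x`_(2 * j) + x`_(2 * j).+1); have := sqr_ge0 x`_(2 * j).+1.
by move: (x`_(2 * j)) (x`_(2 * j).+1) => y z; lia.
Qed.

Definition tuple_form k (x : (2 * k).-tuple int) : nat := `|F k x|%N.

Lemma tuple_formE k (x : (2 * k).-tuple int) : (tuple_form x)%:Z = F k x.
Proof. by rewrite gez0_abs // F_ge0. Qed.

Lemma tuple_form_fibers k : finite_fibers (@tuple_form k).
Proof.
move=> n; have /finite_seqP[s es] := finite_reps k n; exists s => x xn.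
have : reps k n x by rewrite /reps /= -tuple_formE xn.
by rewrite es.
Qed.

Lemma double_succ k : (2 * k).+2 = (2 * k.+1)%N. Proof. by rewrite mulnS. Qed.

Definition tuple_cons2 k (p : (int * int) * (2 * k).-tuple int) : (2 * k.+1).-tuple int :=
  tcast (double_succ k) [tuple of p.1.1 :: p.1.2 :: p.2].

Definition tuple_uncons2 k (x : (2 * k.+1).-tuple int) : (int * int) * (2 * k).-tuple int :=
  let y := tcast (esym (double_succ k)) x in
  ((thead y, thead (behead_tuple y)), behead_tuple (behead_tuple y)).

Lemma tuple_cons2K k : cancel (@tuple_cons2 k) (@tuple_uncons2 k).
Proof.
case=> -[x y] t; rewrite /tuple_uncons2 /tuple_cons2 tcastK /=.
by congr (_, _); apply: val_inj.
Qed.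

Lemma tuple_uncons2K k : cancel (@tuple_uncons2 k) (@tuple_cons2 k).
Proof.
move=> x; rewrite /tuple_uncons2 /tuple_cons2 /=.
set y := tcast _ x; rewrite -[x](tcastKV (double_succ k)) -/y; congr tcast.
by apply: val_inj; rewrite /=; case/tupleP: y => u y; case/tupleP: y => v y.
Qed.

Lemma tuple_form_cons2 k p : tuple_form (@tuple_cons2 k p) = (qform p.1 + tuple_form p.2)%N.
Proof.
case: p => -[x y] t; apply/eqP; rewrite -eqz_nat PoszD !tuple_formE qformE /=; apply/eqP.
rewrite /F /tuple_cons2 big_ord_recl; congr (_ + _); first by rewrite val_tcast muln0.
by apply: eq_bigr => j _; rewrite val_tcast lift0 -double_succ.
Qed.

Lemma gser_tuple_cons2 k (p : int -> rat) :
  gser (@tuple_form k.+1) (fun x => p x`_0) =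
  theta (fun t => p t.1) * gser (@tuple_form k) (fun=> 1).
Proof.
rewrite (gserM _ _ qform_fibers (tuple_form_fibers k)).
rewrite (gser_bij _ _ (@tuple_cons2K k) (@tuple_uncons2K k)).
apply: fpsP => n; apply: eq_fsum => -[[x y] t] /=.
by rewrite tuple_form_cons2 val_tcast mulr1.
Qed.

Lemma gser_tuple1 k : gser (@tuple_form k) (fun=> 1) = theta_a ^+ k.
Proof.
elim: k => [|k IH]; last by rewrite exprS -IH (gser_tuple_cons2 k (fun=> 1)).
apply: fpsP => n; rewrite expr0 fps1 /= (@fsum_seq _ [:: [tuple]]) //.
  by rewrite big_seq1 mulr1 /tuple_form /F big_ord0 eq_sym.
by move=> t _; rewrite inE; apply/eqP; exact: tuple0.
Qed.

(** The first pair of coordinates carries the weight; each of the k other pairs contributes a factor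
    a. *)
Lemma reps_sum k n j :
  \sum_(x <- fset_set (reps k.+1 n)) (x`_0)%:~R ^+ j =
  (theta_pow j * theta_a ^+ k) n :> rat.
Proof.
have <- : gser (@tuple_form k.+1) (fun x => (x`_0)%:~R ^+ j) = theta_pow j * theta_a ^+ k.
  by rewrite (gser_tuple_cons2 k (fun y => y%:~R ^+ j)) gser_tuple1.
rewrite -fsbig_finite; last exact: finite_reps.
rewrite /= /fsum -[RHS](fsbig_widen (reps k.+1 n)) //; last first.
  move=> x [_ /= xn]; case: eqP => [/(congr1 Posz)|_]; last by rewrite mul0r.
  by rewrite tuple_formE => xn'; case: xn.
apply: eq_fsbigr => x /set_mem xn.
by rewrite -eqz_nat tuple_formE xn eqxx mul1r.
Qed.

Lemma theta_pow0 : theta_pow 0 = theta_a.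
Proof. by []. Qed.

Section Coefficients.
Variable n : nat.
Let R k j : rat := (theta_pow j * theta_a ^+ k) n.

Lemma L12_8_coef : (L12_8 n)%:~R = 135 * R 7 4 - 54 * n%:R * R 7 2 + 2 * n%:R ^+ 2 * R 7 0.
Proof.
rewrite /R -!reps_sum /L12_8 fsbig_finite; last exact: finite_reps.
rewrite rmorph_sum !mulr_sumr -sumrB -big_split; apply: eq_bigr => x _ /=.
by rewrite expr0; ring.
Qed.

Lemma L12_6_coef : (L12_6 n)%:~R = 162 * R 5 6 - 162 * n%:R * R 5 4
  + 36 * n%:R ^+ 2 * R 5 2 - n%:R ^+ 3 * R 5 0.
Proof.
rewrite /R -!reps_sum /L12_6 fsbig_finite; last exact: finite_reps.
rewrite rmorph_sum !mulr_sumr -sumrB -big_split -sumrB; apply: eq_bigr => x _ /=.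
by rewrite expr0; ring.
Qed.

Lemma L8_4_coef : (L8_4 n)%:~R = 45 * R 3 4 - 30 * n%:R * R 3 2 + 2 * n%:R ^+ 2 * R 3 0.
Proof.
rewrite /R -!reps_sum /L8_4 fsbig_finite; last exact: finite_reps.
rewrite rmorph_sum !mulr_sumr -sumrB -big_split; apply: eq_bigr => x _ /=.
by rewrite expr0; ring.
Qed.

Lemma L6_2_coef : (L6_2 n)%:~R = 9 * R 1 4 - 9 * n%:R * R 1 2 + n%:R ^+ 2 * R 1 0.
Proof.
rewrite /R -!reps_sum /L6_2 fsbig_finite; last exact: finite_reps.
rewrite rmorph_sum !mulr_sumr -sumrB -big_split; apply: eq_bigr => x _ /=.
by rewrite expr0; ring.
Qed.

(** The terms with 4121 are split off because they form - 4121 times the polynomial of [L8_4];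
    moreover 170100 = 45 * 3780 and 28350 = 30 * 945. *)
Lemma calL4_coef : (calL4 n)%:~R = 164025%:R * R 3 8 - 306180%:R * n%:R * R 3 6
  + 170100%:R * n%:R ^+ 2 * R 3 4 - 28350%:R * n%:R ^+ 3 * R 3 2
  + 675 * n%:R ^+ 4 * R 3 0
  - 4121%:R * (45 * R 3 4 - 30 * n%:R * R 3 2 + 2 * n%:R ^+ 2 * R 3 0).
Proof.
rewrite /calL4 fsbig_finite; last exact: finite_reps.
set r := fset_set _.
have lin5 (c8 c6 c4 c2 c0 : rat) : \sum_(x <- r) (c8 * (x`_0)%:~R ^+ 8 + c6 * (x`_0)%:~R ^+ 6
    + c4 * (x`_0)%:~R ^+ 4 + c2 * (x`_0)%:~R ^+ 2 + c0 * (x`_0)%:~R ^+ 0) =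
    c8 * R 3 8 + c6 * R 3 6 + c4 * R 3 4 + c2 * R 3 2 + c0 * R 3 0.
  by rewrite !big_split -!mulr_sumr !reps_sum.
pose N : rat := n%:R.
transitivity (164025%:R * R 3 8 + - (306180%:R * N) * R 3 6
  + (170100%:R * N ^+ 2 - 4121%:R * 45) * R 3 4
  + - (28350%:R * N ^+ 3 - 4121%:R * 30 * N) * R 3 2
  + (675 * N ^+ 4 - 4121%:R * 2 * N ^+ 2) * R 3 0); last first.
  by rewrite -/N; move: (R 3 8) (R 3 6) (R 3 4) (R 3 2) (R 3 0) N => *; ring.
rewrite -lin5 (raddf_sum intr); apply: eq_bigr => x _; rewrite /N; move: (x`_0) => y.
by rewrite expr0; ring.
Qed.

End Coefficients.

(** * The ring of cubic theta functions *)

Section CubicRing.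
Variables (R : comNzRingType) (D d : {additive R -> R}).
Hypothesis dE : forall x, d x = 12%:R * D x.
Hypothesis dM : forall x y, d (x * y) = d x * y + x * d y.

Let DZ k x : D (k%:R * x) = k%:R * D x.
Proof. by rewrite !mulr_natl raddfMn. Qed.

Let DZM k x y : D (k%:R * x * y) = k%:R * D (x * y).
Proof. by rewrite -mulrA DZ. Qed.

Let dD := raddfD d.
Let dN := raddfN d.

Let dZ k x : d (k%:R * x) = k%:R * d x.
Proof. by rewrite !mulr_natl raddfMn. Qed.

Let dX x n : d (x ^+ n.+2) = n.+2%:R * (x ^+ n.+1 * d x).
Proof.
elim: n => [|n IH]; first by rewrite expr2 dM; ring.
by rewrite exprS dM IH -[n.+3%:R]natr1 [x ^+ n.+2]exprS; ring.
Qed.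

Variables x K : R.
Local Notation x1 := (d x).
Local Notation x2 := (d x1).
Local Notation x3 := (d x2).
Local Notation x4 := (d x3).
Local Notation K1 := (d K).

(** In the application d is 12 q d/dq, x is a, K is 1728 h, and later y is b^3 and e is E2; the
    factor 12 gives their derivatives integer coefficients. The [deriv_pow] lemmas only use the
    Leibniz rule: they rewrite each combination of moments as a bracket in the derivatives of x and
    K. *)
Lemma deriv_pow8 : 45%:R * (x2 * x ^+ 7) - 18%:R * d (x1 * x ^+ 7) + d (d (x ^+ 8)) =
  35%:R * (x ^+ 6 * (x * x2 - 2%:R * x1 ^+ 2)).
Proof.
rewrite !(dD, dN, dZ, dX, dM, expr1).
by move: x2 x1 x => *; ring.
Qed.

Lemma deriv_pow2 : 6%:R * (x2 * x) - 6%:R * d (x1 * x) + d (d (x ^+ 2)) =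
  2%:R * (x * x2 - 2%:R * x1 ^+ 2).
Proof.
rewrite !(dD, dN, dZ, dX, dM, expr1).
by move: x2 x1 x => *; ring.
Qed.

Lemma deriv_pow4 : 15%:R * (x2 * x ^+ 3) - 10%:R * d (x1 * x ^+ 3) + d (d (x ^+ 4)) =
  9%:R * (x ^+ 2 * (x * x2 - 2%:R * x1 ^+ 2)).
Proof.
rewrite !(dD, dN, dZ, dX, dM, expr1).
by move: x2 x1 x => *; ring.
Qed.

Lemma deriv_pow6 :
  6%:R * ((20%:R * x3 - K) * x ^+ 5) - 108%:R * d (x2 * x ^+ 5)
    + 24%:R * d (d (x1 * x ^+ 5)) - d (d (d (x ^+ 6))) =
  6%:R * (5%:R * x ^+ 5 * x3 - 45%:R * x ^+ 4 * x1 * x2 + 60%:R * x ^+ 3 * x1 ^+ 3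
    - K * x ^+ 5).
Proof.
rewrite !(dD, dN, dZ, dX, dM, expr1).
by move: x3 x2 x1 x K => *; ring.
Qed.

Lemma deriv_pow4_4 :
  15%:R * ((70%:R * x4 - 8%:R * K1) * x ^+ 3)
    - 84%:R * d ((20%:R * x3 - K) * x ^+ 3)
    + 840%:R * d (d (x2 * x ^+ 3)) - 140%:R * d (d (d (x1 * x ^+ 3)))
    + 5%:R * d (d (d (d (x ^+ 4)))) =
  18%:R * (5%:R * x ^+ 3 * x4 - 80%:R * x ^+ 2 * x1 * x3 + 80%:R * x ^+ 2 * x2 ^+ 2
    + 40%:R * x * x1 ^+ 2 * x2 - 40%:R * x1 ^+ 4 - 2%:R * K1 * x ^+ 3
    + 14%:R * K * x ^+ 2 * x1).
Proof.
rewrite !(dD, dN, dZ, dX, dM, expr1).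
by move: x4 x3 x2 x1 K1 x K => *; ring.
Qed.

Variables y e : R.
Hypothesis dx : d x = x * e + 3%:R * x ^+ 3 - 4%:R * y.
Hypothesis dy : d y = 3%:R * (y * (e - x ^+ 2)).
Hypothesis de : d e = e ^+ 2 - 9%:R * x ^+ 4 + 8%:R * (x * y).

Hypothesis KE : K = 768%:R * (x * y * (x ^+ 3 - y)).

Let d2x : x2 = 2%:R * (x * e ^+ 2) + 12%:R * (x ^+ 3 * e) - 16%:R * (y * e)
  - 16%:R * (x ^+ 2 * y) + 18%:R * x ^+ 5.
Proof. by rewrite dx !(dD, dN, dZ, dX, dM, expr1, dx, dy, de); ring. Qed.

Let d3x : x3 = 6%:R * (x * e ^+ 3) + 54%:R * (x ^+ 3 * e ^+ 2) - 72%:R * (y * e ^+ 2)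
  + 162%:R * (x ^+ 5 * e) - 144%:R * (x ^+ 2 * (y * e)) + 162%:R * x ^+ 7
  - 168%:R * (x ^+ 4 * y).
Proof. by rewrite d2x !(dD, dN, dZ, dX, dM, expr1, dx, dy, de); ring. Qed.

Let d4x : x4 = 24%:R * (x * e ^+ 4) + 288%:R * (x ^+ 3 * e ^+ 3) - 384%:R * (y * e ^+ 3)
  + 1296%:R * (x ^+ 5 * e ^+ 2) - 1152%:R * (x ^+ 2 * (y * e ^+ 2))
  + 2592%:R * (x ^+ 7 * e) - 2688%:R * (x ^+ 4 * (y * e)) + 1944%:R * x ^+ 9
  - 3456%:R * (x ^+ 6 * y) + 1536%:R * (x ^+ 3 * y ^+ 2).
Proof. by rewrite d3x !(dD, dN, dZ, dX, dM, expr1, dx, dy, de); ring. Qed.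

(** All terms in e cancel, as in a Rankin-Cohen bracket of modular forms; the same happens in the
    two brackets of higher order. *)
Lemma rankin_cohen2 : x * x2 - 2%:R * x1 ^+ 2 = 32%:R * (y * (x ^+ 3 - y)).
Proof. by rewrite d2x dx; ring. Qed.

Lemma rankin_cohen3 :
  5%:R * x ^+ 5 * x3 - 45%:R * x ^+ 4 * x1 * x2 + 60%:R * x ^+ 3 * x1 ^+ 3 - K * x ^+ 5 =
  1344%:R * (5%:R * x ^+ 6 * y ^+ 2 - 2%:R * x ^+ 9 * y - 3%:R * x ^+ 3 * y ^+ 3)
    + 192%:R * (x ^+ 3 * y ^+ 3 - x ^+ 6 * y ^+ 2).
Proof. by rewrite KE d3x d2x dx; ring. Qed.

Lemma rankin_cohen4 :
  5%:R * x ^+ 3 * x4 - 80%:R * x ^+ 2 * x1 * x3 + 80%:R * x ^+ 2 * x2 ^+ 2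
    + 40%:R * x * x1 ^+ 2 * x2 - 40%:R * x1 ^+ 4 - 2%:R * K1 * x ^+ 3
    + 14%:R * K * x ^+ 2 * x1 =
  1024%:R * (56%:R * x ^+ 3 * y ^+ 3 - 10%:R * y ^+ 4)
    + 512%:R * (81%:R * x ^+ 9 * y - 173%:R * x ^+ 6 * y ^+ 2).
Proof.
rewrite KE d4x d3x d2x !(dD, dN, dZ, dX, dM, expr1, dx, dy).
by ring.
Qed.

Variables t2 t4 t6 t8 : R.
Hypothesis h2 : 18%:R * t2 = x1.
Hypothesis h4 : 216%:R * t4 = x2.
Hypothesis h6 : 216%:R * (216%:R * t6) = 20%:R * x3 - K.
Hypothesis h8 : 1296%:R * (1296%:R * t8) = 70%:R * x4 - 8%:R * K1.

(** The factor 24 on both sides allows t2, t4 and D to be exchanged for d without division; such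
    factors are cancelled later by [fps_natI]. *)
Lemma moments_pow8 : 24%:R * (9%:R * (135%:R * (t4 * x ^+ 7) - 54%:R * D (t2 * x ^+ 7)
    + 2%:R * D (D (x ^+ 8)))) =
  24%:R * (140%:R * (x ^+ 6 * y * (x ^+ 3 - y))).
Proof.
transitivity (3%:R * (45%:R * (d (d x) * x ^+ 7) - 18%:R * d (d x * x ^+ 7) + d (d (x ^+ 8)))).
  by rewrite -h4 -h2 !dE !(DZ, DZM); ring.
by rewrite deriv_pow8 rankin_cohen2; ring.
Qed.

Lemma moments_pow2 : 16%:R * (9%:R * (9%:R * (t4 * x) - 9%:R * D (t2 * x) + D (D (x ^+ 2)))) =
  16%:R * (4%:R * (y * (x ^+ 3 - y))).
Proof.
transitivity (6%:R * (d (d x) * x) - 6%:R * d (d x * x) + d (d (x ^+ 2))).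
  by rewrite -h4 -h2 !dE !(DZ, DZM); ring.
by rewrite deriv_pow2 rankin_cohen2; ring.
Qed.

Lemma moments_pow4 : 72%:R * (45%:R * (t4 * x ^+ 3) - 30%:R * D (t2 * x ^+ 3)
    + 2%:R * D (D (x ^+ 4))) =
  72%:R * (4%:R * (x ^+ 2 * y * (x ^+ 3 - y))).
Proof.
transitivity (15%:R * (d (d x) * x ^+ 3) - 10%:R * d (d x * x ^+ 3) + d (d (x ^+ 4))).
  by rewrite -h4 -h2 !dE !(DZ, DZM); ring.
by rewrite deriv_pow4 rankin_cohen2; ring.
Qed.

Lemma moments_pow6 : 576%:R * (3%:R * (162%:R * (t6 * x ^+ 5) - 162%:R * D (t4 * x ^+ 5)
    + 36%:R * D (D (t2 * x ^+ 5)) - D (D (D (x ^+ 6))))) =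
  576%:R * (4%:R * (17%:R * x ^+ 6 * y ^+ 2 - 7%:R * x ^+ 9 * y - 10%:R * x ^+ 3 * y ^+ 3)).
Proof.
transitivity (6%:R * ((20%:R * d (d (d x)) - K) * x ^+ 5) - 108%:R * d (d (d x) * x ^+ 5)
    + 24%:R * d (d (d x * x ^+ 5)) - d (d (d (x ^+ 6)))).
  by rewrite -h6 -h4 -h2 !dE !(DZ, DZM); ring.
by rewrite deriv_pow6 rankin_cohen3; ring.
Qed.

Lemma moments_pow4_4 : 2304%:R * (9%:R * (1215%:R * (t8 * x ^+ 3) - 2268%:R * D (t6 * x ^+ 3)
    + 1260%:R * D (D (t4 * x ^+ 3)) - 210%:R * D (D (D (t2 * x ^+ 3)))
    + 5%:R * D (D (D (D (x ^+ 4)))))) =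
  2304%:R * (4%:R * (112%:R * x ^+ 3 * y ^+ 3 - 20%:R * y ^+ 4
    + 81%:R * x ^+ 9 * y - 173%:R * x ^+ 6 * y ^+ 2)).
Proof.
transitivity (15%:R * ((70%:R * d (d (d (d x))) - 8%:R * d K) * x ^+ 3)
    - 84%:R * d ((20%:R * d (d (d x)) - K) * x ^+ 3)
    + 840%:R * d (d (d (d x) * x ^+ 3))
    - 140%:R * d (d (d (d x * x ^+ 3)))
    + 5%:R * d (d (d (d (x ^+ 4))))).
  by rewrite -h8 -h6 -h4 -h2 !dE !(DZ, DZM); ring.
by rewrite deriv_pow4_4 rankin_cohen4; ring.
Qed.

End CubicRing.

(** * Eisenstein series and differential equations *)

Definition eis2 : fps rat := 1 - 24%:R * sigma_series 1.
Definition eis4 : fps rat := 1 + 240%:R * sigma_series 3.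
Definition eis6 : fps rat := 1 - 504%:R * sigma_series 5.

Lemma fps_V_affine k f : fps_V (1 + k%:R * f) = 1 + k%:R * fps_V f.
Proof. by rewrite rmorphD rmorph1 rmorphM /= rmorph_nat. Qed.

Lemma fps_V_affineN k f : fps_V (1 - k%:R * f) = 1 - k%:R * fps_V f.
Proof. by rewrite rmorphB rmorph1 rmorphM /= rmorph_nat. Qed.

Definition fps_delta (f : fps rat) : fps rat := 12%:R * fps_D f.

Lemma fps_delta_is_additive : {morph fps_delta : f g / f - g}.
Proof. by move=> f g; rewrite /fps_delta raddfB mulrBr. Qed.
HB.instance Definition _ :=
  GRing.isZmodMorphism.Build (fps rat) (fps rat) fps_delta fps_delta_is_additive.

Lemma fps_deltaD f g : fps_delta (f + g) = fps_delta f + fps_delta g.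
Proof. exact: raddfD. Qed.

Lemma fps_deltaB f g : fps_delta (f - g) = fps_delta f - fps_delta g.
Proof. exact: raddfB. Qed.

Lemma fps_deltaM f g : fps_delta (f * g) = fps_delta f * g + f * fps_delta g.
Proof. by rewrite /fps_delta fps_DM; ring. Qed.

Lemma fps_deltaX f n : fps_delta (f ^+ n) = n%:R * (f ^+ n.-1 * fps_delta f).
Proof. by rewrite /fps_delta fps_DX; ring. Qed.

Lemma fps_deltaZ k f : fps_delta (k%:R * f) = k%:R * fps_delta f.
Proof. by rewrite fps_deltaM /fps_delta fps_Dn mulr0 mul0r add0r. Qed.

Lemma fps_deltaV f : fps_delta (fps_V f) = 3%:R * fps_V (fps_delta f).
Proof. by rewrite /fps_delta fps_DV rmorphM /= rmorph_nat; ring. Qed.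

Lemma fps_D_scale k f : fps_D (k%:R * f) = k%:R * fps_D f.
Proof. by rewrite fps_DM fps_Dn mul0r add0r. Qed.

Section CubicThetaFunctions.
Local Notation a := theta_a.
Local Notation b := theta_b.
Local Notation G := theta_c.
Local Notation H := theta_h.
Local Notation V := fps_V.
Local Notation D := fps_D.
Local Notation dlt := fps_delta.
Local Notation E2 := eis2.
Local Notation E4 := eis4.
Local Notation E6 := eis6.

(** With explicit cofactors, membership of z in the ideal of the vanishing x_i becomes a single
    identity for [ring]. *)
Lemma lincomb2 (z c1 x1 c2 x2 : fps rat) : x1 = 0 -> x2 = 0 ->
  z = c1 * x1 + c2 * x2 -> z = 0.
Proof. by move=> -> -> ->; rewrite !mulr0 !addr0. Qed.

Lemma lincomb3 (z c1 x1 c2 x2 c3 x3 : fps rat) : x1 = 0 -> x2 = 0 -> x3 = 0 ->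
  z = c1 * x1 + c2 * x2 + c3 * x3 -> z = 0.
Proof. by move=> -> -> -> ->; rewrite !mulr0 !addr0. Qed.

Lemma lincomb4 (z c1 x1 c2 x2 c3 x3 c4 x4 : fps rat) :
  x1 = 0 -> x2 = 0 -> x3 = 0 -> x4 = 0 ->
  z = c1 * x1 + c2 * x2 + c3 * x3 + c4 * x4 -> z = 0.
Proof. by move=> -> -> -> -> ->; rewrite !mulr0 !addr0. Qed.

Lemma eq_sub0 (x y : fps rat) : x = y -> x - y = 0.
Proof. by move=> ->; rewrite subrr. Qed.

Lemma sub0_eq (x y : fps rat) : x - y = 0 -> x = y.
Proof. by move/eqP; rewrite subr_eq0 => /eqP. Qed.

(** The moments [theta_ram] 2, 4, 6 are eliminated between the Taylor coefficients of b(z) and the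
    hexagonal averages. *)
Lemma theta_b_eqs :
  [/\ 8%:R * D b = b * (E2 - V E2),
      80%:R * D (D b) - 20%:R * (E2 - V E2) * D b + (E4 - V E4) * b = 0
    & 560%:R * D (D (D b)) + 14%:R * (H + 81%:R * V H)
      - 210%:R * (E2 - V E2) * D (D b) + 42%:R * (E4 - V E4) * D b
      - 3%:R * (E6 - V E6) * b = 0].
Proof.
have [m1 m3 m5] := theta_ram_moments; have [] := theta_ram_powers.
rewrite !theta_ram0 in m1 m3 m5; rewrite !fps_D_scale => /eq_sub0 p2 /eq_sub0 p4 /eq_sub0 p6.
rewrite /eis2 /eis4 /eis6 fps_V_affine !fps_V_affineN.
move: (V H) (D (D (D b))) (D (D b)) (D b) m1 m3 m5 p2 p4 p6 => vh b3 b2 b1.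
move: (V (sigma_series 1)) (V (sigma_series 3)) (V (sigma_series 5)) => v1 v3 v5.
move: (sigma_series 1) (sigma_series 3) (sigma_series 5) => s1 s3 s5.
move: (theta_ram 2) (theta_ram 4) (theta_ram 6) H b => t2 t4 t6 h b0 m1 m3 m5 p2 p4 p6.
split; first apply: sub0_eq.
- by apply: (lincomb2 (c1 := 6%:R) (c2 := - 2%:R) m1 p2); ring.
- apply: (lincomb3 (c1 := 60%:R) (c2 := - 20%:R) (c3 := - 120%:R * (s1 - v1)) m3 p4 p2).
  by ring.
- apply: (lincomb4 (c1 := 378%:R) (c2 := - 14%:R) (c3 := - 1260%:R * (s1 - v1))
    (c4 := - 2520%:R * (s3 - v3)) m5 p6 p4 p2).
  by ring.
Qed.

Lemma fps_V_comb k f : V (k%:R * V f - f) = k%:R * V (V f) - V f.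
Proof. by rewrite rmorphB rmorphM /= rmorph_nat. Qed.

Lemma theta_c_eqs :
  8%:R * D G = G * (9%:R * V (V E2) - V E2) /\
  560%:R * D (D (D G)) - 14%:R * (H + 27%:R * V H)
      - 210%:R * (9%:R * V (V E2) - V E2) * D (D G)
      + 42%:R * (81%:R * V (V E4) - V E4) * D G
      - 3%:R * (729%:R * V (V E6) - V E6) * G = 0.
Proof.
have [] := theta_cop_moments; have [] := theta_cop_powers.
rewrite !theta_cop0 !fps_V_comb (_ : 3 ^ 2 = 9)%N // (_ : 3 ^ 4 = 81)%N // (_ : 3 ^ 6 = 729)%N //.
rewrite !fps_D_scale => /eq_sub0 p2 /eq_sub0 p4 /eq_sub0 p6 /eq_sub0 m1 /eq_sub0 m3 /eq_sub0 m5.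
rewrite /eis2 /eis4 /eis6 !(fps_V_affine, fps_V_affineN).
move: (V H) (D (D (D G))) (D (D G)) (D G) m1 m3 m5 p2 p4 p6 => vh c3 c2 c1.
move: (V (V (sigma_series 1))) (V (V (sigma_series 3))) (V (V (sigma_series 5))) => w1 w3 w5.
move: (V (sigma_series 1)) (V (sigma_series 3)) (V (sigma_series 5)) => v1 v3 v5.
move: (theta_cop 2) (theta_cop 4) (theta_cop 6) H G => t2 t4 t6 h c0 m1 m3 m5 p2 p4 p6.
split; first apply: sub0_eq.
- by apply: (lincomb2 (c1 := 2%:R) (c2 := - 2%:R) m1 p2); ring.
pose f1 := 9%:R * w1 - v1; pose f3 := 81%:R * w3 - v3.
(* In 3 W5 + 20 W3 + 10 W1, 3 W3 + 6 W1 and 3 W1, these cofactors cancel W3 and W1 and leave 378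
   W5. *)
have := lincomb3 (c1 := 126%:R) (c2 := - 840%:R) (c3 := 1260%:R) m5 m3 m1 erefl => m.
apply: (lincomb4 (c1 := 1) (c2 := - 14%:R) (c3 := 420%:R - 1260%:R * f1)
  (c4 := - 840%:R - 2520%:R * f3) m p6 p4 p2).
by rewrite /f1 /f3; ring.
Qed.

Lemma theta_a0 : a 0%N = 1.
Proof.
rewrite /= (@fsum_seq _ [:: (0, 0)]) // ?big_seq1 ?mulr1 // => -[x y].
rewrite mulr1 pnatr_eq0 eqb0 negbK => /eqP q0.
have := qformE x y; rewrite q0 => /esym/qform_bound[/sqr_bound x0 /sqr_bound y0].
by rewrite inE; apply/eqP; congr (_, _); lia.
Qed.

(** Q(x, y) = (x - y)^2 + 3 x y is 1 modulo 3 wherever the weight does not vanish. *)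
Lemma theta_c_mod n : (n %% 3 != 1)%N -> G n = 0.
Proof.
move=> n1; apply: fsum_eq0 => -[x y] /=; have [eqn|_] := eqVneq; last by rewrite mul0r.
rewrite /cop3 (_ : (3 %| x - y)%Z) ?mul0r ?mulr0 //; have := qformE x y; rewrite eqn => eqQ.
apply: contraR n1 => xy3.
have eqQ' : n%:Z = (x - y) ^+ 2 + 3 * (x * y) by rewrite eqQ; ring.
have [k [e [ek ee]]] : exists k e, x - y = 3 * k + e /\ e ^+ 2 = 1.
  exists (((x - y) + 1) %/ 3)%Z, ((x - y) - 3 * (((x - y) + 1) %/ 3)%Z); split; first by ring.
  have [->|->] : (x - y) - 3 * (((x - y) + 1) %/ 3)%Z = 1 \/ (x - y) - 3 * (((x - y) + 1) %/ 3)%Z = -1 by lia.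
    by [].
  by [].
have : n%:Z = 3 * (3 * k ^+ 2 + 2 * k * e + x * y) + 1.
  rewrite eqQ' ek (_ : (3 * k + e) ^+ 2 = 9 * k ^+ 2 + 6 * (k * e) + e ^+ 2); last by ring.
  by rewrite ee; ring.
by move: (3 * k ^+ 2 + _) => z; lia.
Qed.

Lemma theta_c0 : G 0%N = 0. Proof. exact: theta_c_mod. Qed.

(** Six lattice vectors have norm 1, each of weight 1/2. *)
Lemma theta_c1 : G 1%N = 3.
Proof.
pose r : seq (int * int) := [:: (1, 0); (0, 1); (-1, 0); (0, -1); (1, -1); (-1, 1)].
rewrite /= (@fsum_seq _ r) //; first by rewrite !big_cons big_nil.
case=> x y; rewrite mulf_eq0 negb_or pnatr_eq0 eqb0 negbK => /andP[/eqP q1 _].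
have := qformE x y; rewrite q1 => /esym eq1; have [hx hy] := qform_bound eq1.
have x1 : `|x| <= 1 by nia.
have y1 : `|y| <= 1 by nia.
have [ex|[ex|ex]] : x = -1 \/ x = 0 \/ x = 1 by lia.
all: have [ey|[ey|ey]] : y = -1 \/ y = 0 \/ y = 1 by lia.
all: by move: eq1; rewrite ex ey.
Qed.

Lemma theta_b0 : b 0%N = 1.
Proof. by rewrite theta_bE fpsD fpsN fps_V0 theta_a0 theta_c0 subr0. Qed.

Definition fps_mod3 r (f : fps rat) := forall n, (n %% 3 != r)%N -> f n = 0.

Lemma fps_mod3M r s t f g : ((r + s) %% 3 = t)%N ->
  fps_mod3 r f -> fps_mod3 s g -> fps_mod3 t (f * g).
Proof.
move=> rst fr gs n nt; rewrite fpsM big1 // => -[i /= lei] _.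
have [ir|ir] := eqVneq (i %% 3)%N r; last by rewrite fr ?mul0r.
by rewrite gs ?mulr0 //; apply: contra nt => /eqP; lia.
Qed.

Lemma fpsM0 (f g : fps rat) : (f * g) 0%N = f 0%N * g 0%N.
Proof. by rewrite fpsM big_ord1. Qed.

Lemma fpsX0 (f : fps rat) n : (f ^+ n) 0%N = f 0%N ^+ n.
Proof. by elim: n => // n IH; rewrite !exprS fpsM0 IH. Qed.

Lemma eis2_0 : E2 0%N = 1.
Proof. by rewrite /eis2 fpsD fpsN fps_natM fps1 mulr0 subr0. Qed.

Lemma eis4_0 : E4 0%N = 1.
Proof. by rewrite /eis4 fpsD fps_natM fps1 mulr0 addr0. Qed.

Lemma eis6_0 : E6 0%N = 1.
Proof. by rewrite /eis6 fpsD fpsN fps_natM fps1 mulr0 subr0. Qed.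

(** This is c(q)^3: [G] is c(q^3), and its cube only has exponents divisible by 3, so keeping every
    third coefficient loses nothing. *)
Definition theta_c3 : fps rat := Fps (fun n => (G ^+ 3) (3 * n)%N).
Local Notation C := theta_c3.

Lemma theta_c3_V : V C = G ^+ 3.
Proof.
have G3 : fps_mod3 0 (G ^+ 3).
  apply: (fps_mod3M (r := 1) (s := 2)) => //; first exact: theta_c_mod.
  by apply: (fps_mod3M (r := 1) (s := 1)) => //; exact: theta_c_mod.
apply: fpsP => n; have [/dvdnP[k ->]|n3] := boolP (3 %| n)%N; first by rewrite mulnC fps_VE.
by rewrite fps_VN ?G3.
Qed.

Lemma theta_c3_0 : C 0%N = 0.
Proof. by rewrite -(fps_V0 C) theta_c3_V fpsX0 theta_c0 expr0n. Qed.

Lemma theta_c3_1 : C 1%N = 27.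
Proof.
rewrite -(fps_VE C) theta_c3_V; have := theta_c1; have := theta_c_mod (n := 2) isT.
move: theta_c0; move: G => g g0 g2 g1; rewrite exprS expr2 !(fpsM, big_ord_recl, big_ord0) /=.
by rewrite /bump /= g0 g1 g2; ring.
Qed.

Lemma D_b : 8%:R * D b = b * (E2 - V E2). Proof. by case: theta_b_eqs. Qed.
Lemma D_c : 8%:R * D G = G * (9%:R * V (V E2) - V E2). Proof. by case: theta_c_eqs. Qed.

Lemma D_Vb : 8%:R * D (V b) = 3%:R * (V b * (V E2 - V (V E2))).
Proof.
rewrite fps_DV mulrCA -(rmorph_nat V 8) -rmorphM /= D_b.
by rewrite rmorphM /= rmorphB.
Qed.

Lemma D_c3 : 8%:R * D C = C * (9%:R * V E2 - E2).
Proof.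
apply: fps_V_inj; apply: (@fps_natI 2).
rewrite !rmorphM /= theta_c3_V rmorphB rmorphM /= !rmorph_nat mulrCA -fps_DV theta_c3_V.
rewrite fps_DX; transitivity (3%:R * (G ^+ 2 * (8%:R * D G))); first by move: (D G) => x; ring.
by rewrite D_c; move: (V _) => x; ring.
Qed.

(* The cubic transformation [b(q^3)^3 / b(q) = c(q)^3 / (9 c(q^3))]: both sides
   have the same logarithmic derivative. *)
Lemma cubic_transformation : 9%:R * G * V b ^+ 3 = b * C.
Proof.
apply: (@fps_Dlog_uniq 8 1 _ _ (8%:R * V E2)) => //.
- by rewrite fps_natM fps_V0 eis2_0.
- have := theta_c3_1; have := theta_c3_0; have := theta_c1; have := theta_c0.
  have := theta_b0; have : (V b ^+ 3) 0%N = 1 by rewrite fpsX0 fps_V0 theta_b0.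
  set x := V b ^+ 3; move: x G b C => x y z w x0 z0 y0 y1 w0 w1.
  rewrite -mulrA fps_natM !(fpsM, big_ord_recl, big_ord0) /= /bump /= x0 z0 y0 y1 w0 w1.
  by ring.
- rewrite fps_DM fps_D_scale fps_DX.
  transitivity (9%:R * ((8%:R * D G) * V b ^+ 3 + G * (3%:R * V b ^+ 2 * (8%:R * D (V b))))).
    by move: (D G) (D (V b)) => x y; rewrite /=; ring.
  by rewrite D_c D_Vb; move: (V (V E2)) (V E2) (V b) => x y z; ring.
rewrite fps_DM; transitivity ((8%:R * D b) * C + b * (8%:R * D C)).
  by move: (D b) (D C) => x y; ring.
by rewrite D_b D_c3; move: (V E2) => x; ring.
Qed.

Lemma V_aE : a = V a + 2%:R * G. Proof. exact: theta_aE. Qed.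
Lemma V_bE : b = V a - G. Proof. exact: theta_bE. Qed.

(* With [A = a(q^3)], the defect [a^3 - b^3 - c^3] satisfies
   [b X = 9 c(q^3) X(q^3)], so its order [m] would satisfy [m = 3 m + 1]. *)
Lemma cubic_identity : a ^+ 3 = b ^+ 3 + C.
Proof.
apply: sub0_eq; apply: (@fps_V_eq0 b (9%:R * G)).
- by rewrite theta_b0.
- by rewrite fpsM0 theta_c0 mulr0 mul0r.
rewrite rmorphB rmorphD /= !rmorphXn /= theta_c3_V mulrBr mulrDr -cubic_transformation.
move: V_aE V_bE; move: (V a) (V b) G => x y z -> ->.
by ring.
Qed.

Lemma Vb_cube : V b ^+ 3 = V a ^+ 3 - G ^+ 3.
Proof.
have := congr1 V cubic_identity; rewrite rmorphD /= !rmorphXn /= theta_c3_V => ->.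
by rewrite addrK.
Qed.

(** Let A = a(q^3). Its derivative is computed twice, from A = b + c(q^3) and from A^3 = b(q^3)^3 +
    c(q^3)^3. With Y = 3 E2(q^3) - E2 the comparison gives a^2 Y(q^3) = A^2 Y: the quotient Y / a^2
    is invariant under q -> q^3, hence equal to its constant term 2. *)
Lemma eis2_V : 3%:R * V E2 = E2 + 2%:R * a ^+ 2.
Proof.
pose Y := 3%:R * V E2 - E2.
have VY : V Y = 3%:R * V (V E2) - V E2 by rewrite rmorphB rmorphM /= rmorph_nat.
have key : b * (a ^+ 2 * V Y) = b * (V a ^+ 2 * Y).
  apply: (@fps_natI 2).
  have e1 : 8%:R * (V a ^+ 2 * D (V a)) = 3%:R * (V b ^+ 3 * (V E2 - V (V E2)))
      + G ^+ 3 * (9%:R * V (V E2) - V E2).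
    apply: (@fps_natI 2).
    have := congr1 (fun f => 8%:R * D f) Vb_cube; rewrite raddfB /= !fps_DX /= => /eqP.
    rewrite mulrBr eq_sym subr_eq => /eqP e.
    transitivity (8%:R * (3%:R * (V a ^+ 2 * D (V a)))); first by move: (D _) => z; ring.
    rewrite e; transitivity (3%:R * (V b ^+ 2 * (8%:R * D (V b))) + 3%:R * (G ^+ 2 * (8%:R * D G))).
      by move: (D _) (D _) => z w; ring.
    by rewrite D_Vb D_c; move: (V (V E2)) (V E2) (V b) => z w y; ring.
  have e2 : 8%:R * D (V a) = b * (E2 - V E2) + G * (9%:R * V (V E2) - V E2).
    by rewrite -D_b -D_c -mulrDr -raddfD /= V_bE subrK.
  have : V a ^+ 2 * (8%:R * D (V a)) = 3%:R * (V b ^+ 3 * (V E2 - V (V E2)))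
      + G ^+ 3 * (9%:R * V (V E2) - V E2) by rewrite -e1; move: (D _) => z; ring.
  rewrite e2 Vb_cube VY /Y => /eq_sub0.
  move: V_aE V_bE; move: (V a) (V (V E2)) (V E2) E2 G => x w v u z -> -> e.
  apply: sub0_eq; apply: (lincomb2 (c1 := 3%:R) (c2 := 0) e erefl).
  by ring.
apply/eqP; rewrite addrC -subr_eq; apply/eqP; rewrite -/Y; apply: sub0_eq.
have b0 : b 0%N != 0 by rewrite theta_b0.
have {}key := fps_mulI b0 key.
apply: (@fps_V_eq0 (V a ^+ 2) (a ^+ 2)).
- by rewrite fpsX0 fps_V0 theta_a0 expr1n.
- rewrite fpsM0 fpsD fpsN fps_natM !fpsX0 theta_a0 /Y fpsD fpsN fps_natM fps_V0 eis2_0.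
  by ring.
have -> : V (Y - 2%:R * a ^+ 2) = V Y - 2%:R * V a ^+ 2.
  by rewrite raddfB /= rmorphM /= rmorph_nat rmorphXn.
rewrite mulrBr -key.
by move: (V Y) (V a) => z x; ring.
Qed.

Lemma delta_b : dlt b = b * (E2 - a ^+ 2).
Proof.
apply: (@fps_natI 1); rewrite /fps_delta.
transitivity (3%:R * (8%:R * D b)); first by move: (D b) => x; ring.
rewrite D_b; transitivity (b * (3%:R * E2 - 3%:R * V E2)); first by move: (V E2) => x; ring.
by rewrite eis2_V; ring.
Qed.

Lemma delta_c3 : dlt C = 3%:R * (C * (E2 + 3%:R * a ^+ 2)).
Proof.
apply: (@fps_natI 1); rewrite /fps_delta.
transitivity (3%:R * (8%:R * D C)); first by move: (D C) => x; ring.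
rewrite D_c3; transitivity (C * (9%:R * (3%:R * V E2) - 3%:R * E2)).
  by move: (V E2) => x; ring.
by rewrite eis2_V; ring.
Qed.

Lemma c3E : C = a ^+ 3 - b ^+ 3.
Proof. by rewrite cubic_identity; move: C => x; ring. Qed.

Lemma delta_a : dlt a = a * E2 + 3%:R * a ^+ 3 - 4%:R * b ^+ 3.
Proof.
have a20 : (a ^+ 2) 0%N != 0 by rewrite fpsX0 theta_a0.
apply: (fps_mulI a20); apply: (@fps_natI 2).
have := congr1 dlt cubic_identity; rewrite raddfD /= !fps_deltaX /= delta_b delta_c3 c3E.
by move=> ->; ring.
Qed.

Definition eis4_poly (x y : fps rat) := 9%:R * x ^+ 4 - 8%:R * (x * y ^+ 3).

Lemma eis4_poly_0 : eis4_poly a b 0%N = 1.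
Proof.
by rewrite /eis4_poly fpsD fpsN !fps_natM fpsM0 !fpsX0 theta_a0 theta_b0; ring.
Qed.

Lemma eis4_poly_V : V (eis4_poly a b) = 9%:R * V a ^+ 4 - 8%:R * (V a * (V a ^+ 3 - G ^+ 3)).
Proof.
rewrite -Vb_cube /eis4_poly raddfB /= [V (9%:R * _)]rmorphM [V (8%:R * _)]rmorphM /=.
by rewrite [V (a * _)]rmorphM /= !rmorphXn /= !rmorph_nat.
Qed.

(** Ramanujan's equation, once [eis4_poly a b] is known to be E4. Applying delta to [eis2_V] shows
    that the defect f satisfies f = 9 f(q^3), and f has no constant term. *)
Lemma delta_E2 : dlt E2 = E2 ^+ 2 - eis4_poly a b.
Proof.
apply: sub0_eq; set f := _ - _; pose U := E2 ^+ 2 - dlt E2.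
have fE : f = eis4_poly a b - U by rewrite /f /U; ring.
apply: (@fps_V_eq0 1 9%:R); rewrite ?fps1 //.
  have U0 : U 0%N = 1.
    by rewrite /U /fps_delta fpsD fpsN fpsX0 eis2_0 fps_natM fps_DE mul0r mulr0 subr0 expr1n.
  have -> : f 0%N = 0 by rewrite fE fpsD fpsN U0 eis4_poly_0 subrr.
  by rewrite mulr0.
have : 3%:R * dlt (V E2) = dlt E2 + 2%:R * dlt (a ^+ 2).
  by rewrite -fps_deltaZ eis2_V raddfD /= fps_deltaZ.
rewrite fps_deltaX fps_deltaV delta_a -[2.-1]/1%N expr1.
have VU : V U = V E2 ^+ 2 - V (dlt E2) by rewrite /U rmorphB /= rmorphXn.
have {VU} -> : V (dlt E2) = V E2 ^+ 2 - V U by rewrite VU; ring.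
have -> : dlt E2 = E2 ^+ 2 - U by rewrite /U; ring.
rewrite fE [V (eis4_poly a b - U)]raddfB /= eis4_poly_V /eis4_poly => /eq_sub0.
clear fE f; have := eis2_V; move: V_aE V_bE.
move: U E2 G (V U) (V a) (V E2) => u e z vu x v -> -> ev eq.
apply: sub0_eq.
apply: (lincomb2 (c1 := - 1) (c2 := 3%:R * v + e + 2%:R * (x + 2%:R * z) ^+ 2) eq (eq_sub0 ev)).
by ring.
Qed.

Lemma delta2E f : dlt (dlt f) = 144%:R * D (D f).
Proof. by rewrite /fps_delta fps_D_scale; ring. Qed.

Lemma delta3E f : dlt (dlt (dlt f)) = 1728%:R * D (D (D f)).
Proof. by rewrite delta2E /fps_delta !fps_D_scale; ring. Qed.

Lemma eis2_subV : 3%:R * (E2 - V E2) = 2%:R * (E2 - a ^+ 2).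
Proof. by rewrite mulrBr eis2_V; ring. Qed.

Local Notation w := (E2 - a ^+ 2).
Local Notation w1 := (E2 ^+ 2 - 2%:R * a ^+ 2 * E2 - 15%:R * a ^+ 4 + 16%:R * a * b ^+ 3).

Lemma delta_w : dlt w = w1.
Proof. by rewrite raddfB /= fps_deltaX /= delta_E2 delta_a /eis4_poly; ring. Qed.

Lemma delta2_b : dlt (dlt b) = b * (w ^+ 2 + w1).
Proof. by rewrite {1}delta_b fps_deltaM delta_w delta_b; ring. Qed.

(** The second-order equation of b, solved for E4 - E4(q^3); E2 cancels when the derivatives of b
    are written in a, b and E2. *)
Lemma eis4_subV : 9%:R * (E4 - V E4) = 80%:R * (a * (a ^+ 3 - b ^+ 3)).
Proof.
have b0 : b 0%N != 0 by rewrite theta_b0.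
apply: (fps_mulI b0); have [_ + _] := theta_b_eqs.
move=> /(congr1 ( *%R 9%:R)); rewrite mulr0 => e; apply: sub0_eq; rewrite -e.
transitivity (b * (9%:R * (E4 - V E4)) + 5%:R * dlt (dlt b)
  - 5%:R * (3%:R * (E2 - V E2)) * dlt b).
  by rewrite eis2_subV delta2_b delta_b; move: (V E4) => v; ring.
by rewrite delta2E /fps_delta; move: (D (D b)) (D b) (V E2) (V E4) => x y u v; ring.
Qed.

(** By [eis4_subV] the difference of the two sides is invariant under q -> q^3, so it is constant,
    and its constant term is 0. *)
Lemma eis4E : E4 = eis4_poly a b.
Proof.
apply: sub0_eq; apply: (@fps_V_eq0 1 1).
- by rewrite fps1.
- by rewrite fps1 mul1r fpsD fpsN eis4_0 eis4_poly_0 subrr.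
rewrite !mul1r (_ : V (E4 - eis4_poly a b) = V E4 - V (eis4_poly a b)); last exact: raddfB.
rewrite eis4_poly_V; apply: (@fps_natI 8).
have := eis4_subV; rewrite /eis4_poly; move: V_aE V_bE.
move: E4 G (V a) (V E4) => x z y v -> -> /eq_sub0 e.
apply: sub0_eq; apply: (lincomb2 (c1 := 1) (c2 := 0) e erefl).
by ring.
Qed.

Local Notation a' := (a * E2 + 3%:R * a ^+ 3 - 4%:R * b ^+ 3).
Local Notation e' := (E2 ^+ 2 - 9%:R * a ^+ 4 + 8%:R * a * b ^+ 3).
Local Notation w2 := (2%:R * E2 * e' - 4%:R * a * a' * E2 - 2%:R * a ^+ 2 * e'
  - 60%:R * a ^+ 3 * a' + 16%:R * a' * b ^+ 3 + 48%:R * a * b ^+ 3 * w).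

Lemma delta_w1 : dlt w1 = w2.
Proof.
have -> : w1 = E2 * E2 - 2%:R * (a * a * E2) - 15%:R * (a ^+ 4) + 16%:R * (a * b ^+ 3) by ring.
rewrite fps_deltaD !fps_deltaB.
rewrite (fps_deltaZ 2) (fps_deltaZ 15) (fps_deltaZ 16) !fps_deltaX.
rewrite (fps_deltaM E2) (fps_deltaM (a * a)) (fps_deltaM a a) (fps_deltaM a (b ^+ 3)) fps_deltaX.
by rewrite delta_a delta_b delta_E2 /eis4_poly; ring.
Qed.

Lemma delta3_b : dlt (dlt (dlt b)) = b * (w ^+ 3 + 3%:R * w * w1 + w2).
Proof.
rewrite delta2_b fps_deltaM (fps_deltaD (w ^+ 2)) delta_w1 fps_deltaX delta_w delta_b.
by ring.
Qed.

Local Notation A := (V a).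
Local Notation e := (V E2).

Lemma eis2_VV : 3%:R * V e = e + 2%:R * A ^+ 2.
Proof.
have := congr1 V eis2_V.
by rewrite fps_VZ fps_VD fps_VZ fps_VX.
Qed.

Lemma delta_c : dlt G = 3%:R * (G * (e + 3%:R * A ^+ 2)).
Proof.
apply: (@fps_natI 1); rewrite /fps_delta.
transitivity (3%:R * (8%:R * D G)); first by move: (D G) => x; ring.
rewrite D_c; transitivity (G * (9%:R * (3%:R * V e) - 3%:R * e)).
  by move: (V e) e => x y; ring.
by rewrite eis2_VV; ring.
Qed.

Lemma delta_Va : dlt A = 3%:R * (A * e - A ^+ 3 + 4%:R * G ^+ 3).
Proof.
rewrite fps_deltaV delta_a; congr (_ * _).
have -> : V (a * E2 + 3%:R * a ^+ 3 - 4%:R * b ^+ 3) = A * e + 3%:R * A ^+ 3 - 4%:R * V b ^+ 3.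
  by rewrite fps_VB fps_VD !fps_VZ (fps_VM a) !fps_VX.
by rewrite Vb_cube; ring.
Qed.

Lemma eis4_V : V E4 = A ^+ 4 + 8%:R * (A * G ^+ 3).
Proof. by rewrite eis4E eis4_poly_V; ring. Qed.

Lemma delta_Ve : dlt e = 3%:R * (e ^+ 2 - A ^+ 4 - 8%:R * (A * G ^+ 3)).
Proof.
rewrite fps_deltaV delta_E2 -eis4E; congr (_ * _).
by rewrite fps_VB fps_VX eis4_V; ring.
Qed.

Local Notation o := (3%:R * (e + 3%:R * A ^+ 2)).
Local Notation o1 := (9%:R * e ^+ 2 + 54%:R * (A ^+ 2 * e) - 63%:R * A ^+ 4
  + 144%:R * (A * G ^+ 3)).

Lemma delta_o : dlt o = o1.
Proof.
rewrite fps_deltaZ fps_deltaD fps_deltaZ fps_deltaX delta_Va delta_Ve -[2.-1]/1%N expr1.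
by move: A e => x y; ring.
Qed.

Lemma delta_c_o : dlt G = G * o. Proof. by rewrite delta_c; ring. Qed.

Lemma delta2_c : dlt (dlt G) = G * (o ^+ 2 + o1).
Proof. by rewrite {1}delta_c_o fps_deltaM delta_o delta_c_o; ring. Qed.

Local Notation A' := (3%:R * (A * e - A ^+ 3 + 4%:R * G ^+ 3)).
Local Notation e'' := (3%:R * (e ^+ 2 - A ^+ 4 - 8%:R * (A * G ^+ 3))).
Local Notation o2 := (18%:R * e * e'' + 108%:R * A * A' * e + 54%:R * A ^+ 2 * e''
  - 252%:R * A ^+ 3 * A' + 144%:R * A' * G ^+ 3 + 432%:R * A * G ^+ 3 * o).

Lemma delta_o1 : dlt o1 = o2.
Proof.
rewrite fps_deltaD fps_deltaB fps_deltaD.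
rewrite (fps_deltaZ 9) (fps_deltaZ 54) (fps_deltaZ 63) (fps_deltaZ 144).
rewrite (fps_deltaM (A ^+ 2)) (fps_deltaM A) !fps_deltaX delta_Va delta_Ve delta_c.
by rewrite -[2.-1]/1%N -[4.-1]/3%N -[3.-1]/2%N; move: A e G => x y z; ring.
Qed.

Lemma delta3_c : dlt (dlt (dlt G)) = G * (o ^+ 3 + 3%:R * o * o1 + o2).
Proof.
rewrite delta2_c fps_deltaM (fps_deltaD (o ^+ 2)) delta_o1 fps_deltaX delta_o delta_c_o.
by rewrite -[2.-1]/1%N; move: A e G => x y z; ring.
Qed.

Definition eis6_poly (x y : fps rat) := - 27%:R * x ^+ 6 + 36%:R * x ^+ 3 * y ^+ 3 - 8%:R * y ^+ 6.

Lemma eis6_poly_V : V (eis6_poly a b) = A ^+ 6 - 20%:R * A ^+ 3 * G ^+ 3 - 8%:R * G ^+ 6.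
Proof.
have -> : eis6_poly a b = 36%:R * (a ^+ 3 * b ^+ 3) - 27%:R * a ^+ 6 - 8%:R * (b ^+ 3) ^+ 2.
  by rewrite /eis6_poly; ring.
rewrite !fps_VB !fps_VZ (fps_VM (a ^+ 3)) !fps_VX Vb_cube.
by move: A => x; ring.
Qed.

Lemma eis6_poly_V27 : 27%:R * V (eis6_poly a b) =
  - a ^+ 6 + 20%:R * (a ^+ 3 * b ^+ 3) + 8%:R * (b ^+ 3) ^+ 2.
Proof. by rewrite eis6_poly_V; move: V_aE V_bE; move: A G => x z -> ->; ring. Qed.

Lemma eis6_poly_VV : 27%:R * V (V (eis6_poly a b)) =
  - A ^+ 6 + 20%:R * (A ^+ 3 * (A ^+ 3 - G ^+ 3)) + 8%:R * (A ^+ 3 - G ^+ 3) ^+ 2.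
Proof.
have := eis6_poly_V27; move: (V (eis6_poly a b)) => p /(congr1 V).
by rewrite !fps_VD fps_Vopp !fps_VZ (fps_VM (a ^+ 3)) !fps_VX Vb_cube.
Qed.

Lemma theta_h_V : V (a * b ^+ 3 * C) = A * (A ^+ 3 - G ^+ 3) * G ^+ 3.
Proof. by rewrite fps_VM theta_c3_V (fps_VM a) fps_VX Vb_cube. Qed.

Lemma theta_h0 : H 0%N = 0.
Proof.
apply: fsum_eq0 => -[x y]; have [q0|_] := eqVneq (qform (x, y)) 0%N; last by rewrite mul0r.
have := qformE x y; rewrite q0 => /esym/qform_bound[/sqr_bound x0 /sqr_bound y0].
have [-> ->] : x = 0 /\ y = 0 by split; lia.
by rewrite mulr0.
Qed.

(** The third-order equation of b holds exactly for the expected values of h and E6, so by linearity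
    their defects satisfy its homogeneous form; [eis6_h_c] does the same for c. *)
Lemma eis6_h_b :
  14%:R * ((9%:R * H - 4%:R * (a * b ^+ 3 * C)) + 81%:R * V (9%:R * H - 4%:R * (a * b ^+ 3 * C)))
  = 27%:R * (b * ((E6 - eis6_poly a b) - V (E6 - eis6_poly a b))).
Proof.
have [_ _ key] := theta_b_eqs.
have {key} : 70%:R * dlt (dlt (dlt b)) + 3024%:R * (H + 81%:R * V H)
    - 105%:R * (3%:R * (E2 - V E2)) * dlt (dlt b) + 84%:R * (9%:R * (E4 - V E4)) * dlt b
    - 648%:R * (E6 - V E6) * b = 0.
  rewrite -[RHS](mulr0 216%:R) -key delta3E delta2E /fps_delta.
  move: (D (D (D b))) (D (D b)) (D b) (V H) (V E2) (V E4) (V E6) => x y z h u v t.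
  by move: H E2 E4 E6 b => *; ring.
rewrite delta3_b delta2_b delta_b eis2_subV eis4_subV => key.
rewrite (fps_VB E6) (fps_VB (9%:R * H)) !fps_VZ theta_h_V c3E.
apply: (@fps_natI 23); apply: sub0_eq; have := eis6_poly_V27.
move: (V (eis6_poly a b)) => vp /eq_sub0 vp27; rewrite /eis6_poly; move: key vp27.
move: V_aE V_bE; move: (V H) (V E6) A => vh v6 x -> ->.
move: H E6 E2 G => h e6 e2 z key vp27.
apply: (lincomb2 (c1 := 1) (c2 := - 24%:R * (x - z)) key vp27).
by ring.
Qed.

Lemma eis2_VV9 : 9%:R * V (V E2) - V E2 = 2%:R * (V E2 + 3%:R * A ^+ 2).
Proof.
rewrite (_ : 9%:R * V (V E2) = 3%:R * (3%:R * V (V E2))); last by move: (V (V E2)) => x; ring.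
by rewrite eis2_VV; ring.
Qed.

Lemma eis4_VV81 : 81%:R * V (V E4) - V E4 = 80%:R * (A ^+ 4 - A * G ^+ 3).
Proof.
have := congr1 V eis4_subV; rewrite !fps_VZ fps_VB (fps_VM a) fps_VB !fps_VX Vb_cube.
rewrite eis4_V => /eq_sub0 e; apply: sub0_eq.
apply: (lincomb2 (c1 := - 9%:R) (c2 := 0) e erefl).
by move: A (V (V E4)) => x y; ring.
Qed.

Lemma eis6_h_c :
  14%:R * ((9%:R * H - 4%:R * (a * b ^+ 3 * C)) + 27%:R * V (9%:R * H - 4%:R * (a * b ^+ 3 * C)))
  = 27%:R * (G * (V (E6 - eis6_poly a b) - 729%:R * V (V (E6 - eis6_poly a b)))).
Proof.
have [_ key] := theta_c_eqs.
have {key} : 70%:R * dlt (dlt (dlt G)) - 3024%:R * (H + 27%:R * V H)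
    - 315%:R * (9%:R * V (V E2) - V E2) * dlt (dlt G)
    + 756%:R * (81%:R * V (V E4) - V E4) * dlt G
    - 648%:R * (729%:R * V (V E6) - V E6) * G = 0.
  rewrite -[RHS](mulr0 216%:R) -key delta3E delta2E /fps_delta.
  move: (D (D (D G))) (D (D G)) (D G) (V H) (V (V E2)) (V (V E4)) (V (V E6)) => x y z h uu vv tt.
  by move: (V E2) (V E4) (V E6) H G => *; ring.
rewrite delta3_c delta2_c delta_c eis2_VV9 eis4_VV81 => key.
rewrite (fps_VB E6) (fps_VB (V E6)) (fps_VB (9%:R * H)) !fps_VZ theta_h_V c3E.
apply: (@fps_natI 23); apply: sub0_eq; have := eis6_poly_VV; rewrite eis6_poly_V.
move: (V (V (eis6_poly a b))) => vvp /eq_sub0 vvp27; move: key vvp27.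
move: V_aE V_bE; move: (V H) (V (V E6)) (V E6) (V E2) A => vh vv6 v6 e x -> ->.
move: H G => h z key vvp27.
apply: (lincomb2 (c1 := - 1) (c2 := - 24%:R * 729%:R * z) key vvp27).
by ring.
Qed.

(** Let f and d be the defects of E6 and h. As [G] has no constant term, coefficient n of the
    equation from c involves f only below n and gives d n = 0; the equation from b then gives f n =
    0. *)
Lemma eis6_h : E6 = eis6_poly a b /\ 9%:R * H = 4%:R * (a * b ^+ 3 * C).
Proof.
have := eis6_h_c; have := eis6_h_b.
have d0 : (9%:R * H - 4%:R * (a * b ^+ 3 * C)) 0%N = 0.
  by rewrite fpsD fpsN !fps_natM fpsM0 theta_h0 theta_c3_0 !mulr0 subr0.
have p0 : eis6_poly a b 0%N = 1.
  have -> : eis6_poly a b = 36%:R * (a ^+ 3 * b ^+ 3) - 27%:R * a ^+ 6 - 8%:R * b ^+ 6.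
    by rewrite /eis6_poly; ring.
  have subE (f g h : fps rat) : (f - g - h) 0%N = f 0%N - g 0%N - h 0%N by [].
  rewrite subE !fps_natM fpsM0 !fpsX0 theta_a0 theta_b0.
  by rewrite !expr1n mulr1; ring.
have e0 : (E6 - eis6_poly a b) 0%N = 0 by rewrite fpsD fpsN eis6_0 p0 subrr.
suff main (d f : fps rat) : d 0%N = 0 -> f 0%N = 0 ->
    14%:R * (d + 81%:R * V d) = 27%:R * (b * (f - V f)) ->
    14%:R * (d + 27%:R * V d) = 27%:R * (G * (V f - 729%:R * V (V f))) ->
    f = 0 /\ d = 0.
  by move=> eqb eqc; have [fe de] := main _ _ d0 e0 eqb eqc; split; apply: sub0_eq.
move=> {d0 p0 e0} d0 f0 eqb eqc.
have subE (g h : fps rat) n : (g - h) n = g n - h n by [].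
have low (g : fps rat) n : (forall m, (m < n)%N -> g m = 0) ->
    forall m, (m < n)%N -> V g m = 0.
  move=> g0 m mn; have [/dvdnP[k ek]|m3] := boolP (3 %| m)%N; last by rewrite fps_VN.
  by rewrite ek mulnC fps_VE g0 //; lia.
have lowS (g : fps rat) n : (0 < n)%N -> (forall m, (m < n)%N -> g m = 0) -> V g n = 0.
  move=> n0 g0; have [/dvdnP[k ek]|m3] := boolP (3 %| n)%N; last by rewrite fps_VN.
  by rewrite ek mulnC fps_VE g0 //; lia.
suff fd n : forall m, (m < n)%N -> f m = 0 /\ d m = 0.
  by split; apply: fpsP => n; have [] := fd n.+1 n (ltnSn n).
elim: n => [//|n IH] m; rewrite ltnS leq_eqVlt => /orP[/eqP ->|/IH //] {m}.
have [->//|n0] := posnP n.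
have fn m : (m < n)%N -> f m = 0 by case/IH.
have dn m : (m < n)%N -> d m = 0 by case/IH.
have d_n : d n = 0.
  have := congr1 (fun h : fps rat => h n) eqc.
  rewrite !fps_natM fpsD fps_natM (lowS d) // mulr0 addr0.
  rewrite fpsM big_ord_recl theta_c0 mul0r add0r big1 => [|i _].
    by move/eqP; rewrite mulr0 mulf_eq0 => /orP[//|/eqP].
  have lti : (n - lift ord0 i < n)%N by rewrite lift0; lia.
  have v1 := low f n fn _ lti; have v2 := low (V f) n (low f n fn) _ lti.
  by rewrite subE fps_natM v1 v2 [729%:R * 0]mulr0 subr0 mulr0.
have f_n : f n = 0; last by [].
have := congr1 (fun h : fps rat => h n) eqb.
have dd : (d + 81%:R * V d) n = 0.
  by rewrite fpsD fps_natM d_n (lowS d) // [81%:R * 0]mulr0 addr0.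
rewrite !fps_natM dd mulr0 fpsM_low => [|m mn].
  rewrite subE (lowS f) // subr0 theta_b0 mul1r => /esym/eqP.
  by rewrite mulf_eq0 => /orP[//|/eqP].
by rewrite subE fn // (low f n) // subr0.
Qed.

(** * The discriminant *)

Definition fps_of_poly (p : {poly int}) : fps rat := Fps (fun n => (p`_n)%:~R).

Lemma fps_of_polyB p q : fps_of_poly (p - q) = fps_of_poly p - fps_of_poly q.
Proof. by apply: fpsP => n; rewrite fpsD fpsN /= coefB rmorphB. Qed.

Lemma fps_of_polyM p q : fps_of_poly (p * q) = fps_of_poly p * fps_of_poly q.
Proof.
apply: fpsP => n; rewrite fpsM /= coefM rmorph_sum.
by apply: eq_bigr => i _; rewrite rmorphM.
Qed.

Lemma fps_of_poly1 : fps_of_poly 1 = 1.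
Proof. by apply: fpsP => n; rewrite fps1 /= coef1; case: eqP. Qed.

Lemma fps_of_polyX p n : fps_of_poly (p ^+ n) = fps_of_poly p ^+ n.
Proof. by elim: n => [|n IH]; rewrite ?fps_of_poly1 // !exprS fps_of_polyM IH. Qed.

(** The Lambert term m q^m / (1 - q^m). *)
Definition geom_series (m : nat) : fps rat :=
  Fps (fun n => ((0 < n)%N && (m %| n)%N)%:R * m%:R).

Lemma fps_XnM m f n : (fps_of_poly 'X^m * f) n = if (n < m)%N then 0 else f (n - m)%N.
Proof.
have -> : (fps_of_poly 'X^m * f) n = \sum_(i < n.+1) (i == m :> nat)%:R * f (n - i)%N.
  by rewrite fpsM; apply: eq_bigr => i _; rewrite /= coefXn; case: eqP.
case: ltnP => mn.
  by rewrite big1 // => i _; rewrite ltn_eqF ?mul0r // (leq_trans _ mn).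
rewrite (bigD1 (Ordinal (mn : m < n.+1)%N)) //= eqxx mul1r big1 ?addr0 // => i ne.
rewrite (_ : (i == m :> nat) = false) ?mul0r //.
by apply: contraNF ne => /eqP im; apply/eqP/val_inj.
Qed.

Lemma geom_seriesE m : (0 < m)%N ->
  (1 - fps_of_poly 'X^m) * geom_series m = m%:R * fps_of_poly 'X^m.
Proof.
move=> m0; apply: fpsP => n; rewrite mulrBl mul1r fpsD fpsN fps_XnM fps_natM /= coefXn.
have [nm|mn] := ltnP n m.
  rewrite subr0 (ltn_eqF nm) mulr0; case: (posnP n) => [->|n0]; first by rewrite mul0r.
  by rewrite gtnNdvd // mul0r.
have [->|nm] := eqVneq n m; first by rewrite subnn m0 dvdnn /=; ring.
have -> : (m %| n - m)%N = (m %| n)%N by rewrite dvdn_subl // dvdnn.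
have -> : (0 < n - m)%N by rewrite subn_gt0 ltn_neqAle eq_sym nm.
by rewrite (leq_trans m0 mn) /= mulr0 subrr.
Qed.

Definition delta_trunc N : {poly int} := 'X * \prod_(1 <= m < N.+1) (1 - 'X^m) ^+ 24.

Lemma D_delta_trunc N : D (fps_of_poly (delta_trunc N)) =
  fps_of_poly (delta_trunc N) * (1 - 24%:R * \sum_(1 <= m < N.+1) geom_series m).
Proof.
have D_Xn m : D (fps_of_poly 'X^m) = m%:R * fps_of_poly 'X^m.
  apply: fpsP => n; rewrite fps_DE fps_natM /= coefXn.
  by have [->//|_] := eqVneq n m; rewrite !mulr0.
elim: N => [|N IH].
  rewrite /delta_trunc !big_nil !mulr1 mulr0 subr0 mulr1.
  by have := D_Xn 1%N; rewrite expr1 mul1r.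
have -> : delta_trunc N.+1 = delta_trunc N * (1 - 'X^(N.+1)) ^+ 24.
  by rewrite /delta_trunc big_nat_recr //= mulrA.
rewrite fps_of_polyM fps_of_polyX fps_of_polyB fps_of_poly1 fps_DM IH fps_DX.
have D1 : D 1 = 0 := fps_Dn 1.
rewrite raddfB /= D_Xn D1 sub0r -geom_seriesE //.
rewrite [in RHS]big_nat_recr //=.
move: (fps_of_poly _) (fps_of_poly _) (\sum_(_ <= _ < _) _) (geom_series _) => p x s g.
by ring.
Qed.

Definition tau_series : fps rat := Fps (fun n => (tau n)%:~R).

Lemma eis2_trunc n k : (k <= n)%N ->
  (1 - 24%:R * \sum_(1 <= m < n.+1) geom_series m) k = E2 k.
Proof.
move=> len; rewrite /eis2 !fpsD !fpsN !fps_natM fps_sum; congr (_ - _ * _).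
have [->|k0] := posnP k; first by rewrite big1 // => m _; rewrite /= mul0r.
rewrite sigma_seriesE // /sigma natr_sum /=.
rewrite (eq_bigr (fun m => if (m %| k)%N then m%:R else 0)); last first.
  by move=> m _; rewrite k0 /=; case: ifP; rewrite ?mul1r ?mul0r.
rewrite -big_mkcond -big_filter (perm_big (divisors k)) //; apply: uniq_perm.
- by rewrite filter_uniq // iota_uniq.
- exact: divisors_uniq.
move=> d; rewrite mem_filter -dvdn_divisors // mem_index_iota.
by case: (boolP (d %| k)%N) => //= dk; rewrite ltnS (dvdn_gt0 k0 dk) (leq_trans (dvdn_leq k0 dk)).
Qed.

(** Coefficient n only involves indices up to n, where the product truncated at n agrees with [tau]
    and the truncated Lambert sum with E2. *)
Lemma D_tau_series : D tau_series = E2 * tau_series.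
Proof.
apply: fpsP => n.
have -> : D tau_series n = D (fps_of_poly (delta_trunc n)) n by [].
rewrite D_delta_trunc [RHS](congr1 (fun f : fps rat => f n) (mulrC _ _)) !fpsM.
apply: eq_bigr => i _; rewrite eis2_trunc ?leq_subr //; congr (_ * _).
by congr (_%:~R); apply: tau_coef; rewrite -ltnS.
Qed.

Lemma tau1 : tau 1 = 1.
Proof.
by rewrite /tau big_nat1 expr1 coefXM /= -horner_coef0 !hornerE ?subr0 expr1n.
Qed.

(** Both sides have logarithmic derivative E2, because 9 (E2 - a^2) + 3 (E2 + 3 a^2) = 12 E2, and
    coefficient 27 at q. *)
Lemma tau_seriesE : 27%:R * tau_series = b ^+ 9 * C.
Proof.
have D_tau := D_tau_series; apply: (@fps_Dlog_uniq 12 1 _ _ (12%:R * E2)) => //.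
- by rewrite fps_natM eis2_0.
- rewrite fps_natM (_ : tau_series 1%N = 1); last by rewrite /= tau1.
  have : (b ^+ 9) 0%N = 1 by rewrite fpsX0 theta_b0 expr1n.
  have := theta_c3_1; have := theta_c3_0; set x := b ^+ 9; move: x C => x y y0 y1 x0.
  by rewrite !(fpsM, big_ord_recl, big_ord0) /= /bump /= x0 y0 y1; ring.
- by rewrite fps_D_scale D_tau; ring.
rewrite -[LHS]/(dlt (b ^+ 9 * C)) fps_deltaM fps_deltaX delta_b delta_c3 -[9.-1]/8%N.
by ring.
Qed.

(** * The formula *)

Local Notation K := (1728%:R * H).

Lemma theta_hE : K = 768%:R * (a * b ^+ 3 * (a ^+ 3 - b ^+ 3)).
Proof.
transitivity (192%:R * (9%:R * H)); first by move: H => h; ring.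
by have [_ ->] := eis6_h; rewrite c3E; ring.
Qed.

Lemma theta_pow_delta :
  [/\ 18%:R * theta_pow 2 = dlt a,
      216%:R * theta_pow 4 = dlt (dlt a),
      216%:R * (216%:R * theta_pow 6) = 20%:R * dlt (dlt (dlt a)) - K
    & 1296%:R * (1296%:R * theta_pow 8) =
        70%:R * dlt (dlt (dlt (dlt a))) - 8%:R * dlt K].
Proof.
have [e2 e4 e6 e8] := theta_pow_powers; split.
- transitivity (6%:R * (3%:R * theta_pow 2)); first by ring.
  by rewrite e2 /fps_delta; move: (D a) => d; ring.
- transitivity (72%:R * (3%:R * theta_pow 4)); first by ring.
  by rewrite e4 delta2E; move: (D (D a)) => d; ring.
- transitivity (1728%:R * (20%:R * D (D (D a)) - H)); first by rewrite -e6; ring.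
  by rewrite delta3E; move: (D (D (D a))) H => d h; ring.
transitivity (144%:R * (144%:R * (70%:R * D (D (D (D a))) - 8%:R * D H))).
  by rewrite -e8; ring.
rewrite delta3E fps_deltaZ /fps_delta !fps_D_scale.
by move: (D (D (D (D a)))) (D H) => d h; ring.
Qed.

Lemma delta_b3 : dlt (b ^+ 3) = 3%:R * (b ^+ 3 * (E2 - a ^+ 2)).
Proof. by rewrite fps_deltaX delta_b -[3.-1]/2%N; ring. Qed.

Lemma delta_E2_poly : dlt E2 = E2 ^+ 2 - 9%:R * a ^+ 4 + 8%:R * (a * b ^+ 3).
Proof. by rewrite delta_E2 /eis4_poly; ring. Qed.

Lemma L12_8_series : 9%:R * (135%:R * (theta_pow 4 * a ^+ 7) - 54%:R * D (theta_pow 2 * a ^+ 7)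
  + 2%:R * D (D (a ^+ 8))) = 140%:R * (a ^+ 6 * b ^+ 3 * (a ^+ 3 - b ^+ 3)).
Proof.
have [h2 h4 _ _] := theta_pow_delta.
exact: (@fps_natI 23 _ _ (@moments_pow8 _ D dlt (fun=> erefl) fps_deltaM _ _ _
  delta_a delta_b3 delta_E2_poly _ _ h2 h4)).
Qed.

Lemma L6_2_series : 9%:R * (9%:R * (theta_pow 4 * a) - 9%:R * D (theta_pow 2 * a)
  + D (D (a ^+ 2))) = 4%:R * (b ^+ 3 * (a ^+ 3 - b ^+ 3)).
Proof.
have [h2 h4 _ _] := theta_pow_delta.
exact: (@fps_natI 15 _ _ (@moments_pow2 _ D dlt (fun=> erefl) fps_deltaM _ _ _
  delta_a delta_b3 delta_E2_poly _ _ h2 h4)).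
Qed.

Lemma L8_4_series : 45%:R * (theta_pow 4 * a ^+ 3) - 30%:R * D (theta_pow 2 * a ^+ 3)
  + 2%:R * D (D (a ^+ 4)) = 4%:R * (a ^+ 2 * b ^+ 3 * (a ^+ 3 - b ^+ 3)).
Proof.
have [h2 h4 _ _] := theta_pow_delta.
exact: (@fps_natI 71 _ _ (@moments_pow4 _ D dlt (fun=> erefl) fps_deltaM _ _ _
  delta_a delta_b3 delta_E2_poly _ _ h2 h4)).
Qed.

Lemma L12_6_series : 3%:R * (162%:R * (theta_pow 6 * a ^+ 5) - 162%:R * D (theta_pow 4 * a ^+ 5)
    + 36%:R * D (D (theta_pow 2 * a ^+ 5)) - D (D (D (a ^+ 6)))) =
  4%:R * (17%:R * a ^+ 6 * (b ^+ 3) ^+ 2 - 7%:R * a ^+ 9 * b ^+ 3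
    - 10%:R * a ^+ 3 * (b ^+ 3) ^+ 3).
Proof.
have [h2 h4 h6 _] := theta_pow_delta.
exact: (@fps_natI 575 _ _ (@moments_pow6 _ D dlt (fun=> erefl) fps_deltaM _ _ _ _
  delta_a delta_b3 delta_E2_poly theta_hE _ _ _ h2 h4 h6)).
Qed.

Lemma calL4_series : 9%:R * (1215%:R * (theta_pow 8 * a ^+ 3)
    - 2268%:R * D (theta_pow 6 * a ^+ 3) + 1260%:R * D (D (theta_pow 4 * a ^+ 3))
    - 210%:R * D (D (D (theta_pow 2 * a ^+ 3))) + 5%:R * D (D (D (D (a ^+ 4))))) =
  4%:R * (112%:R * a ^+ 3 * (b ^+ 3) ^+ 3 - 20%:R * (b ^+ 3) ^+ 4
    + 81%:R * a ^+ 9 * b ^+ 3 - 173%:R * a ^+ 6 * (b ^+ 3) ^+ 2).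
Proof.
have [h2 h4 h6 h8] := theta_pow_delta.
exact: (@fps_natI 2303 _ _ (@moments_pow4_4 _ D dlt (fun=> erefl) fps_deltaM _ _ _ _
  delta_a delta_b3 delta_E2_poly theta_hE _ _ _ _ h2 h4 h6 h8)).
Qed.

Local Notation y := (b ^+ 3).
Local Notation u := (a ^+ 3 - b ^+ 3).

(** The Cauchy product also contains the term i = n, j = 0, which vanishes with [f 0]. *)
Lemma sigma_convolution r (f : fps rat) n : f 0%N = 0 ->
  \sum_(1 <= i < n.+1) \sum_(1 <= j < n.+1 | (i + j)%N == n) (sigma r i)%:R * f j =
  (sigma_series r * f) n.
Proof.
move=> f0; rewrite fpsM -(big_mkord xpredT (fun i => sigma_series r i * f (n - i)%N)).
rewrite [RHS]big_ltn // mul0r add0r; apply: eq_big_nat => i /andP[i0 lein].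
rewrite (eq_bigl (fun j => j == (n - i)%N)) => [|j]; last by apply/eqP/eqP; lia.
rewrite big_nat1_eq ltnS leq_subr andbT sigma_seriesE //.
by case: posnP => // ->; rewrite f0 mulr0.
Qed.

Section Evaluation.
Variables (n : nat) (c c8 c6 c4 c2 c0 : nat) (f8 f6 f4 f2 f0 : fps rat).
Local Notation ev := (fpsD, fpsN, fps_natM, fps_DE).

Lemma moments2_eval : (c%:R * (c4%:R * f4 - c2%:R * D f2 + D (D f0))) n =
  c%:R * (c4%:R * f4 n - c2%:R * n%:R * f2 n + n%:R ^+ 2 * f0 n).
Proof. by rewrite !ev; ring. Qed.

Lemma moments4_eval : (c4%:R * f4 - c2%:R * D f2 + c0%:R * D (D f0)) n =
  c4%:R * f4 n - c2%:R * n%:R * f2 n + c0%:R * n%:R ^+ 2 * f0 n.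
Proof. by rewrite !ev; ring. Qed.

Lemma moments6_eval :
  (c%:R * (c6%:R * f6 - c4%:R * D f4 + c2%:R * D (D f2) - D (D (D f0)))) n =
  c%:R * (c6%:R * f6 n - c4%:R * n%:R * f4 n + c2%:R * n%:R ^+ 2 * f2 n - n%:R ^+ 3 * f0 n).
Proof. by rewrite !ev; ring. Qed.

Lemma moments8_eval :
  (c%:R * (c8%:R * f8 - c6%:R * D f6 + c4%:R * D (D f4) - c2%:R * D (D (D f2))
    + c0%:R * D (D (D (D f0))))) n =
  c%:R * (c8%:R * f8 n - c6%:R * n%:R * f6 n + c4%:R * n%:R ^+ 2 * f4 n
    - c2%:R * n%:R ^+ 3 * f2 n + c0%:R * n%:R ^+ 4 * f0 n).
Proof. by rewrite !ev; ring. Qed.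

End Evaluation.

Lemma L12_8E n : 9 * (L12_8 n)%:~R = 140 * (a ^+ 6 * y * u) n.
Proof.
have /(congr1 (fun f : fps rat => f n)) := L12_8_series.
rewrite fps_natM moments4_eval fps_natM => <-.
by rewrite L12_8_coef theta_pow0 -exprS.
Qed.

Lemma L6_2E n : 9 * (L6_2 n)%:~R = 4 * (y * u) n.
Proof.
have /(congr1 (fun f : fps rat => f n)) := L6_2_series.
by rewrite moments2_eval fps_natM => <-; rewrite L6_2_coef theta_pow0 -exprS.
Qed.

Lemma L8_4E n : (L8_4 n)%:~R = 4 * (a ^+ 2 * y * u) n.
Proof.
have /(congr1 (fun f : fps rat => f n)) := L8_4_series.
by rewrite moments4_eval fps_natM => <-; rewrite L8_4_coef theta_pow0 -exprS.
Qed.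

Lemma L12_6E n : 3 * (L12_6 n)%:~R =
  4 * (17%:R * a ^+ 6 * y ^+ 2 - 7%:R * a ^+ 9 * y - 10%:R * a ^+ 3 * y ^+ 3) n.
Proof.
have /(congr1 (fun f : fps rat => f n)) := L12_6_series.
by rewrite moments6_eval fps_natM => <-; rewrite L12_6_coef theta_pow0 -exprS.
Qed.

(** The multiplier 15 matches the leading coefficients, 164025 = 15 * 9 * 1215, and adding 4121
    times z2 removes the lower-weight part. *)
Lemma calL4_arith (z1 z2 m v8 v6 v4 v2 v0 p : rat) :
  z1 = 164025%:R * v8 - 306180%:R * m * v6 + 170100%:R * m ^+ 2 * v4 - 28350%:R * m ^+ 3 * v2
    + 675 * m ^+ 4 * v0 - 4121%:R * (45 * v4 - 30 * m * v2 + 2 * m ^+ 2 * v0) ->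
  z2 = 45 * v4 - 30 * m * v2 + 2 * m ^+ 2 * v0 ->
  9 * (1215 * v8 - 2268 * m * v6 + 1260 * m ^+ 2 * v4 - 210 * m ^+ 3 * v2 + 5 * m ^+ 4 * v0)
    = 4 * p ->
  z1 + 4121%:R * z2 = 60 * p.
Proof. by move=> e1 e2 /(congr1 ( *%R 15)); lra. Qed.

Lemma calL4E n : (calL4 n)%:~R + 4121%:R * (L8_4 n)%:~R =
  60 * (112%:R * a ^+ 3 * y ^+ 3 - 20%:R * y ^+ 4 + 81%:R * a ^+ 9 * y
    - 173%:R * a ^+ 6 * y ^+ 2) n.
Proof.
have /(congr1 (fun f : fps rat => f n)) := calL4_series.
rewrite moments8_eval fps_natM.
move: (calL4_coef n) (L8_4_coef n); rewrite theta_pow0 -exprS.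
exact: calL4_arith.
Qed.

(* The coefficient 8167 is split because [ring] does not evaluate numerals above 5000. *)
Lemma tau_series_relation :
  351%:R * (311%:R * (a ^+ 6 * y * u))
  + 972%:R * (17%:R * a ^+ 6 * y ^+ 2 - 7%:R * a ^+ 9 * y - 10%:R * a ^+ 3 * y ^+ 3)
  + 135%:R * (112%:R * a ^+ 3 * y ^+ 3 - 20%:R * y ^+ 4 + 81%:R * a ^+ 9 * y
    - 173%:R * a ^+ 6 * y ^+ 2) =
  9%:R * (4121%:R * (a ^+ 2 * y * u + 240%:R * (sigma_series 3 * (a ^+ 2 * y * u))))
  + 4000%:R * (y * u - 504%:R * (sigma_series 5 * (y * u)))
  + 4167%:R * (y * u - 504%:R * (sigma_series 5 * (y * u)))
  + 932%:R * (73%:R * (27%:R * tau_series)).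
Proof.
transitivity (9%:R * (4121%:R * (E4 * (a ^+ 2 * y * u)))
  + 4000%:R * (E6 * (y * u)) + 4167%:R * (E6 * (y * u)) + 932%:R * (73%:R * (b ^+ 9 * C))).
  have [-> _] := eis6_h; rewrite eis4E c3E /eis4_poly /eis6_poly.
  by move: a b => x z; ring.
rewrite -tau_seriesE /eis4 /eis6.
by move: (a ^+ 2 * _) (y * u) (sigma_series 3) (sigma_series 5) tau_series => *; ring.
Qed.

(** The two sets of constants agree through 351 * 311 = 3 * 36387, 4000 + 4167 = 8167 = 32668 / 4
    and 4 * 932 = 3728. *)
Lemma tau_arith (t l8 l6 l4 l2 l84 s3 s5 v8 p6 p4 v4 v2 w3 w5 : rat) :
  9 * l8 = 140 * v8 -> 3 * l6 = 4 * p6 -> l4 + 4121%:R * l84 = 60 * p4 ->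
  l84 = 4 * v4 -> 9 * l2 = 4 * v2 -> s3 = 4 * w3 -> 9 * s5 = 4 * w5 ->
  351 * (311 * v8) + 972 * p6 + 135 * p4 =
    9 * (4121%:R * (v4 + 240 * w3)) + 4000 * (v2 - 504 * w5) + 4167 * (v2 - 504 * w5)
    + 932 * (73 * (27 * t)) ->
  t = 1 / (73 * 3728) * (36387%:R / 35 * l8 + 108 * l6 + 1 / 3 * l4 - 32668%:R / 12 * l2
    - 329680%:R * s3 + 1372056%:R * s5).
Proof. by lra. Qed.

Lemma L8_4_convolution n :
  \sum_(1 <= i < n.+1) \sum_(1 <= j < n.+1 | (i + j)%N == n) (sigma 3 i)%:R * (L8_4 j)%:~R =
  4 * (sigma_series 3 * (a ^+ 2 * y * u)) n.
Proof.
rewrite -sigma_convolution; last by rewrite 2!fpsM0 fpsD fpsN !fpsX0 theta_a0 theta_b0; ring.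
rewrite mulr_sumr; apply: eq_bigr => i _; rewrite mulr_sumr; apply: eq_bigr => j _.
by rewrite L8_4E mulrCA.
Qed.

Lemma L6_2_convolution n :
  9 * (\sum_(1 <= i < n.+1) \sum_(1 <= j < n.+1 | (i + j)%N == n)
    (sigma 5 i)%:R * (L6_2 j)%:~R) = 4 * (sigma_series 5 * (y * u)) n.
Proof.
rewrite -sigma_convolution; last by rewrite fpsM0 fpsD fpsN !fpsX0 theta_a0 theta_b0; ring.
rewrite !mulr_sumr; apply: eq_bigr => i _; rewrite !mulr_sumr; apply: eq_bigr => j _.
by rewrite [LHS]mulrCA L6_2E mulrCA.
Qed.

Lemma tau_series_eval n (v8 p6 p4 v4 w3 v2 w5 t : fps rat) :
  351%:R * (311%:R * v8) + 972%:R * p6 + 135%:R * p4 =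
    9%:R * (4121%:R * (v4 + 240%:R * w3)) + 4000%:R * (v2 - 504%:R * w5)
    + 4167%:R * (v2 - 504%:R * w5) + 932%:R * (73%:R * (27%:R * t)) ->
  351%:R * (311%:R * v8 n) + 972%:R * p6 n + 135%:R * p4 n =
    9%:R * (4121%:R * (v4 n + 240%:R * w3 n)) + 4000%:R * (v2 n - 504%:R * w5 n)
    + 4167%:R * (v2 n - 504%:R * w5 n) + 932%:R * (73%:R * (27%:R * t n)).
Proof. by move=> /(congr1 (fun f : fps rat => f n)); rewrite !(fpsD, fpsN, fps_natM). Qed.

End CubicThetaFunctions.

Theorem corollary2p4 (n : nat) (hn : (1 <= n)%N) :
  (tau n)%:~R =
    1 / (73 * 3728) *
    (36387%:R / 35 * (L12_8 n)%:~R
     + 108 * (L12_6 n)%:~R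
     + 1 / 3 * (calL4 n)%:~R
     - 32668%:R / 12 * (L6_2 n)%:~R
     - 329680%:R * (\sum_(1 <= a < n.+1) \sum_(1 <= b < n.+1 | (a + b)%N == n)
                   (sigma 3 a)%:R * (L8_4 b)%:~R)
     + 1372056%:R * (\sum_(1 <= a < n.+1) \sum_(1 <= b < n.+1 | (a + b)%N == n)
                    (sigma 5 a)%:R * (L6_2 b)%:~R)) :> rat.
Proof.
exact: (tau_arith (L12_8E n) (L12_6E n) (calL4E n) (L8_4E n) (L6_2E n)
  (L8_4_convolution n) (L6_2_convolution n) (tau_series_eval n tau_series_relation)).
Qed.
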